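(* Let $\Omega\subset\mathbb{R}^N$ be a Friedrichs admissible domain with best Friedrichs constant $c_{\mathsf f}$. Let $$\mathring{B}:\mathring{\mathsf H}^4(\Omega)\subset\mathsf L^2(\Omega)\to\mathsf L^2(\Omega),\qquad\varphi\mapsto\Delta^2\varphi .$$ Then $\mathring{B}$ is densely defined and closed, and its Hilbert space adjoint is $$B:=\mathring{B}^*:\mathsf H(\Delta^2,\Omega)\subset\mathsf L^2(\Omega)\to\mathsf L^2(\Omega),\qquad\varphi\mapsto\Delta^2\varphi .$$ Both ranges are closed, and $$N(\mathring{B})=\{0\},\quad R(\mathring{B})=\mathsf L^2(\Omega)\cap\mathbb{BH}^\perp,\quad N(B)=\mathbb{BH},\quad R(B)=\mathsf L^2(\Omega).$$ The reduced operators $$\mathring{\mathcal B}:\mathring{\mathsf H}^4(\Omega)\to\mathsf L^2(\Omega)\cap\mathbb{BH}^\perp,\qquad \mathcal B:\mathsf H(\Delta^2,\Omega)\cap\mathbb{BH}^\perp\to\mathsf L^2(\Omega)$$ (both acting as $\Delta^2$) are bijective with bounded inverses, and, as operators between $\mathsf L^2$-normed spaces, $$\|\mathring{\mathcal B}^{-1}\|=\|\mathcal B^{-1}\|\le c_{\mathsf f}^4 .$$ Consequently, for each $f\in\mathsf L^2(\Omega)\cap\mathbb{BH}^\perp$ there is a unique $u\in\mathring{\mathsf H}^4(\Omega)$ with $\Delta^2u=f$, and for each $f\in\mathsf L^2(\Omega)$ there is a unique $u\in\mathsf H(\Delta^2,\Omega)$ with $u\perp\mathbb{BH}$ and $\D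elta^2u=f$.
   Context: A domain is a (nonempty) connected open set $\Omega\subset\mathbb{R}^N$, $N\in\mathbb{N}$; no regularity of the boundary is assumed. $\mathring{\mathsf H}^k(\Omega)$ is the closure of the compactly supported smooth functions in $\mathsf H^k(\Omega)$. $\Omega$ is called Friedrichs admissible if there is $c_{\mathsf f}>0$ with $\|\varphi\|_{\mathsf L^2(\Omega)}\le c_{\mathsf f}\|\nabla\varphi\|_{\mathsf L^2(\Omega)}$ for all $\varphi\in\mathring{\mathsf H}^1(\Omega)$; $c_{\mathsf f}$ denotes the best such constant. All differential operators are distributional, $\perp$ is orthogonality in $\mathsf L^2(\Omega)$, and $N(\cdot)$, $R(\cdot)$ denote kernel and range. $\mathsf H(\Delta^2,\Omega):=\{\varphi\in\mathsf L^2(\Omega):\Delta^2\varphi\in\mathsf L^2(\Omega)\}$, $\mathbb{BH}:=\{\varphi\in\mathsf L^2(\Omega):\Delta^2\varphi=0\}$. *)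

(* Defs.v *)
(* Function spaces consist of real-valued functions on R^N = 'rV[R]_N. *)
From HB Require Import structures.
From mathcomp Require Import all_boot all_order all_algebra.
From mathcomp Require Import generic_quotient ring_quotient.
From mathcomp Require Import all_classical all_reals all_analysis.
From mathcomp Require Import measurable_realfun.

Set Implicit Arguments.
Unset Strict Implicit.
Unset Printing Implicit Defensive.
Import Order.TTheory GRing.Theory Num.Theory.
Import numFieldNormedType.Exports.

Local Open Scope classical_set_scope.
Local Open Scope ring_scope.
Local Open Scope quotient_scope.

(** ** Lebesgue measure on R^N *)

(* The measurable sets of R^N form the product of N copies of the Borel
   sigma-algebra of R, i.e. the Borel sigma-algebra of R^N. *)
Definition rV_display : measure_display -> measure_display.
Proof. exact. Qed.

Section measurable_rV.
Context {R : realType} (N : nat).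

Definition rV_coord (i : 'I_N) (x : 'rV[R]_N) : R := x ord0 i.

Let rV_set0 : g_sigma_preimage rV_coord set0.
Proof. exact: sigma_algebra0. Qed.

Let rV_setC A : g_sigma_preimage rV_coord A -> g_sigma_preimage rV_coord (~` A).
Proof. exact: sigma_algebraC. Qed.

Let rV_bigcup (F : _^nat) : (forall i, g_sigma_preimage rV_coord (F i)) ->
  g_sigma_preimage rV_coord (\bigcup_i (F i)).
Proof. exact: sigma_algebra_bigcup. Qed.

HB.instance Definition _ := @isMeasurable.Build (rV_display default_measure_display)
  'rV[R]_N (g_sigma_preimage rV_coord) rV_set0 rV_setC rV_bigcup.

End measurable_rV.

Section measurable_rV_lemmas.
Context {R : realType}.

Lemma measurable_rV_coord N (i : 'I_N) :
  measurable_fun [set: 'rV[R]_N] (@rV_coord R N i).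
Proof.
move=> _ A mA; apply: sub_sigma_algebra; case: N => [|N] in i *; first by case: i.
rewrite -bigcup_mkord_ord; exists i => /=; first exact: ltn_ord.
by exists A => //; rewrite inord_val.
Qed.

Lemma measurable_fun_rVP d (T : measurableType d) N (f : T -> 'rV[R]_N) :
  (forall i, measurable_fun [set: T] (fun t => f t ord0 i)) ->
  measurable_fun [set: T] f.
Proof.
move=> mf; have prefS : g_sigma_preimage (fun i => @rV_coord R N i \o f)
    `<=` measurable.
  apply: smallest_sub; first exact: sigma_algebra_measurable.
  case: N => [|N] in f mf *; first by rewrite big_ord0.
  by rewrite -bigcup_mkord_ord; apply: bigcup_sub => i Ii _ [B mB <-]; exact: mf.
move: prefS; rewrite g_sigma_preimage_comp => prefS _ A mA.
by apply: prefS; exists A.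
Qed.

Lemma open_measurable_rV N (A : set 'rV[R]_N) : open A -> measurable A.
Proof.
move=> oA; pose box (p : 'rV[rat]_N * nat) : set 'rV[R]_N :=
  ball (map_mx ratr p.1 : 'rV[R]_N) (p.2.+1%:R^-1).
have mbox p : measurable (box p).
  have -> : box p = \bigcap_(i in [set: 'I_N])
      ((@rV_coord R N i) @^-1` ball (ratr (p.1 ord0 i) : R) (p.2.+1%:R^-1)).
    apply/seteqP; split=> [x [_ +] i _|x h]; first by move/(_ ord0 i); rewrite mxE.
    by split=> [//|i j]; rewrite ord1 mxE; exact: h.
  apply: fin_bigcap_measurable; first exact: finite_finset.
  move=> i _; rewrite -[X in measurable X]setTI.
  by apply: measurable_rV_coord => //; apply: open_measurable; exact: ball_open.
have -> : A = \bigcup_(p in [set p | box p `<=` A]) box p; last first.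
  rewrite bigcup_mkcond; apply: countable_bigcupT_measurable => [|p].
    exact: countableP.
  by case: ifP.
apply/seteqP; split=> [x Ax|x [p +]]; last exact.
have /nbhs_ballP[e /= e0 eA] : nbhs x A by exact: open_nbhs_nbhs.
have [n ne] : exists n : nat, (n.+1%:R^-1 : R) < e / 2.
  have := @near_infty_natSinv_lt R (PosNum (divr_gt0 e0 (ltr0n R 2))).
  by move=> [n _ /(_ n (leqnn n))] /= h; exists n.
have n0 : (0 : R) < n.+1%:R^-1 by rewrite invr_gt0 ltr0n.
have q_ i : exists q : rat, `|x ord0 i - ratr q| < n.+1%:R^-1.
  have : x ord0 i - n.+1%:R^-1 < x ord0 i + n.+1%:R^-1.
    by rewrite ltrBlDr -addrA ltrDl addr_gt0.
  by move/rat_in_itvoo => [q]; rewrite in_itv/= => xq; exists q; rewrite ltr_distlC.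
have [q qx] := choice q_.
exists (\row_i q i, n).
  move=> y /= [_ qy]; apply: eA; split=> // i j.
  rewrite ord1; have := qy ord0 j; rewrite !mxE /ball/= => qyj.
  rewrite (splitr e) (le_lt_trans (ler_distD (ratr (q j)) _ _))//.
  by rewrite ltrD// (lt_trans _ ne).
by split=> // i j; rewrite ord1 !mxE /ball/= distrC.
Qed.

End measurable_rV_lemmas.

Section lebesgue_rV.
Context {R : realType}.

Definition consrV N (p : measurableTypeR R * 'rV[R]_N) : 'rV[R]_N.+1 :=
  row_mx (p.1 : R)%:M p.2.

Lemma measurable_consrV N : measurable_fun [set: _] (@consrV N).
Proof.
apply: measurable_fun_rVP => i.
case: (@splitP 1 N i) => j ij.
  rewrite (_ : (fun _ => _) = fst); first exact: measurable_fst.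
  apply/funext => p; rewrite /consrV (_ : i = lshift N j); last exact/val_inj.
  by rewrite (@row_mxEl _ 1 1 N) (ord1 j) mxE.
rewrite (_ : (fun _ => _) = @rV_coord R N j \o snd).
  by apply: measurableT_comp; [exact: measurable_rV_coord|exact: measurable_snd].
apply/funext => p; rewrite /consrV (_ : i = rshift 1 j); last exact/val_inj.
by rewrite (@row_mxEr _ 1 1 N).
Qed.

HB.instance Definition _ N :=
  isMeasurableFun.Build _ _ _ _ (@consrV N) (@measurable_consrV N).

(* Product of the Lebesgue measure of R with a measure on R^N, carried to
   R^(N + 1). *)
Definition lebesgue_step N (mu : {measure set 'rV[R]_N -> \bar R}) :=
  pushforward (lebesgue_measure \x^ mu)%E (@consrV N).

Section lebesgue_step_measure.
Context N (mu : {measure set 'rV[R]_N -> \bar R}).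

Let lebesgue_step0 : lebesgue_step mu set0 = 0%E.
Proof. exact: measure0. Qed.

Let lebesgue_step_ge0 A : (0 <= lebesgue_step mu A)%E.
Proof. exact: measure_ge0. Qed.

Let lebesgue_step_sigma_additive : semi_sigma_additive (lebesgue_step mu).
Proof. exact: measure_semi_sigma_additive. Qed.

HB.instance Definition _ := isMeasure.Build _ _ _ (lebesgue_step mu)
  lebesgue_step0 lebesgue_step_ge0 lebesgue_step_sigma_additive.

End lebesgue_step_measure.

Fixpoint lebesgue_rV N : {measure set 'rV[R]_N -> \bar R} :=
  match N with
  | 0 => \d_(0 : 'rV[R]_0)
  | N'.+1 => lebesgue_step (lebesgue_rV N')
  end.

End lebesgue_rV.

(** ** The space L^2 *)

Section L2.
Context d (T : measurableType d) (R : realType) (mu : {measure set T -> \bar R}).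

(* Square-integrable functions, before identification of a.e. equal ones. *)
Local Notation fun2 := (LfunType mu (lee1n 2)).

Definition L2null : {pred fun2} := mem [set f : fun2 | f = 0 %[ae mu]].

Let L2null_zmod_closed : zmod_closed L2null.
Proof.
split=> [|f g]; rewrite !inE/=.
  by apply: filterE => x.
move=> f0 g0; apply: filterS2 f0 g0 => x /(_ I) fx0 /(_ I) gx0 _.
by rewrite [LHS](_ : _ = f x - g x)// fx0 gx0 subr0.
Qed.

HB.instance Definition _ := GRing.isZmodClosed.Build _ L2null L2null_zmod_closed.

Definition L2 : Type := Quotient.quot L2null.
HB.instance Definition _ := GRing.Zmodule.on L2.
HB.instance Definition _ := EqQuotient.on L2.


(* A representative of the class u. *)
Definition L2_repr (u : L2) : T -> R := (repr u : fun2).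
Coercion L2_repr : L2 >-> Funclass.

Lemma eq_L2P (f g : fun2) : \pi_L2 f = \pi_L2 g <-> f = g %[ae mu].
Proof.
have -> : (\pi_L2 f = \pi_L2 g) <-> (f - g \in L2null).
  by rewrite (Quotient.idealrBE L2null); split=> /eqP.
rewrite inE/=; split; apply: filterS => x /(_ I) fg _.
  by apply/eqP; rewrite -subr_eq0; apply/eqP.
by rewrite [LHS](_ : _ = f x - g x)// fg subrr.
Qed.

Lemma L2_reprP (f : fun2) : ((\pi_L2 f : L2) : T -> R) = f %[ae mu].
Proof. by apply/eq_L2P; rewrite reprK. Qed.

Definition L2_scale (a : R) (u : L2) : L2 := \pi_L2 (a *: (repr u : fun2)).

Lemma pi_L2D (f g : fun2) : \pi_L2 (f + g) = \pi_L2 f + \pi_L2 g.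
Proof. exact: pi_addr. Qed.

Lemma pi_L2Z a (f : fun2) : \pi_L2 (a *: f) = L2_scale a (\pi_L2 f).
Proof.
apply/eq_L2P; have := L2_reprP f; apply: filterS => x /(_ I) fx _.
by rewrite [LHS](_ : _ = a * f x)// -fx.
Qed.

Let L2_scaleA a b u : L2_scale a (L2_scale b u) = L2_scale (a * b) u.
Proof. by rewrite -pi_L2Z scalerA. Qed.

Let L2_scale1 : left_id 1 L2_scale.
Proof. by move=> u; rewrite /L2_scale scale1r reprK. Qed.

Let L2_scaleDr : right_distributive L2_scale +%R.
Proof.
by move=> a u v; rewrite -[u]reprK -[v]reprK -pi_L2D -!pi_L2Z scalerDr pi_L2D.
Qed.

Let L2_scaleDl u : {morph L2_scale^~ u : a b / a + b}.
Proof. by move=> a b; rewrite /L2_scale scalerDl pi_L2D. Qed.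

HB.instance Definition _ := GRing.Zmodule_isLmodule.Build R L2
  L2_scaleA L2_scale1 L2_scaleDr L2_scaleDl.

Definition L2_norm (u : L2) : R := fine ('N[mu]_2%:E[EFin \o u])%E.

Let pi_L2_norm (f : fun2) :
  L2_norm (\pi_L2 f) = fine ('N[mu]_2%:E[EFin \o f])%E.
Proof.
rewrite /L2_norm unlock; congr (fine (_ `^ _)%E).
apply: ae_eq_integral => //.
- apply/measurable_EFinP/(@measurableT_comp _ _ _ _ _ _ (@powR R ^~ 2)) => //.
  exact: measurableT_comp.
- apply/measurable_EFinP/(@measurableT_comp _ _ _ _ _ _ (@powR R ^~ 2)) => //.
  exact: measurableT_comp.
- by have := L2_reprP f; apply: filterS => x /(_ I) /= -> _.
Qed.

Let L2_normD u v : L2_norm (u + v) <= L2_norm u + L2_norm v.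
Proof.
by rewrite -[u]reprK -[v]reprK -pi_L2D !pi_L2_norm; exact: ler_LnormD.
Qed.

Let L2_normZ a u : L2_norm (a *: u) = `|a| * L2_norm u.
Proof.
rewrite [a *: u](_ : _ = L2_scale a u)// pi_L2_norm LnormZ fineM//.
by rewrite -finite_norm_fine.
Qed.

Let L2_norm0_eq0 u : L2_norm u = 0 -> u = 0.
Proof.
move=> /fine_Lnormr_eq0 u0; rewrite -[u]reprK.
by rewrite [RHS](_ : _ = \pi_L2 (0 : fun2)); [exact/eq_L2P|rewrite pi_zeror].
Qed.

HB.instance Definition _ := Lmodule_isNormed.Build R L2
  L2_normD L2_normZ L2_norm0_eq0.

Definition L2_dot (u v : L2) : R := \int[mu]_x (u x * v x).

Lemma L2_dotuu u : L2_dot u u = `|u| ^+ 2.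
Proof.
apply: EFin_inj; rewrite -powR_mulrn// -poweR_EFin.
rewrite [X in (X%:E `^ _)%E](_ : _ = L2_norm u)// [X in (X `^ _)%E]finite_norm_fine.
rewrite poweR_Lnorm// /L2_dot /Rintegral fineK.
  by apply: eq_integral => x _ /=; rewrite powR_mulrn// real_normK ?num_real// expr2.
have /Lfun2_integrable_sqr := LfunP (repr u : fun2).
by move/integrable_fin_num; apply.
Qed.

End L2.

Notation "''[' u , v ]" := (L2_dot u v) : ring_scope.

(** ** Unbounded operators *)

Section operators.
Context {d} {T : measurableType d} {R : realType} {mu : {measure set T -> \bar R}}.
Local Notation H := (L2 mu).

(* An operator dom A c H -> H; the values of A outside dom A are irrelevant. *)
Record operator := Operator { dom : set H; op_fun :> H -> H }.
Implicit Types (A B : operator) (D : set H).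

(* H * H carries the product topology. *)
Definition graph A : set (H * H) := [set p | dom A p.1 /\ p.2 = A p.1].

Definition densely_defined A := dense (dom A).

Definition closed_operator A := closed (graph A).

(* B is the Hilbert space adjoint of the densely defined operator A: v lies in
   dom B, with B v = w, exactly when '[A u, v] = '[u, w] for all u in dom A. *)
Definition is_adjoint A B :=
  graph B = [set p | forall u, dom A u -> '[A u, p.1] = '[u, p.2]].

Definition op_kernel A : set H := [set u | dom A u /\ A u = 0].

Definition op_range A : set H := A @` dom A.

Definition L2_perp D : set H := [set u | forall v, D v -> '[u, v] = 0].

(* The inverse of A : dom A -> op_range A when A is injective on dom A; 0 outside
   op_range A. *)
Definition inverse A : H -> H := 'pinv_(fun=> 0) (dom A) A.

(* Boundedness of S : D -> H for the L^2 norm on D and the norm n on S @` D. *)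
Definition bounded_into D (n : H -> R) (S : H -> H) :=
  exists C : R, forall f, D f -> n (S f) <= C * `|f|.

(* The norm of S : D -> H for the L^2 norms, D being a subspace. *)
Definition opnorm D (S : H -> H) : \bar R :=
  ereal_sup [set `|S f|%:E | f in [set f | D f /\ `|f| <= 1]].

End operators.
Arguments operator {d T R} mu.

(** ** Sobolev spaces *)

Record domain (R : realType) (N : nat) := Domain {
  domain_set :> set 'rV[R]_N ;
  domain_neq0 : domain_set !=set0 ;
  domain_open : open domain_set ;
  domain_connected : connected domain_set }.

Arguments domain_neq0 {R N} d.
Arguments domain_open {R N} d.
Arguments domain_connected {R N} d.

Section test_functions.
Context {R : realType} {N : nat}.
Implicit Types (phi : 'rV[R]_N -> R) (a : 'I_N -> nat).

Definition partial (i : 'I_N) phi : 'rV[R]_N -> R :=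
  fun x => 'D_(delta_mx ord0 i) phi x.

(* All iterated partial derivatives, in any order, exist and are continuous. *)
Definition smooth phi := forall s : seq 'I_N,
  let psi := foldr partial phi s in
  continuous psi /\ forall i x, derivable psi x (delta_mx ord0 i).

Definition laplacian phi : 'rV[R]_N -> R :=
  fun x => \sum_(i < N) partial i (partial i phi) x.

Definition mindex_len a : nat := (\sum_(i < N) a i)%N.

Definition mpartial a phi : 'rV[R]_N -> R :=
  foldr (fun i => iter (a i) (partial i)) phi (enum 'I_N).

Definition test_function (Omega : set 'rV[R]_N) phi :=
  smooth phi /\ exists K : set 'rV[R]_N,
    [/\ compact K, K `<=` Omega & forall x, ~ K x -> phi x = 0].

End test_functions.

Section sobolev.
Context {R : realType} {N : nat} (Omega : domain R N).

Definition lebesgue_on : {measure set 'rV[R]_N -> \bar R} :=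
  mrestr (lebesgue_rV N) (open_measurable_rV (domain_open Omega)).

Local Notation mu := lebesgue_on.
Local Notation H := (L2 mu).
Implicit Types (u v f g : H) (a : 'I_N -> nat).

(* g is the distributional derivative of u of multi-index a. *)
Definition is_wpartial a u g := forall psi, test_function Omega psi ->
  \int[mu]_x (u x * mpartial a psi x) =
  (-1) ^+ mindex_len a * \int[mu]_x (g x * psi x).

(* f is the distributional Delta^2 u. *)
Definition is_bilaplacian u f := forall psi, test_function Omega psi ->
  \int[mu]_x (u x * laplacian (laplacian psi) x) = \int[mu]_x (f x * psi x).

(* The elements of L^2 representing these distributions when they exist; 0
   otherwise. *)
Definition wpartial a u : H := xget 0 [set g | is_wpartial a u g].

Definition bilaplacian u : H := xget 0 [set f | is_bilaplacian u f].

Definition Hk (k : nat) : set H := [set u | forall a, (mindex_len a <= k)%N ->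
  exists g, is_wpartial a u g].

Definition Hk_norm k u : R := Num.sqrt
  (\sum_(a : {ffun 'I_N -> 'I_k.+1} | (mindex_len (fun i => a i) <= k)%N)
    `|wpartial (fun i => a i) u| ^+ 2).

Definition Cc_infty : set H :=
  [set v | exists2 phi, test_function Omega phi & (v : 'rV[R]_N -> R) = phi %[ae mu]].

(* The closure of Cc_infty in Hk k for Hk_norm k. *)
Definition H0k k : set H := [set u | Hk k u /\ forall e : R, 0 < e ->
  exists2 v, Cc_infty v & Hk_norm k (u - v) < e].

(* fun j => j == i is the multi-index of the i-th first-order derivative. *)
Definition grad_norm u : R :=
  Num.sqrt (\sum_(i < N) `|wpartial (fun j => j == i) u| ^+ 2).

Definition friedrichs_bound (c : R) :=
  0 < c /\ forall u, H0k 1 u -> `|u| <= c * grad_norm u.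

Definition friedrichs_admissible := exists c, friedrichs_bound c.

Definition friedrichs_constant : R := inf [set c | friedrichs_bound c].

Definition H_bilaplacian : set H := [set u | exists f, is_bilaplacian u f].

(* The graph norm of Delta^2. *)
Definition H_bilaplacian_norm u : R :=
  Num.sqrt (`|u| ^+ 2 + `|bilaplacian u| ^+ 2).

Definition BH : set H := [set u | is_bilaplacian u 0].

Definition B0 : operator mu := Operator (H0k 4) bilaplacian.

Definition B : operator mu := Operator H_bilaplacian bilaplacian.

(* The reduced operator of B0 has the same domain and values as B0; only its
   codomain shrinks. *)
Definition red_B : operator mu := Operator (H_bilaplacian `&` L2_perp BH) bilaplacian.

End sobolev.

Arguments Hk {R N} Omega k.
Arguments Hk_norm {R N} Omega k u.
Arguments Cc_infty {R N} Omega.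
Arguments H0k {R N} Omega k.
Arguments H_bilaplacian {R N} Omega.
Arguments H_bilaplacian_norm {R N} Omega u.
Arguments BH {R N} Omega.
Arguments B0 {R N} Omega.
Arguments B {R N} Omega.
Arguments red_B {R N} Omega.

(* Main.v *)
Require Import Defs.
From HB Require Import structures.
From mathcomp Require Import all_boot all_order all_algebra.
From mathcomp Require Import all_classical all_reals all_analysis.
From mathcomp Require Import generic_quotient ring_quotient.
From mathcomp Require Import measurable_realfun ring lra.

(* By Friedrichs' inequality and integration by parts, |phi| <= c |grad phi| and
   |grad phi|^2 = - <phi, Delta phi> give |grad phi| <= c |Delta phi| and
   |phi| <= c^2 |Delta phi| for test functions, whence |phi| <= c^4 |Delta^2 phi|; since
   moreover the L^2 norm of all second derivatives is |Delta phi|, every derivative of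
   order at most 4 is controlled by |Delta^2 phi|.  Hence the closure of Delta^2 from the
   test functions has domain H0^4 and is bounded below, so its range is closed and equals
   the orthogonal complement of the kernel BH of its adjoint, which is the
   distributional Delta^2.  Riesz representation on that range solves the adjoint
   equation inside BH^perp, and the two reduced inverses are adjoint to each other,
   hence have equal norms. *)

Set Implicit Arguments.
Unset Strict Implicit.
Unset Printing Implicit Defensive.
Import Order.TTheory GRing.Theory Num.Theory.
Import numFieldNormedType.Exports.

Local Open Scope classical_set_scope.
Local Open Scope ring_scope.
Local Open Scope quotient_scope.

(** No regularity of the boundary is available, so every estimate is proved for test functions,
    where integration by parts has no boundary term, and is then carried over by limits. The
    functional analysis is done for a closed linear graph in L^2 x L^2 instead of for an operator:
    closures and adjoints are then plain sets of pairs, and the adjoint of the closure only has to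
    be checked on test pairs, where it is the definition of the distributional Delta^2. Order four
    is reached by using the order-two estimate twice, for the outer two derivatives and, since Delta
    commutes with derivatives, for the inner two applied to Delta phi. Uniqueness of weak
    derivatives and density of the test functions both rest on the fundamental lemma: an element of
    L^2 orthogonal to all test functions is 0. The best Friedrichs constant is an infimum; the bound
    by c^4 is proved for each admissible c and passes to the infimum through fourth roots. *)

Lemma natSinv_eventually_lt (R : realType) (e : R) : 0 < e ->
  exists M, forall n, (M <= n)%N -> n.+1%:R^-1 < e.
Proof.
move=> e0; have [M _ hM] := near_infty_natSinv_lt (PosNum e0).
by exists M => n Mn; exact: hM.
Qed.

Lemma eq0_small (R : realType) (x C : R) : (forall e : R, 0 < e -> `|x| <= e * C) -> x = 0.
Proof.
move=> h; apply/eqP; rewrite -normr_le0; apply/ler_addgt0Pr => e e0; rewrite add0r.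
have C0 : 0 < `|C| + 1 by rewrite ltr_wpDl.
apply: le_trans (h _ (divr_gt0 e0 C0)) _.
rewrite mulrAC ler_pdivrMr//; apply: ler_wpM2l; first exact: ltW.
by apply: le_trans (ler_norm _) _; rewrite lerDl.
Qed.

(** * The Hilbert space L^2 *)

Section L2_theory.
Context d (T : measurableType d) (R : realType) (mu : {measure set T -> \bar R}).
Local Notation H := (L2 mu).
Implicit Types (u v w : H) (f g : T -> R).

Lemma L2_Lfun u : (u : T -> R) \in Lfun mu 2%:E.
Proof. exact: LfunP (repr u). Qed.

Lemma L2_measurable u : measurable_fun setT (u : T -> R).
Proof. by have := L2_Lfun u; rewrite inE => /andP[/[!inE]]. Qed.

Lemma L2_eqP u v : u = v <-> u = v %[ae mu].
Proof. by rewrite -{1}[u]reprK -{1}[v]reprK; exact: eq_L2P. Qed.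

Lemma Lfun2P f : measurable_fun setT f ->
  (\int[mu]_x (f x ^+ 2)%:E < +oo)%E -> f \in Lfun mu 2%:E.
Proof.
move=> mf if2; rewrite inE; apply/andP; split; rewrite inE//= /finite_norm.
rewrite unlock poweR_lty//.
rewrite [ltLHS](_ : _ = \int[mu]_x (f x ^+ 2)%:E)%E//.
by apply: eq_integral => x _ /=; rewrite powR_mulrn// real_normK// num_real.
Qed.

(** Turns a concrete function into its class, 0 being the default when no class agrees with [f]
    almost everywhere; on test functions it is the embedding into L^2. *)
Definition toL2 f : H := xget 0 [set u : H | (u : T -> R) = f %[ae mu]].

Lemma toL2P f : f \in Lfun mu 2%:E -> (toL2 f : T -> R) = f %[ae mu].
Proof.
move=> fL; rewrite /toL2; case: xgetP => [u _ //|h].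
by case: (h (\pi_(L2 mu) (Lfun_Sub (lee1n 2) fL))); exact: L2_reprP.
Qed.

Lemma toL2_eq u f : (u : T -> R) = f %[ae mu] -> toL2 f = u.
Proof.
move=> uf; rewrite /toL2; case: xgetP => [v _ vf|/(_ u)//].
by apply/L2_eqP; exact: ae_eq_trans vf (ae_eq_sym uf).
Qed.

Lemma L2D_ae u v : ((u + v : H) : T -> R) = (fun x => u x + v x) %[ae mu].
Proof.
(* Naming the sum [w] keeps [reprK] away from the representatives of [u] and [v] on the right-hand
   side. *)
suff h w : w = \pi_(L2 mu) (repr u + repr v) ->
    (w : T -> R) = (fun x => u x + v x) %[ae mu].
  by apply: h; rewrite pi_L2D !reprK.
by move=> wE; subst w; apply: ae_eq_trans (L2_reprP _) _; apply: filterE.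
Qed.

Lemma L2Z_ae a u : ((a *: u : H) : T -> R) = (fun x => a * u x) %[ae mu].
Proof.
by apply: ae_eq_trans (L2_reprP _) _; apply: filterE.
Qed.

Lemma L20_ae : ((0 : H) : T -> R) = (fun=> 0) %[ae mu].
Proof.
suff h w : w = \pi_(L2 mu) 0 -> (w : T -> R) = (fun=> 0) %[ae mu].
  by apply: h; rewrite pi_zeror.
by move=> wE; subst w; apply: ae_eq_trans (L2_reprP _) _; apply: filterE.
Qed.

Lemma L2N_ae u : ((- u : H) : T -> R) = (fun x => - u x) %[ae mu].
Proof.
suff h w : w = - 1 *: u -> (w : T -> R) = (fun x => - u x) %[ae mu].
  by apply: h; rewrite scaleN1r.
move=> wE; subst w; apply: ae_eq_trans (L2Z_ae _ _) _.
by apply: filterE => x _; rewrite mulN1r.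
Qed.

Lemma L2B_ae u v : ((u - v : H) : T -> R) = (fun x => u x - v x) %[ae mu].
Proof.
apply: ae_eq_trans (L2D_ae _ _) _.
by have := L2N_ae v; apply: filterS => x /(_ I) /= -> _.
Qed.

Lemma ae_eq_Rintegral f g : measurable_fun setT f -> measurable_fun setT g ->
  f = g %[ae mu] -> \int[mu]_x f x = \int[mu]_x g x.
Proof.
move=> mf mg fg; rewrite /Rintegral; congr fine; apply: ae_eq_integral => //.
- exact/measurable_EFinP.
- exact/measurable_EFinP.
- by apply: filterS fg => x /(_ I) /= -> _.
Qed.

Lemma Lfun2_mul_integrable f g : f \in Lfun mu 2%:E -> g \in Lfun mu 2%:E ->
  mu.-integrable setT (EFin \o (fun x => f x * g x)).
Proof. by move=> fL gL; apply/Lfun1_integrable; exact: Lfun2_mul_Lfun1. Qed.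

Lemma Lfun_measurable f : f \in Lfun mu 2%:E -> measurable_fun setT f.
Proof. by rewrite inE => /andP[/[!inE]]. Qed.

Lemma L2_dotE u g : g \in Lfun mu 2%:E -> '[u, toL2 g] = \int[mu]_x (u x * g x).
Proof.
move=> gL; apply: ae_eq_Rintegral.
- by apply: measurable_funM; exact: L2_measurable.
- by apply: measurable_funM; [exact: L2_measurable|exact: Lfun_measurable].
- by have := toL2P gL; apply: filterS => x /(_ I) -> _.
Qed.

Lemma L2_dotC u v : '[u, v] = '[v, u].
Proof. by apply: eq_Rintegral => x _; rewrite mulrC. Qed.

Lemma L2_dotDl u v w : '[u + v, w] = '[u, w] + '[v, w].
Proof.
rewrite -RintegralD//; [|exact: Lfun2_mul_integrable (L2_Lfun _) (L2_Lfun _)..].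
apply: ae_eq_Rintegral.
- by apply: measurable_funM; exact: L2_measurable.
- by apply: measurable_funD; apply: measurable_funM; exact: L2_measurable.
- by have := L2D_ae u v; apply: filterS => x /(_ I) -> _; rewrite mulrDl.
Qed.

Lemma L2_dotZl a u v : '[a *: u, v] = a * '[u, v].
Proof.
rewrite -RintegralZl//; last exact: Lfun2_mul_integrable (L2_Lfun _) (L2_Lfun _).
apply: ae_eq_Rintegral.
- by apply: measurable_funM; exact: L2_measurable.
- by apply: measurable_funM => //; apply: measurable_funM; exact: L2_measurable.
- by have := L2Z_ae a u; apply: filterS => x /(_ I) -> _; rewrite mulrA.
Qed.

Lemma L2_dotNl u v : '[- u, v] = - '[u, v].
Proof. by rewrite -scaleN1r L2_dotZl mulN1r. Qed.
Lemma L2_dotBl u v w : '[u - v, w] = '[u, w] - '[v, w].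
Proof. by rewrite L2_dotDl L2_dotNl. Qed.
Lemma L2_dotDr u v w : '[w, u + v] = '[w, u] + '[w, v].
Proof. by rewrite L2_dotC L2_dotDl ![ '[w, _] ]L2_dotC. Qed.
Lemma L2_dotZr a u v : '[v, a *: u] = a * '[v, u].
Proof. by rewrite L2_dotC L2_dotZl L2_dotC. Qed.
Lemma L2_dotBr u v w : '[w, u - v] = '[w, u] - '[w, v].
Proof. by rewrite L2_dotC L2_dotBl ![ '[w, _] ]L2_dotC. Qed.
Lemma L2_dot0l v : '[0, v] = 0.
Proof. by rewrite -(scale0r v) L2_dotZl mul0r. Qed.
Lemma L2_dot0r v : '[v, 0] = 0.
Proof. by rewrite L2_dotC L2_dot0l. Qed.

Lemma L2_dotuu_eq0 u : '[u, u] = 0 -> u = 0.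
Proof. by rewrite L2_dotuu => /eqP; rewrite sqrf_eq0 normr_eq0 => /eqP. Qed.

(** Expands the squared norm of [u] minus its component along [v], which is nonnegative. *)
Lemma L2_CauchySchwarz u v : `|'[u, v]| <= `|u| * `|v|.
Proof.
have [->|v0] := eqVneq v 0; first by rewrite L2_dot0r !normr0 mulr0.
have nv : 0 < `|v| ^+ 2 by rewrite exprn_gt0// normr_gt0.
rewrite -ler_sqr ?nnegrE ?mulr_ge0// exprMn real_normK ?num_real//.
have : 0 <= '[u - ('[u, v] / `|v| ^+ 2) *: v, u - ('[u, v] / `|v| ^+ 2) *: v].
  by rewrite L2_dotuu sqr_ge0.
rewrite L2_dotBl !L2_dotBr !L2_dotZl !L2_dotZr [ '[v, u] ]L2_dotC !L2_dotuu.
rewrite divfK ?gt_eqF// subrr subr0 subr_ge0 mulrAC ler_pdivrMr//.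
Qed.

Lemma L2_norm_dual (C : R) u : 0 <= C -> '[u, u] <= C * `|u| -> `|u| <= C.
Proof.
move=> C0; rewrite L2_dotuu expr2; have [->//|u0] := eqVneq u 0.
  by rewrite normr0.
by rewrite ler_pM2r// normr_gt0.
Qed.

Lemma L2_parallelogram u v :
  `|u + v| ^+ 2 + `|u - v| ^+ 2 = 2 * `|u| ^+ 2 + 2 * `|v| ^+ 2.
Proof.
rewrite -!L2_dotuu L2_dotBl !L2_dotDl !L2_dotBr !L2_dotDr; ring.
Qed.

Lemma L2_norm_toL2 f : f \in Lfun mu 2%:E ->
  (`|toL2 f| ^+ 2)%:E = (\int[mu]_x (f x ^+ 2)%:E)%E.
Proof.
move=> fL; rewrite -L2_dotuu L2_dotE// (_ : Rintegral _ _ _ = \int[mu]_x (f x * f x)).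
  rewrite fineK; first by apply: eq_integral => x _; rewrite expr2.
  by have /integrable_fin_num := Lfun2_mul_integrable fL fL; apply.
apply: ae_eq_Rintegral.
- by apply: measurable_funM; [exact: L2_measurable|exact: Lfun_measurable].
- by apply: measurable_funM; exact: Lfun_measurable.
- by have := toL2P fL; apply: filterS => x /(_ I) -> _.
Qed.

Lemma L2_norm_integral u : (`|u| ^+ 2)%:E = (\int[mu]_x (u x ^+ 2)%:E)%E.
Proof.
rewrite -L2_norm_toL2 ?L2_Lfun// (_ : toL2 _ = u)//.
by apply: toL2_eq; exact: filterE.
Qed.

End L2_theory.

(** * Closedness and convergence in terms of the norm *)

Section normed_sequences.
Context (R : realType) (V : normedModType R).

Lemma closed_normP (K : set V) : closed K <->
  forall x, (forall e : R, 0 < e -> exists2 k, K k & `|x - k| < e) -> K x.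
Proof.
split=> [cK x hx|h].
  apply: cK => B /nbhs_ballP[e /= e0 eB]; have [k Kk xk] := hx _ e0.
  by exists k; split=> //; apply: eB; rewrite -ball_normE.
move=> x clx; apply: h => e e0.
have [k [Kk]] := clx _ (nbhsx_ballx x e e0).
by rewrite -ball_normE => xk; exists k.
Qed.

Lemma cvg_normP (u : nat -> V) l : u @ \oo --> l <->
  forall e : R, 0 < e -> exists M, forall n, (M <= n)%N -> `|u n - l| < e.
Proof.
split=> [/cvgrPdist_lt ul e e0|h].
  have [M _ hM] := ul _ e0; exists M => n Mn; rewrite distrC; exact: hM.
apply/cvgrPdist_lt => e e0; have [M hM] := h _ e0.
by exists M => // n /= Mn; rewrite distrC; exact: hM.
Qed.

End normed_sequences.

(** * Completeness of L^2 *)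

Section L2_complete.
Context d (T : measurableType d) (R : realType) (mu : {measure set T -> \bar R}).
Local Notation H := (L2 mu).

Let a (k : nat) : R := (2 ^ k.+1)%:R^-1.

Let a_gt0 k : 0 < a k. Proof. by rewrite invr_gt0 ltr0n expn_gt0. Qed.
Let a_le1 k : a k <= 1.
Proof. by rewrite invf_le1 ?ler1n ?ltr0n expn_gt0. Qed.

Let a_cvg : cvgn (series a).
Proof.
have -> : a = geometric (2^-1 : R) 2^-1.
  by apply/funext => k; rewrite /geometric /= /a natrX -exprVn exprS.
by apply: is_cvg_geometric_series; rewrite ger0_norm// invf_lt1// ltr1n.
Qed.

(** A bound on each weighted square already makes the increments at most sqrt C times [a k], which
    is summable. *)
Let fast_cvg (f : nat -> R) (C : R) :
  (forall k, (a k)^-1 ^+ 2 * (f k.+1 - f k) ^+ 2 <= C) -> cvgn f.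
Proof.
move=> hC.
have bnd k : `|f k.+1 - f k| <= Num.sqrt C * a k.
  have C0 : 0 <= C by apply: le_trans (hC 0%N); rewrite mulr_ge0// sqr_ge0.
  rewrite -ler_pdivrMr// -ler_sqr ?nnegrE ?divr_ge0 ?sqrtr_ge0 ?(ltW (a_gt0 k))//.
  by rewrite sqr_sqrtr// (le_trans _ (hC k))// exprMn real_normK ?num_real// mulrC.
have : cvgn (series (telescope f)).
  apply: normed_cvg; apply: series_le_cvg (is_cvg_seriesZ (k := Num.sqrt C) a_cvg).
  - by move=> n; exact: normr_ge0.
  - by move=> n; rewrite mulr_ge0 ?sqrtr_ge0// ltW.
  - by move=> n /=; exact: bnd.
move=> cs; rewrite (_ : f = (fun n => f 0%N + series (telescope f) n)).
  by apply: is_cvgD => //; exact: is_cvg_cst.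
by apply/funext => n; exact: eq_sum_telescope.
Qed.

(* Riesz-Fischer: along a subsequence [f] with [|f k.+1 - f k| <= 2 a_k^2] the series
   [\sum_k a_k^-2 (f k.+1 - f k)^2] has finite integral, hence converges almost everywhere,
   which makes [f k x] converge geometrically. *)
Lemma L2_complete (u : nat -> H) :
  (forall e : R, 0 < e -> exists M, forall m n, (M <= m)%N -> (M <= n)%N ->
    `|u m - u n| < e) ->
  exists l : H, u @ \oo --> l.
Proof.
move=> cu.
(* The squared increments are at most 4 a_k^4, so even after division by a_k^2 they are summable;
   [k <= n_ k] puts [f k] beyond any index [M] as soon as [M <= k]. *)
have /choice[n_ n_P] : forall k, exists n, (k <= n)%N /\
    forall m, (n <= m)%N -> `|u m - u n| <= a k ^+ 2.
  move=> k.
  have [M hM] := cu _ (exprn_gt0 2 (a_gt0 k)).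
  exists (maxn M k); split=> [|m hm]; first exact: leq_maxr.
  apply/ltW/hM; last exact: leq_maxl.
  by rewrite (leq_trans _ hm)// leq_maxl.
pose f k : H := u (n_ k).
have fS k : `|f k.+1 - f k| <= 2 * a k ^+ 2.
  pose M := maxn (n_ k) (n_ k.+1).
  rewrite (le_trans (ler_distD (u M) _ _))// distrC mulr_natl mulr2n lerD//.
    rewrite (le_trans (proj2 (n_P _) _ _)) ?leq_maxr//.
    rewrite lerXn2r ?nnegrE ?(ltW (a_gt0 _))//.
    by rewrite lef_pV2 ?posrE ?ltr0n ?expn_gt0// ler_nat leq_exp2l.
  by rewrite (proj2 (n_P _))// leq_maxl.
have mf k : measurable_fun setT (f k : T -> R) := L2_measurable _.
pose G k x : \bar R := ((a k)^-1 ^+ 2 * (f k.+1 x - f k x) ^+ 2)%:E.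
have G0 k x : (0 <= G k x)%E by rewrite lee_fin mulr_ge0// sqr_ge0.
have mG k : measurable_fun setT (G k).
  apply/measurable_EFinP; apply: measurable_funM => //.
  by apply: measurable_funX; exact: measurable_funB.
have iG k : (\int[mu]_x G k x <= (8 / (2 ^ k.+1)%:R)%:E)%E.
  have -> : (\int[mu]_x G k x = ((a k)^-1 ^+ 2 * `|f k.+1 - f k| ^+ 2)%:E)%E.
    rewrite EFinM L2_norm_integral -ge0_integralZl//.
    - apply: ae_eq_integral => //.
      + apply: emeasurable_funM => //; apply/measurable_EFinP.
        by apply: measurable_funX; exact: L2_measurable.
      + have := L2B_ae (f k.+1) (f k); apply: filterS => x /(_ I) fx _.
        by rewrite -EFinM fx.
    - by apply/measurable_EFinP; apply: measurable_funX; exact: L2_measurable.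
    - by move=> x _; rewrite lee_fin sqr_ge0.
    - by rewrite lee_fin sqr_ge0.
  rewrite lee_fin -/(a k); rewrite exprVn mulrC ler_pdivrMr ?exprn_gt0//.
  have : `|f k.+1 - f k| ^+ 2 <= (2 * a k ^+ 2) ^+ 2.
    by rewrite lerXn2r ?nnegrE// mulr_ge0// sqr_ge0.
  move/le_trans; apply; have := a_le1 k; have := a_gt0 k; move: (a k) => b b0 b1.
  rewrite (_ : _ ^+ 2 = 4 * b * b ^+ 3); last by ring.
  rewrite (_ : 8 * _ * _ = 8 * b ^+ 3); last by ring.
  by rewrite ler_wpM2r ?exprn_ge0 ?(ltW b0)//; lra.
have SG : {ae mu, forall x, (\sum_(k <oo) G k x)%E \is a fin_num}.
  have /integrable_ae : mu.-integrable setT (fun x => \sum_(k <oo) G k x)%E.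
    apply/integrableP; split; first exact: ge0_emeasurable_sum.
    rewrite (eq_integral (fun x => \sum_(k <oo) G k x)%E); last first.
      by move=> x _; rewrite gee0_abs// nneseries_ge0.
    rewrite integral_nneseries//; apply: le_lt_trans (ltry 8%R).
    rewrite (le_trans _ (epsilon_trick0 xpredT (ler0n R 8)))//.
    by apply: lee_nneseries => [k _ _|k _]; [exact: integral_ge0|exact: iG].
  by move/(_ measurableT); apply: filterS => x /(_ I).
(* An upper limit is measurable everywhere, whatever happens on the null set where the series
   diverges. *)
pose F x := fine (limn_esup (fun k => (f k x)%:E)).
have fF : {ae mu, forall x, (fun k => f k x) @ \oo --> F x}.
  apply: filterS SG => x Gx.
  have /cvg_ex[l fl] : cvgn (fun k => f k x).
    apply: (@fast_cvg _ (fine (\sum_(k <oo) G k x)%E)) => k.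
    rewrite -lee_fin fineK//.
    rewrite (@nneseriesD1 _ _ k)//.
    by rewrite leeDl// nneseries_ge0.
  rewrite /F; suff -> : limn_esup (fun k => (f k x)%:E) = l%:E by [].
  have : (fun k => (f k x)%:E) @ \oo --> l%:E by apply: cvg_EFin => //; exact: nearW.
  by move/cvg_limn_einf_sup => [].
have mF : measurable_fun setT F.
  apply: measurableT_comp; first exact: fine_measurable.
  by apply: measurable_fun_limn_esup => k; exact/measurable_EFinP.
(* Fatou's lemma along the subsequence carries a Cauchy bound over to [F]. With e = 1 it makes [F]
   square-integrable, with small e it gives convergence of the whole sequence. *)
have key (e : R) M : 0 <= e -> (forall m n, (M <= m)%N -> (M <= n)%N ->
    `|u m - u n| <= e) -> forall m, (M <= m)%N ->
    (\int[mu]_x ((F x - u m x) ^+ 2)%:E <= (e ^+ 2)%:E)%E.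
  move=> e0 hM m Mm.
  pose P k x : \bar R := ((f k x - u m x) ^+ 2)%:E.
  have mP k : measurable_fun setT (P k).
    apply/measurable_EFinP; apply: measurable_funX.
    by apply: measurable_funB; [exact: mf|exact: L2_measurable].
  rewrite (@ae_eq_integral _ _ _ mu setT (fun x => limn_einf (P ^~ x)))//.
  - apply: le_trans (fatou _ _ mP _) _ => //.
      by move=> k x _; rewrite lee_fin sqr_ge0.
    rewrite limn_einf_lim; apply: lime_le; first exact: is_cvg_einfs.
    exists M => // k /= Mk; apply: (@le_trans _ _ (\int[mu]_x P k x)%E).
      by apply: ereal_inf_lbound; exists k => /=.
    have -> : (\int[mu]_x P k x = (`|f k - u m| ^+ 2)%:E)%E.
      rewrite L2_norm_integral; apply: ae_eq_integral => //.
        by apply/measurable_EFinP; apply: measurable_funX; exact: L2_measurable.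
      by have := L2B_ae (f k) (u m); apply: filterS => x /(_ I) fx _; rewrite fx.
    rewrite lee_fin lerXn2r ?nnegrE// hM//.
    by rewrite (leq_trans Mk)//; have [] := n_P k.
  - apply/measurable_EFinP; apply: measurable_funX.
    by apply: measurable_funB; [exact: mF|exact: L2_measurable].
  - rewrite /limn_einf; apply: measurableT_comp => //.
    by apply: measurable_fun_limn_esup => k; exact: measurableT_comp.
  - apply: filterS fF => x fx _; apply/esym.
    have : (P ^~ x) @ \oo --> ((F x - u m x) ^+ 2)%:E.
      apply: cvg_EFin; first exact: nearW.
      have h : (fun k => f k x - u m x) @ \oo --> F x - u m x.
        by apply: cvgB => //; exact: cvg_cst.
      exact: (cvgM h h).
    by move/cvg_limn_einf_sup => [].
have LF : F \in Lfun mu 2%:E.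
  have [M hM] := cu _ ltr01.
  have /(_ ler01 _ M (leqnn M)) kM := key 1 M.
  have L1 : (fun x => F x - u M x) \in Lfun mu 2%:E.
    apply: Lfun2P; first by apply: measurable_funB => //; exact: L2_measurable.
    by apply: le_lt_trans (kM _) (ltry _) => m n Mm Mn; rewrite ltW// hM.
  have -> : F = ((fun x => F x - u M x) + (u M : T -> R))%R.
    by apply/funext => x /=; rewrite -[RHS]/(F x - u M x + u M x) subrK.
  exact: (proj2 (Lfun_addr_closed mu (lee1n 2)) _ _ L1 (L2_Lfun (u M))).
exists (toL2 mu F); apply/cvg_normP => e e0.
have [M hM] := cu _ (divr_gt0 e0 (ltr0n R 2)).
exists M => m Mm; apply: (@le_lt_trans _ _ (e / 2)); last first.
  by rewrite ltr_pdivrMr// ltr_pMr// ltr1n.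
rewrite distrC -(@ler_sqr R) ?nnegrE ?divr_ge0 ?(ltW e0)//.
rewrite -lee_fin L2_norm_integral.
apply: le_trans (key (e / 2) M _ _ m Mm) => //; last 2 first.
- by rewrite divr_ge0// ltW.
- by move=> i j Mi Mj; rewrite ltW// hM.
rewrite (@ae_eq_integral _ _ _ mu setT (fun x => ((F x - u m x) ^+ 2)%:E))//.
- by apply/measurable_EFinP; apply: measurable_funX; exact: L2_measurable.
- apply/measurable_EFinP; apply: measurable_funX.
  by apply: measurable_funB; [exact: mF|exact: L2_measurable].
- have := L2B_ae (toL2 mu F) (u m); have := toL2P LF.
  by apply: filterS2 => x /(_ I) h1 /(_ I) h2 _; rewrite h2 h1.
Qed.

End L2_complete.

Lemma closed_prodP (R : realType) (V W : normedModType R) (G : set (V * W)) :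
  closed G <-> forall p, (forall e : R, 0 < e ->
    exists q, [/\ G q, `|p.1 - q.1| < e & `|p.2 - q.2| < e]) -> G p.
Proof.
split=> [cG p hp|h].
  apply: cG => B [[B1 B2] /= [/nbhs_ballP[e1 /= e10 eB1] /nbhs_ballP[e2 /= e20 eB2]] B12].
  have e0 : 0 < Num.min e1 e2 by rewrite lt_min e10.
  have [q [Gq]] := hp _ e0; rewrite !lt_min => /andP[q1 _] /andP[_ q2].
  exists q; split=> //; apply: B12; split; [apply: eB1|apply: eB2];
    by rewrite -ball_normE.
move=> p clp; apply: h => e e0.
have : nbhs p (ball p.1 e `*` ball p.2 e).
  by exists (ball p.1 e, ball p.2 e) => //=; split; exact: nbhsx_ballx.
by move=> /clp[q [Gq /= []]]; rewrite -!ball_normE => q1 q2; exists q.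
Qed.

(** * Orthogonal projection and Riesz representation *)

Section hilbert.
Context d (T : measurableType d) (R : realType) (mu : {measure set T -> \bar R}).
Local Notation H := (L2 mu).
Implicit Types (u v w x y k : H).

Lemma L2_sqr_normB u v : `|u - v| ^+ 2 = `|u| ^+ 2 - 2 * '[u, v] + `|v| ^+ 2.
Proof.
by rewrite -!L2_dotuu L2_dotBl !L2_dotBr [ '[v, u] ]L2_dotC; ring.
Qed.

Definition subspace (K : set H) :=
  K !=set0 /\ forall (a : R) u v, K u -> K v -> K (a *: u + v).

Lemma subspace0 K : subspace K -> K 0.
Proof.
move=> [[k Kk] sK]; rewrite (_ : 0 = (- 1) *: k + k); first exact: sK.
by rewrite scaleN1r addNr.
Qed.

Lemma subspaceZ K a u : subspace K -> K u -> K (a *: u).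
Proof.
by move=> sK Ku; rewrite -[X in K X]addr0; apply: sK.2 => //; exact: subspace0.
Qed.

Lemma subspaceB K u v : subspace K -> K u -> K v -> K (u - v).
Proof. by move=> sK Ku Kv; rewrite addrC -scaleN1r; apply: sK.2. Qed.

(** Orthogonality is prepared before the limit: a near-minimiser [k_ n] is orthogonal to [K] up to
    [a n], and this error vanishes along the minimising sequence. *)
Lemma L2_projection (K : set H) x : closed K -> subspace K ->
  exists2 p, K p & forall k, K k -> '[x - p, k] = 0.
Proof.
move=> cK sK; have K0 := subspace0 sK.
pose S := [set `|x - k| ^+ 2 | k in K].
have S0 : S !=set0 by exists (`|x - 0| ^+ 2), 0.
have lbS : lbound S 0 by move=> _ [k Kk <-]; rewrite sqr_ge0.
have infS : has_inf S by split=> //; exists 0.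
pose D := inf S.
have DP k : K k -> D <= `|x - k| ^+ 2.
  by move=> Kk; apply: ge_inf; [exists 0|exists k].
pose a (n : nat) : R := n.+1%:R^-1.
have a0 n : 0 < a n by rewrite invr_gt0 ltr0n.
have small (e : R) : 0 < e -> exists M, forall n, (M <= n)%N -> a n < e.
  exact: natSinv_eventually_lt.
have /choice[k_ k_P] : forall n, exists k, K k /\ `|x - k| ^+ 2 < D + a n ^+ 2.
  move=> n; have [_ [k Kk <-] kD] := inf_adherent (exprn_gt0 2 (a0 n)) infS.
  by exists k.
(* Moving [k_ n] by the optimal multiple of [k] lowers the squared distance by b^2 / |k|^2, which
   cannot exceed the remaining gap [a n ^+ 2]. *)
have ortho n k : K k -> `|'[x - k_ n, k]| <= a n * `|k|.
  move=> Kk; have [->|k0] := eqVneq k 0; first by rewrite L2_dot0r !normr0 mulr0.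
  have nk : 0 < `|k| ^+ 2 by rewrite exprn_gt0// normr_gt0.
  set b := '[_, _].
  rewrite -ler_sqr ?nnegrE ?mulr_ge0 ?(ltW (a0 n))// exprMn real_normK ?num_real//.
  have := DP _ (sK.2 (b / `|k| ^+ 2) _ _ Kk (k_P n).1).
  set c := b / _; have cb : c * `|k| ^+ 2 = b by rewrite divfK// gt_eqF.
  have -> : x - (c *: k + k_ n) = (x - k_ n) - c *: k by rewrite opprD addrCA addrC.
  rewrite L2_sqr_normB L2_dotZr -/b normrZ exprMn real_normK ?num_real// => Db.
  move: (`|k| ^+ 2) (`|x - k_ n| ^+ 2) Db cb nk (k_P n).2 => q y2 Db cb q0 y2D.
  rewrite -{1}cb.
  have -> : (c * q) ^+ 2 = (c * b) * q by rewrite -cb; ring.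
  rewrite ler_wpM2r ?(ltW q0)//; move: Db.
  have -> : c ^+ 2 * q = c * b by rewrite expr2 -mulrA cb.
  lra.
have [p k_p] : exists p : H, k_ @ \oo --> p.
  apply: L2_complete => e e0; have [M hM] := small _ (divr_gt0 e0 (ltr0n R 3)).
  exists M => m n Mm Mn.
  (* The midpoint lies in [K], so the parallelogram law gives |k_m - k_n|^2 < 2 a_m^2 + 2 a_n^2;
     with both weights below e / 3 this is less than e^2. *)
  have Kmn : K (2^-1 *: k_ m + 2^-1 *: k_ n).
    by apply: sK.2; [exact: (k_P m).1|apply: subspaceZ => //; exact: (k_P n).1].
  have := L2_parallelogram (x - k_ m) (x - k_ n).
  have -> : x - k_ m + (x - k_ n) = 2 *: (x - (2^-1 *: k_ m + 2^-1 *: k_ n)).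
    rewrite scalerBr scalerDr !scalerA !divff ?pnatr_eq0// !scale1r scaler_nat.
    by rewrite mulr2n addrACA opprD.
  have -> : x - k_ m - (x - k_ n) = k_ n - k_ m.
    by rewrite opprB addrC addrA subrK.
  rewrite normrZ exprMn ger0_norm// (distrC (k_ n)) => hp.
  have h1 := DP _ Kmn; have h2 := (k_P m).2; have h3 := (k_P n).2.
  have := hM _ Mm; have := hM _ Mn; have := a0 m; have := a0 n => n0 m0 ne me.
  rewrite -ltr_sqr ?nnegrE ?(ltW e0)//.
  have : a m ^+ 2 < (e / 3) ^+ 2 by rewrite ltr_sqr ?nnegrE ?(ltW m0)// ltW// divr_gt0.
  have : a n ^+ 2 < (e / 3) ^+ 2 by rewrite ltr_sqr ?nnegrE ?(ltW n0)// ltW// divr_gt0.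
  have -> : (e / 3) ^+ 2 = e ^+ 2 / 9 by field.
  have := exprn_gt0 2 e0; lra.
have /cvg_normP pP := k_p.
exists p.
  move/closed_normP: cK; apply=> e e0; have [M /(_ M (leqnn M)) hM] := pP _ e0.
  by exists (k_ M); [exact: (k_P M).1|rewrite distrC].
move=> k Kk; apply: (@eq0_small _ _ `|k|) => e e0.
have e20 := divr_gt0 e0 (ltr0n R 2).
have [M1 hM1] := pP _ e20; have [M2 hM2] := small _ e20.
pose M := maxn M1 M2.
have -> : x - p = (x - k_ M) + (k_ M - p) by rewrite addrA subrK.
rewrite L2_dotDl (le_trans (ler_normD _ _))// (splitr e) mulrDl lerD//.
  apply: le_trans (ortho M _ Kk) _; rewrite ler_wpM2r//.
  by apply/ltW/hM2; exact: leq_maxr.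
apply: le_trans (L2_CauchySchwarz _ _) _; rewrite ler_wpM2r//.
by apply/ltW/hM1; exact: leq_maxl.
Qed.

Lemma L2_perp_perp (K : set H) : closed K -> subspace K -> L2_perp (L2_perp K) = K.
Proof.
move=> cK sK; apply/seteqP; split=> [x xp|k Kk v vK]; last first.
  by rewrite L2_dotC; apply: vK.
have [p Kp pP] := L2_projection x cK sK.
suff /eqP : x - p = 0 by rewrite subr_eq0 => /eqP ->.
apply: L2_dotuu_eq0; rewrite L2_dotBr (pP _ Kp) L2_dotC.
by rewrite (xp (x - p)) ?subr0.
Qed.

(** The functional is controlled only on [V], so its kernel [K] is taken inside [V]. The
    representing vector is a multiple of the component [w] orthogonal to [K] of some [x0] in [V]
    outside [K]. *)
Lemma L2_Riesz (V : set H) (l : H -> R) (C : R) : closed V -> subspace V ->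
  (forall a u v, V u -> V v -> l (a *: u + v) = a * l u + l v) ->
  (forall u, V u -> `|l u| <= C * `|u|) ->
  exists2 v, V v & forall u, V u -> l u = '[u, v].
Proof.
move=> cV sV ll lC; have V0 := subspace0 sV.
have l0 : l 0 = 0 by have := ll (-1) 0 0 V0 V0; rewrite scaler0 addr0 mulN1r addNr.
have lZ a u : V u -> l (a *: u) = a * l u.
  by move=> Vu; have := ll a u 0 Vu V0; rewrite addr0 l0 addr0.
have lB u v : V u -> V v -> l (u - v) = l u - l v.
  by move=> Vu Vv; rewrite addrC -scaleN1r ll// mulN1r addrC.
pose K := [set u | V u /\ l u = 0].
have sK : subspace K.
  split; first by exists 0.
  by move=> a u v [Vu lu] [Vv lv]; split; [exact: sV.2|rewrite ll// lu lv mulr0 addr0].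
have cK : closed K.
  apply/closed_normP => x hx; have Vx : V x.
    move/closed_normP : cV; apply => e e0; have [k [Vk _] xk] := hx _ e0.
    by exists k.
  split=> //; apply/eqP; rewrite -normr_le0; apply/ler_addgt0Pr => e e0.
  have C0 : 0 < `|C| + 1 by rewrite ltr_wpDl.
  have [k [Vk lk] xk] := hx _ (divr_gt0 e0 C0).
  rewrite add0r -[l x]subr0 -lk -lB//; apply: le_trans (lC _ (subspaceB sV Vx Vk)) _.
  apply: (@le_trans _ _ ((`|C| + 1) * `|x - k|)).
    by rewrite ler_wpM2r// (le_trans (ler_norm _))// lerDl.
  by rewrite mulrC -ler_pdivlMr// ltW.
have [[x0 [Vx0 lx0]]|noV] := pselect (exists x, V x /\ l x != 0); last first.
  exists 0 => // u Vu; rewrite L2_dot0r; apply/eqP/negPn/negP => lu.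
  by apply: noV; exists u.
have [p [Vp lp] pK] := L2_projection x0 cK sK.
pose w := x0 - p; have Vw : V w by exact: subspaceB.
have lw : l w = l x0 by rewrite lB// lp subr0.
have w0 : `|w| ^+ 2 != 0.
  rewrite sqrf_eq0 normr_eq0; apply: contra_neq lx0 => w0.
  by rewrite -lw w0.
exists ((l w / `|w| ^+ 2) *: w); first exact: subspaceZ.
move=> u Vu; rewrite L2_dotZr.
(* Subtracting the right multiple of [w] from [u] lands in the kernel, which is orthogonal to
   [w]. *)
have /eqP : '[w, - (l u / l w) *: w + u] = 0.
  apply: pK; split; first exact: sV.2.
  by rewrite ll// mulNr divfK ?lw// addNr.
rewrite L2_dotDr L2_dotZr L2_dotuu mulNr addrC subr_eq0 L2_dotC => /eqP ->.
rewrite -lw in lx0; move: (`|w| ^+ 2) w0 => n n0.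
by field; rewrite lx0 n0.
Qed.

End hilbert.

(** * Limits under a linear bound *)

Section dominated_limits.
Context d (T : measurableType d) (R : realType) (mu : {measure set T -> \bar R}).
Local Notation H := (L2 mu).

(** Domination by the convergent [f_] makes [g_] Cauchy. The comparison with fixed [x] and [y] is
    returned along with the limit, so that an estimate for the approximants survives in the
    limit. *)
Lemma L2_dominated_cvg (g_ f_ : nat -> H) (f : H) (C : R) : 0 <= C ->
  (forall n m, `|g_ n - g_ m| <= C * `|f_ n - f_ m|) -> f_ @ \oo --> f ->
  exists2 g : H, g_ @ \oo --> g & forall x y : H,
    (forall n, `|g_ n - x| <= C * `|f_ n - y|) -> `|g - x| <= C * `|f - y|.
Proof.
move=> C0 gf /cvg_normP ff; have C1 : 0 < C + 1 by rewrite ltr_wpDl.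
have C2 : 0 < 1 + C by rewrite ltr_pwDl.
have [g gP] : exists g : H, g_ @ \oo --> g.
  apply: L2_complete => e e0.
  have [M hM] := ff _ (divr_gt0 e0 (mulr_gt0 (ltr0n R 2) C1)).
  exists M => m n Mm Mn; apply: le_lt_trans (gf m n) _.
  apply: (@le_lt_trans _ _ ((C + 1) * `|f_ m - f_ n|)); first by rewrite ler_wpM2r// lerDl.
  rewrite mulrC -ltr_pdivlMr//.
  rewrite (le_lt_trans (ler_distD f _ _))// [`|f - _|]distrC.
  have := hM _ Mm; have := hM _ Mn; rewrite invfM mulrA; lra.
exists g => // x y hxy; have /cvg_normP gP' := gP.
suff h (e : R) : 0 < e -> `|g - x| <= C * `|f - y| + e.
  by apply/ler_addgt0Pr => e; exact: h.
move=> e0; have e1 := divr_gt0 e0 C2.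
have [M1 hM1] := gP' _ e1; have [M2 hM2] := ff _ e1.
pose M := maxn M1 M2.
have h1 : `|g - g_ M| < e / (1 + C) by rewrite distrC; apply: hM1; exact: leq_maxl.
have h2 : `|f_ M - f| < e / (1 + C) by apply: hM2; exact: leq_maxr.
have h3 := hxy M; have h4 := ler_distD (g_ M) g x.
have h5 : C * `|f_ M - y| <= C * (`|f_ M - f| + `|f - y|).
  by rewrite ler_wpM2l// ler_distD.
have h6 : C * `|f_ M - f| <= C * (e / (1 + C)) by rewrite ler_wpM2l// ltW.
have h7 : e = e / (1 + C) + C * (e / (1 + C)).
  by rewrite -[X in X + _]mul1r -mulrDl mulrC divfK ?gt_eqF.
rewrite [in leRHS]h7; rewrite mulrDr in h5; lra.
Qed.

(** The tolerance e / (1 + C) is paid once for [u] and C times for [f]. *)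
Lemma L2_closure_bound (u f U F : H) (C e : R) : 0 <= C -> 0 < e ->
  `|U| <= C * `|F| -> `|u - U| < e / (1 + C) -> `|f - F| < e / (1 + C) ->
  `|u| <= C * `|f| + e.
Proof.
move=> C0 e0 UF q1 q2; have C1 : 0 < 1 + C by rewrite ltr_pwDl.
have h1 : `|u| <= `|u - U| + `|U| by rewrite -[in leLHS](subrK U u) ler_normD.
have h2 : `|F| <= `|f| + `|f - F|.
  by rewrite -[in leLHS](subrK f F) addrC distrC ler_normD.
have h3 : C * `|F| <= C * (`|f| + `|f - F|) by rewrite ler_wpM2l.
have h4 : C * `|f - F| <= C * (e / (1 + C)) by rewrite ler_wpM2l// ltW.
have h5 : e = e / (1 + C) + C * (e / (1 + C)).
  by rewrite -[X in X + _]mul1r -mulrDl mulrC divfK ?gt_eqF.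
rewrite [in leRHS]h5; rewrite mulrDr in h3; lra.
Qed.

End dominated_limits.

(** * Closed graphs bounded below *)

Section closed_bounded_below.
Context d (T : measurableType d) (R : realType) (mu : {measure set T -> \bar R}).
Local Notation H := (L2 mu).
Implicit Types (u v w f g : H).
Variables (G : set (H * H)) (c : R).
Hypotheses (c_ge0 : 0 <= c) (cG : closed G) (G0 : G (0, 0))
  (sG : forall a u f v g, G (u, f) -> G (v, g) -> G (a *: u + v, a *: f + g))
  (bG : forall u f, G (u, f) -> `|u| <= c * `|f|).

(* [G] is the graph of an operator that is bounded below, so its range is closed and
   Riesz representation on the range solves the adjoint equation. *)
Definition graph_range : set H := [set f | exists u, G (u, f)].
Definition graph_adjoint : set (H * H) :=
  [set p | forall u f, G (u, f) -> '[f, p.1] = '[u, p.2]].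
Local Notation ran := graph_range.
Local Notation adj := graph_adjoint.

Lemma graphB u f v g : G (u, f) -> G (v, g) -> G (u - v, f - g).
Proof.
by move=> Gu Gv; rewrite [u - v]addrC [f - g]addrC -scaleN1r -(scaleN1r g); exact: sG.
Qed.

Lemma graphZ a u f : G (u, f) -> G (a *: u, a *: f).
Proof. by move=> Gu; have := sG a Gu G0; rewrite !addr0. Qed.

Lemma graph_uniq u v f : G (u, f) -> G (v, f) -> u = v.
Proof.
move=> Gu Gv; have := bG (graphB Gu Gv); rewrite subrr normr0 mulr0 normr_le0.
by rewrite subr_eq0 => /eqP.
Qed.

Lemma graph_range_subspace : subspace ran.
Proof.
split; first by exists 0, 0.
by move=> a f g [u Gu] [v Gv]; exists (a *: u + v); exact: sG.
Qed.

(** The lower bound makes the arguments Cauchy whenever the values converge, and closedness of [G]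
    catches the limit pair. *)
Lemma graph_range_closed : closed ran.
Proof.
apply/closed_normP => f hf.
pose a (n : nat) : R := n.+1%:R^-1.
have a0 n : 0 < a n by rewrite invr_gt0 ltr0n.
have small (e : R) : 0 < e -> exists M, forall n, (M <= n)%N -> a n < e.
  exact: natSinv_eventually_lt.
have /choice[q_ q_P] : forall n, exists q : H * H, G q /\ `|f - q.2| < a n.
  by move=> n; have [g [u Gu] fg] := hf _ (a0 n); exists (u, g).
have Gq n : G ((q_ n).1, (q_ n).2) by rewrite -surjective_pairing; exact: (q_P n).1.
have qf : (fun n => (q_ n).2) @ \oo --> f.
  apply/cvg_normP => e e0; have [M hM] := small _ e0; exists M => n Mn.
  by rewrite distrC; exact: lt_trans (q_P n).2 (hM _ Mn).
have [u /cvg_normP uP _] := L2_dominated_cvg (g_ := fun n => (q_ n).1) c_ge0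
  (fun n m => bG (graphB (Gq n) (Gq m))) qf.
exists u; move/closed_prodP: cG; apply => e e0 /=.
have [M1 hM1] := uP _ e0; have [M2 hM2] := small _ e0.
exists (q_ (maxn M1 M2)); split; first exact: (q_P _).1.
  by rewrite distrC; apply: hM1; exact: leq_maxl.
by apply: lt_trans (q_P _).2 _; apply: hM2; exact: leq_maxr.
Qed.

Lemma graph_adjoint0 v : adj (v, 0) <-> L2_perp ran v.
Proof.
split=> [av f [u /av /=]|vp u f Gu /=]; first by rewrite L2_dot0r L2_dotC.
by rewrite L2_dot0r L2_dotC vp//; exists u.
Qed.

Lemma graph_range_perp : L2_perp [set v | adj (v, 0)] = ran.
Proof.
rewrite -[RHS]L2_perp_perp; [|exact: graph_range_closed|exact: graph_range_subspace].
by congr L2_perp; apply/seteqP; split=> v /graph_adjoint0.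
Qed.

Lemma graph_adjoint_surj w : exists v, ran v /\ adj (v, w).
Proof.
(* The inverse of the graph, with default 0; on the range it is linear because arguments are unique
   there. The solution represents the functional sending f to the product of [S f] with [w]. *)
pose S f : H := xget 0 [set u | G (u, f)].
have SP f : ran f -> G (S f, f).
  by move=> [u Gu]; rewrite /S; case: xgetP => [v _ //|/(_ u)].
have SE u f : G (u, f) -> S f = u.
  by move=> Gu; apply: (graph_uniq _ Gu); apply: SP; exists u.
have lS a f g : ran f -> ran g ->
    '[S (a *: f + g), w] = a * '[S f, w] + '[S g, w].
  by move=> /SP Sf /SP Sg; rewrite (SE _ _ (sG a Sf Sg)) L2_dotDl L2_dotZl.
have bS f : ran f -> `|'[S f, w]| <= (c * `|w|) * `|f|.
  move=> /SP Sf; apply: le_trans (L2_CauchySchwarz _ _) _.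
  by rewrite mulrAC ler_wpM2r// bG.
have [v rv vP] := L2_Riesz graph_range_closed graph_range_subspace lS bS.
exists v; split=> // u f Gu /=; rewrite -vP; last by exists u.
by rewrite (SE _ _ Gu).
Qed.

(** As [v] is the value of some [u], its squared norm equals the product of [u] with [w], at most c
    |v| |w|, and one factor |v| cancels. *)
Lemma graph_adjoint_bound v w : ran v -> adj (v, w) -> `|v| <= c * `|w|.
Proof.
move=> [u Gu] /(_ _ _ Gu) /= vw; apply: L2_norm_dual; first by rewrite mulr_ge0.
rewrite vw; apply: le_trans (ler_norm _) (le_trans (L2_CauchySchwarz _ _) _).
by rewrite mulrAC ler_wpM2r// bG.
Qed.

Lemma graph_adjointD a v w v' w' : adj (v, w) -> adj (v', w') ->
  adj (a *: v + v', a *: w + w').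
Proof.
move=> av av' u f Gu /=.
by rewrite !L2_dotDr !L2_dotZr (av _ _ Gu) (av' _ _ Gu).
Qed.

Lemma graph_adjoint_uniq v v' w : ran v -> ran v' -> adj (v, w) -> adj (v', w) ->
  v = v'.
Proof.
move=> rv rv' av av'; have := graph_adjointD (- 1) av' av.
rewrite !scaleN1r addNr addrC => avv'.
have := graph_adjoint_bound (subspaceB graph_range_subspace rv rv') avv'.
by rewrite normr0 mulr0 normr_le0 subr_eq0 => /eqP.
Qed.

Variables (S S' : H -> H).
Hypotheses (SP : forall f, ran f -> G (S f, f))
  (S'P : forall f, ran (S' f) /\ adj (S' f, f)).

Let SZ a f : ran f -> S (a *: f) = a *: S f.
Proof.
move=> rf; apply: (graph_uniq (SP (subspaceZ a graph_range_subspace rf))).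
by apply: graphZ; exact: SP.
Qed.

Let S'Z a f : S' (a *: f) = a *: S' f.
Proof.
apply: (@graph_adjoint_uniq _ _ (a *: f)); [exact: (S'P _).1| |exact: (S'P _).2|].
  by apply: subspaceZ; [exact: graph_range_subspace|exact: (S'P _).1].
move=> u g Gu /=; rewrite !L2_dotZr; congr (_ * _); exact: (S'P f).2 Gu.
Qed.

Let SS' f g : ran f -> '[f, S' g] = '[S f, g].
Proof. by move=> rf; have := (S'P g).2 _ _ (SP rf). Qed.

(** Each norm is tested at the normalised image under the other map, as |S f|^2 is the product of
    [f] with [S' (S f)]. In the converse direction [S] may be applied because [S'] takes values in
    the range. *)
Lemma opnorm_adjoint : opnorm ran S = opnorm setT S'.
Proof.
have sqr_le (x y z : R) : 0 <= x -> 0 <= z -> x ^+ 2 <= y * z -> z <= 1 -> 0 <= y -> x ^+ 2 <= y.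
  by move=> x0 z0 xyz z1 y0; apply: le_trans xyz _; rewrite ler_piMr.
apply/eqP; rewrite eq_le; apply/andP; split.
- apply: ge_ereal_sup => _ [f [rf f1] <-].
  (* An image equal to 0 cannot be normalised; the value 0 is then attained at the vector 0. *)
  have [Sf0|Sf0] := eqVneq (S f) 0.
    rewrite Sf0 normr0; apply: ereal_sup_ubound; exists 0.
      by split=> //; rewrite normr0.
    by rewrite -(scale0r (0 : H)) S'Z scale0r normr0.
  apply: (@le_trans _ _ `|S' (`|S f|^-1 *: S f)|%:E); last first.
    apply: ereal_sup_ubound; exists (`|S f|^-1 *: S f) => //; split=> //.
    by rewrite normrZ normfV normr_id mulVf ?normr_eq0.
  rewrite S'Z normrZ normfV normr_id lee_fin mulrC ler_pdivlMr ?normr_gt0// -expr2.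
  apply: (sqr_le _ _ `|f|) => //; rewrite -L2_dotuu -SS' // mulrC.
  exact: le_trans (ler_norm _) (L2_CauchySchwarz _ _).
- apply: ge_ereal_sup => _ [g [_ g1] <-]; have [rf _] := S'P g.
  have [Sf0|Sf0] := eqVneq (S' g) 0.
    rewrite Sf0 normr0; apply: ereal_sup_ubound; exists 0.
      by split; [exists 0|rewrite normr0].
    by rewrite -(scale0r (0 : H)) SZ ?scale0r ?normr0//; exists 0.
  apply: (@le_trans _ _ `|S (`|S' g|^-1 *: S' g)|%:E); last first.
    apply: ereal_sup_ubound; exists (`|S' g|^-1 *: S' g) => //; split=> //.
      exact: subspaceZ graph_range_subspace _.
    by rewrite normrZ normfV normr_id mulVf ?normr_eq0.
  rewrite SZ// normrZ normfV normr_id lee_fin mulrC ler_pdivlMr ?normr_gt0// -expr2.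
  apply: (sqr_le _ _ `|g|) => //; rewrite -L2_dotuu SS' //.
  exact: le_trans (ler_norm _) (L2_CauchySchwarz _ _).
Qed.

End closed_bounded_below.

(** * Smooth functions *)

Section line_derivatives.
Context (R : realType) (V : normedModType R).
Implicit Types (f : V -> R) (x v w : V).

Lemma is_derive_line f x v (t df : R) :
  is_derive (t *: v + x) v f df <->
  is_derive t (1 : R) (fun s : R => f (s *: v + x)) df.
Proof.
have E : (fun h : R => h^-1 *: ((f \o shift (t *: v + x)) (h *: v) - f (t *: v + x))) =
    (fun h : R => h^-1 *: (((fun s : R => f (s *: v + x)) \o shift t) (h *: (1 : R)) -
      f (t *: v + x))).
  by apply/funext => h /=; rewrite addrA -scalerDl [h *: (1 : R)]mulr1.
by split=> -[dv de]; constructor; move: dv de; rewrite /derivable /derive E.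
Qed.

Lemma is_derive_along f x v t : (forall y, derivable f y v) ->
  is_derive t (1 : R) (fun s : R => f (s *: v + x)) ('D_v f (t *: v + x)).
Proof. by move=> df; apply/is_derive_line; exact/derivableP. Qed.

Lemma MVT_along f x v (h : R) : 0 < h -> (forall y, derivable f y v) ->
  exists2 s : R, 0 < s < h & f (h *: v + x) - f x = 'D_v f (s *: v + x) * h.
Proof.
move=> h0 df.
have [] := @MVT R (fun s : R => f (s *: v + x)) (fun s => 'D_v f (s *: v + x)) 0 h h0.
- by move=> t _; exact: is_derive_along.
- apply: continuous_subspaceT => t; apply: differentiable_continuous.
  by apply/derivable1_diffP; case: (is_derive_along x t df).
- by move=> s; rewrite in_itv/= scale0r add0r subr0 => sh sE; exists s.
Qed.

(** The mean value theorem is used along [v] for the increment [g] of [f] in direction [w], then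
    along [w] for the derivative of [f] in direction [v]. *)
Lemma second_difference f x v w (h : R) : 0 < h ->
  (forall y, derivable f y v) -> (forall y, derivable ('D_v f) y w) ->
  exists s t : R, [/\ 0 < s < h, 0 < t < h &
    f (h *: v + (h *: w + x)) - f (h *: v + x) - f (h *: w + x) + f x =
    'D_w ('D_v f) (t *: w + (s *: v + x)) * h ^+ 2].
Proof.
move=> h0 df ddf; pose g y := f (h *: w + y) - f y.
have dgh y : is_derive y v g ('D_v f (h *: w + y) - 'D_v f y).
  apply: is_deriveB; last exact/derivableP.
  have := is_derive_along (h *: w + y) 0 df.
  rewrite (_ : (fun s => _) = (fun s => (f \o +%R (h *: w)) (s *: v + y))); last first.
    by apply/funext => s /=; rewrite addrCA.
  by move/is_derive_line; rewrite !scale0r !add0r.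
have [s sh sE] := MVT_along x h0 (fun y => @ex_derive _ _ _ _ _ _ _ (dgh y)).
have [t th tE] := MVT_along (s *: v + x) h0 ddf.
exists s, t; split => //; rewrite expr2 mulrA -tE.
have := dgh (s *: v + x) => /@derive_val <-; rewrite -sE /g addrCA.
rewrite opprB; ring.
Qed.

Lemma second_difference_near f x v w (h r : R) : 0 < h ->
  h * (`|v| + `|w|) < r ->
  (forall y, derivable f y v) -> (forall y, derivable ('D_v f) y w) ->
  exists2 p, `|x - p| < r &
    f (h *: v + (h *: w + x)) - f (h *: v + x) - f (h *: w + x) + f x =
    'D_w ('D_v f) p * h ^+ 2.
Proof.
move=> h0 hr dv dvw.
have [s [t [/andP[s0 sh] /andP[t0 th] ->]]] := second_difference x h0 dv dvw.
exists (t *: w + (s *: v + x)) => //.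
rewrite addrA distrC addrK; apply: le_lt_trans hr.
apply: le_trans (ler_normD _ _) _.
rewrite !normrZ (gtr0_norm s0) (gtr0_norm t0) mulrDr addrC.
by apply: lerD; rewrite ler_wpM2r// ltW.
Qed.

(* Used with p and q the intermediate points of a second difference: Schwarz's theorem. *)
Lemma eq_continuous_near (A B : V -> R) x :
  {for x, continuous A} -> {for x, continuous B} ->
  (forall r : R, 0 < r -> exists p q, [/\ `|x - p| < r, `|x - q| < r & A p = B q]) ->
  A x = B x.
Proof.
move=> cA cB hAB.
apply/eqP; rewrite -subr_eq0 -normr_le0; apply/ler_addgt0Pr => e e0; rewrite add0r.
have e20 : 0 < e / 2 by rewrite divr_gt0.
have /cvgrPdist_lt/(_ _ e20)/nbhs_ballP[r1 /= r10 h1] := cA.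
have /cvgrPdist_lt/(_ _ e20)/nbhs_ballP[r2 /= r20 h2] := cB.
have m0 : 0 < Num.min r1 r2 by rewrite lt_min r10.
have [p [q []]] := hAB _ m0; rewrite !lt_min => /andP[p1 _] /andP[_ q2] pq.
rewrite (splitr e) -(subrKA (A p)) (le_trans (ler_normD _ _))// lerD//.
  by apply/ltW/h1; rewrite -ball_normE.
by rewrite pq distrC; apply/ltW/h2; rewrite -ball_normE.
Qed.

(** The second difference is symmetric in [v] and [w]; divided by h^2 it is the value of either
    mixed derivative at some point within [r] of [x]. *)
Lemma derive_swap f x v w :
  (forall y, derivable f y v) -> (forall y, derivable f y w) ->
  (forall y, derivable ('D_v f) y w) -> (forall y, derivable ('D_w f) y v) ->
  {for x, continuous ('D_w ('D_v f))} -> {for x, continuous ('D_v ('D_w f))} ->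
  'D_w ('D_v f) x = 'D_v ('D_w f) x.
Proof.
move=> dv dw dvw dwv cvw cwv.
apply: (eq_continuous_near cvw cwv) => r r0; clear cvw cwv.
have C0 : 0 < `|v| + `|w| + 1 by rewrite ltr_wpDl// addr_ge0.
pose h := r / (`|v| + `|w| + 1); have h0 : 0 < h by rewrite divr_gt0.
have hr : h * (`|v| + `|w|) < r by rewrite /h mulrAC ltr_pdivrMr// ltr_pM2l// ltrDl.
have [p xp pE] := second_difference_near x h0 hr dv dvw.
have [q xq qE] : exists2 q, `|x - q| < r &
    f (h *: w + (h *: v + x)) - f (h *: w + x) - f (h *: v + x) + f x =
    'D_v ('D_w f) q * h ^+ 2.
  by apply: (second_difference_near x h0 _ dw dwv); rewrite [`|w| + _]addrC.
exists p, q; split; [exact: xp|exact: xq|].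
have h2 : h ^+ 2 != 0 by rewrite expf_eq0 gt_eqF.
apply: (mulIf h2); apply: etrans (esym pE) (etrans _ qE).
by rewrite [h *: w + (h *: v + x)]addrCA; congr (_ + _); exact: addrAC.
Qed.

End line_derivatives.

(** * Calculus of smooth functions and iterated derivatives *)

Section smooth_functions.
Context {R : realType} {N : nat}.
Implicit Types (phi psi : 'rV[R]_N -> R).

(** Coinduction for [smooth]: derivatives of all orders are reduced to stability of a class under
    one derivative. *)
Lemma smooth_class (C : set ('rV[R]_N -> R)) :
  (forall phi, C phi -> continuous phi) ->
  (forall phi, C phi -> forall i x, derivable phi x (delta_mx ord0 i)) ->
  (forall phi i, C phi -> C (partial i phi)) ->
  forall phi, C phi -> smooth phi.
Proof.
move=> cC dC pC phi Cphi s.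
suff : C (foldr partial phi s) by move=> Cs; split; [exact: cC|exact: dC].
by elim: s => //= i s; exact: pC.
Qed.

Lemma smooth_continuous phi : smooth phi -> continuous phi.
Proof. by move=> /(_ [::])[]. Qed.

Lemma smooth_derivable phi i x : smooth phi -> derivable phi x (delta_mx ord0 i).
Proof. by move=> /(_ [::])[_]; exact. Qed.

Lemma smooth_foldr phi s : smooth phi -> smooth (foldr partial phi s).
Proof. by move=> sphi t; rewrite -foldr_cat; exact: sphi. Qed.

Lemma smooth_partial phi i : smooth phi -> smooth (partial i phi).
Proof. by move=> /(smooth_foldr [:: i]). Qed.

(* Otherwise conversion tests between distinct smooth functions unfold iterated
   derivatives down to limits. *)
#[local] Opaque smooth.

Lemma partial0 i : partial i (0 : 'rV[R]_N -> R) = 0.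
Proof. by apply/funext => x; exact: derive_cst. Qed.

Lemma derivable_partial i j phi x : smooth phi ->
  derivable ('D_(delta_mx ord0 i) phi) x (delta_mx ord0 j).
Proof. by move=> /(smooth_partial i)/(@smooth_derivable _ j x). Qed.

Lemma smooth0 : smooth (0 : 'rV[R]_N -> R).
Proof.
apply: (@smooth_class [set 0]) => // phi.
- by move=> -> x; exact: cst_continuous.
- by move=> -> i x; exact: derivable_cst.
- by move=> i -> /=; exact: partial0.
Qed.

Lemma derivable_partialD i phi psi :
  (forall x, derivable phi x (delta_mx ord0 i)) ->
  (forall x, derivable psi x (delta_mx ord0 i)) ->
  partial i (phi + psi) = partial i phi + partial i psi.
Proof. by move=> dphi dpsi; apply/funext => x; rewrite /partial deriveD. Qed.

Lemma derivable_partialZ i (a : R) phi :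
  (forall x, derivable phi x (delta_mx ord0 i)) ->
  partial i (a *: phi) = a *: partial i phi.
Proof. by move=> dphi; apply/funext => x; rewrite /partial deriveZ. Qed.

Lemma partialD i phi psi : smooth phi -> smooth psi ->
  partial i (phi + psi) = partial i phi + partial i psi.
Proof.
by move=> sphi spsi; apply: derivable_partialD => x; exact: smooth_derivable.
Qed.

Lemma partialZ i (a : R) phi : smooth phi -> partial i (a *: phi) = a *: partial i phi.
Proof. by move=> sphi; apply: derivable_partialZ => x; exact: smooth_derivable. Qed.

Lemma partialM i phi psi : smooth phi -> smooth psi ->
  partial i (phi * psi) = partial i phi * psi + phi * partial i psi.
Proof.
move=> sphi spsi; apply/funext => x.
rewrite /partial deriveM; [|exact: smooth_derivable..].
rewrite -[RHS]/('D_(delta_mx ord0 i) phi x * psi x + phi x * 'D_(delta_mx ord0 i) psi x).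
by rewrite addrC mulrC.
Qed.

#[local] Opaque partial.

(** The derivative of a product, or of a flat function, leaves its family but stays in the linear
    span, so the span is the class to which coinduction applies. *)
Inductive smooth_span (B : set ('rV[R]_N -> R)) : ('rV[R]_N -> R) -> Prop :=
| Span_base f : B f -> smooth_span B f
| Span_add f g : smooth_span B f -> smooth_span B g -> smooth_span B (f + g)
| Span_scale (a : R) f : smooth_span B f -> smooth_span B (a *: f).

Lemma smooth_spanP (B : set ('rV[R]_N -> R)) :
  (forall phi, B phi -> continuous phi) ->
  (forall phi, B phi -> forall i x, derivable phi x (delta_mx ord0 i)) ->
  (forall phi i, B phi -> smooth_span B (partial i phi)) ->
  forall phi, smooth_span B phi -> smooth phi.
Proof.
move=> cB dB pB.
have dS phi : smooth_span B phi -> forall i x, derivable phi x (delta_mx ord0 i).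
  elim=> [f Bf|f g _ hf _ hg|a f _ hf] i x; first exact: dB.
  - exact: derivableD.
  - exact: derivableZ.
apply: smooth_class => // phi.
- elim=> [f Bf|f g _ hf _ hg|a f _ hf] x; first exact: cB.
  + by apply: continuousD; [exact: hf|exact: hg].
  + by apply: continuousZl_tmp => //; exact: hf.
- move=> i; elim=> [f Bf|f g Sf hf Sg hg|a f Sf hf]; first exact: pB.
  + rewrite (_ : partial i (f + g) = partial i f + partial i g).
      exact: Span_add.
    by apply: derivable_partialD => x; exact: dS.
  + rewrite (_ : partial i (a *: f) = a *: partial i f); first exact: Span_scale.
    by apply: derivable_partialZ => x; exact: dS.
Qed.

Lemma smoothD phi psi : smooth phi -> smooth psi -> smooth (phi + psi).
Proof.
move=> sphi spsi; apply: (@smooth_spanP smooth).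
- by move=> f; exact: smooth_continuous.
- by move=> f sf i x; exact: smooth_derivable.
- by move=> f i sf; apply: Span_base; exact: smooth_partial.
- by apply: Span_add; exact: Span_base.
Qed.

Lemma smoothZ (a : R) phi : smooth phi -> smooth (a *: phi).
Proof.
move=> sphi; apply: (@smooth_spanP smooth).
- by move=> f; exact: smooth_continuous.
- by move=> f sf i x; exact: smooth_derivable.
- by move=> f i sf; apply: Span_base; exact: smooth_partial.
- by apply: Span_scale; exact: Span_base.
Qed.

Lemma smoothM phi psi : smooth phi -> smooth psi -> smooth (phi * psi).
Proof.
move=> sphi spsi.
pose B := [set f : 'rV[R]_N -> R | exists g h, [/\ smooth g, smooth h & f = g * h]].
apply: (@smooth_spanP B).
- move=> _ [g [h [sg sh ->]]] x.
  by apply: continuousM; exact: smooth_continuous.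
- move=> _ [g [h [sg sh ->]]] i x.
  by apply: derivableM; exact: smooth_derivable.
- move=> _ i [g [h [sg sh ->]]]; rewrite partialM//; apply: Span_add; apply: Span_base.
    by exists (partial i g), h; split; [exact: smooth_partial|exact: sh|].
  by exists g, (partial i h); split; [exact: sg|exact: smooth_partial|].
- by apply: Span_base; exists phi, psi.
Qed.

Lemma partial_swap i j phi : smooth phi ->
  partial i (partial j phi) = partial j (partial i phi).
Proof.
move=> sphi; apply/funext => x; apply: derive_swap.
- move=> y; exact: smooth_derivable.
- move=> y; exact: smooth_derivable.
- move=> y; exact: derivable_partial.
- move=> y; exact: derivable_partial.
- exact: (smooth_continuous (smooth_foldr [:: i; j] sphi)).
- exact: (smooth_continuous (smooth_foldr [:: j; i] sphi)).
Qed.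

Lemma foldr_partial_cons_rcons i phi s : smooth phi ->
  foldr partial (partial i phi) s = partial i (foldr partial phi s).
Proof.
move=> sphi; elim: s => //= j s ->.
rewrite partial_swap; [by []|exact: smooth_foldr].
Qed.

Lemma foldr_partial_perm phi s t : smooth phi -> perm_eq s t ->
  foldr partial phi s = foldr partial phi t.
Proof.
move=> sphi; elim: s t => [|i s IH] t.
  by rewrite perm_sym => /perm_nilP ->.
move=> st; have it : i \in t by rewrite -(perm_mem st) mem_head.
have /path.splitPr t12 := it; case: t12 st => t1 t2 st.
rewrite foldr_cat /= foldr_partial_cons_rcons; last exact: smooth_foldr.
rewrite -foldr_cat (IH (t1 ++ t2))//.
by rewrite -(perm_cons i) (perm_trans st)// perm_catC /= perm_cons perm_catC.
Qed.

(** Lists the derivatives in the order in which [mpartial] applies them, so that multi-indices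
    become lists up to permutation. *)
Definition mindex_seq (a : 'I_N -> nat) : seq 'I_N :=
  flatten [seq nseq (a i) i | i <- enum 'I_N].

Lemma mpartialE a phi : mpartial a phi = foldr partial phi (mindex_seq a).
Proof.
rewrite /mpartial /mindex_seq; elim: (enum 'I_N) => //= i s ->.
by rewrite foldr_cat; elim: (a i) => //= n ->.
Qed.

Lemma size_mindex_seq a : size (mindex_seq a) = mindex_len a.
Proof.
rewrite size_flatten /shape -map_comp sumnE big_map /mindex_len big_enum /=.
by apply: eq_bigr => i _; rewrite size_nseq.
Qed.

Lemma mindex_seq_count (s : seq 'I_N) :
  perm_eq (mindex_seq (fun i => count_mem i s)) s.
Proof.
apply/allP => /= i _; apply/eqP; rewrite count_flatten -map_comp sumnE big_map.
rewrite big_enum/= (bigD1 i)//= count_nseq /= eqxx mul1n big1 ?addn0// => j ji.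
by rewrite count_nseq /= (negbTE ji) mul0n.
Qed.

Lemma mpartial_count phi s : smooth phi ->
  mpartial (fun i => count_mem i s) phi = foldr partial phi s.
Proof. by move=> sphi; rewrite mpartialE; apply: foldr_partial_perm (mindex_seq_count s). Qed.

Lemma mindex_len_count (s : seq 'I_N) : mindex_len (fun i => count_mem i s) = size s.
Proof. by rewrite -size_mindex_seq; apply: perm_size; exact: mindex_seq_count. Qed.

End smooth_functions.

(** * The function exp(-1/t) and its derivatives *)

Section flat.
Context {R : realType}.
Implicit Types (k n : nat) (t : R).

(* All derivatives of exp(-1/t) on t > 0, extended by 0, are combinations of the
   functions [flat k]. *)
Definition flat k t : R := if 0 < t then t^-1 ^+ k * expR (- t^-1) else 0.

Lemma flat_npos k t : t <= 0 -> flat k t = 0.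
Proof. by rewrite /flat ltNge => ->. Qed.

Lemma flat_ge0 k t : 0 <= flat k t.
Proof.
by rewrite /flat; case: ifP => // t0; rewrite mulr_ge0 ?expR_ge0// exprn_ge0// invr_ge0 ltW.
Qed.

Lemma flat0_le1 t : flat 0 t <= 1.
Proof.
rewrite /flat; case: ifP => // t0.
by rewrite expr0 mul1r -expR0 ler_expR oppr_le0 invr_ge0 ltW.
Qed.

(** With x = 1 / t, exp x is at least (x / (k + 1))^(k + 1); the exponent k + 1 instead of k leaves
    one factor t. *)
Lemma flat_bound k t : flat k t <= k.+1%:R ^+ k.+1 * `|t|.
Proof.
rewrite /flat; case: ifP => t0; last by rewrite mulr_ge0// exprn_ge0.
have n0 : 0 < k.+1%:R :> R by rewrite ltr0n.
have : (t^-1 / k.+1%:R) ^+ k.+1 <= expR (t^-1).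
  have -> : expR t^-1 = expR (t^-1 / k.+1%:R) ^+ k.+1 by rewrite -expRM_natr divfK ?gt_eqF.
  rewrite lerXn2r ?nnegrE ?expR_ge0// ?divr_ge0 ?invr_ge0 ?(ltW t0)//.
  by apply: le_trans (expR_ge1Dx _); rewrite lerDr.
rewrite exprMn (exprVn k.+1%:R) ler_pdivrMr ?exprn_gt0// => h.
rewrite (gtr0_norm t0) expRN ler_pdivrMr ?expR_gt0//.
have -> : t^-1 ^+ k = t^-1 ^+ k.+1 * t by rewrite exprSr -mulrA mulVf ?mulr1 ?gt_eqF.
by rewrite mulrAC ler_pM2r// mulrC.
Qed.

Lemma flat_cvg0 k : flat k @ (0 : R) --> (0 : R).
Proof.
apply/cvgrPdist_lt => e e0.
have n0 : 0 < k.+1%:R ^+ k.+1 :> R by rewrite exprn_gt0.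
apply/nbhs_ballP; exists (e / k.+1%:R ^+ k.+1) => /=; first by rewrite divr_gt0.
move=> t; rewrite /ball /= !sub0r !normrN (ger0_norm (flat_ge0 _ _)) => te.
by apply: le_lt_trans (flat_bound _ _) _; rewrite mulrC -ltr_pdivlMr.
Qed.

Lemma is_derive_flat k t :
  is_derive t (1 : R) (flat k) (flat k.+2 t - k%:R * flat k.+1 t).
Proof.
have [t0|t0|->] := ltgtP t 0.
- rewrite !(flat_npos _ (ltW t0)) mulr0 subr0.
  apply: near_eq_is_derive _ (is_derive_cst (0 : R) t (1 : R)).
  near=> s; rewrite flat_npos// ltW//; near: s; exact: lt_nbhsl.
- pose g (s : R) := s^-1 ^+ k * expR (- s^-1).
  apply: (near_eq_is_derive (f := g)).
    by near=> s; rewrite /flat ifT//; near: s; exact: lt_nbhsr.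
  have tn0 : t != 0 by rewrite gt_eqF.
  have dV : is_derive t (1 : R) (fun s : R => s^-1) (- t ^- 2).
    have := is_deriveV tn0 (is_derive_id t (1 : R)).
    by rewrite [(- _) *: _]mulr1.
  have dVk : is_derive t (1 : R) (fun s : R => s^-1 ^+ k) ((k%:R * t^-1 ^+ k.-1) * - t ^- 2).
    rewrite (_ : (fun s : R => s^-1 ^+ k) = (fun s : R => s^-1) ^+ k).
      exact: is_deriveX.
    by apply/funext => s; rewrite exprfctE.
  have dE : is_derive t (1 : R) (expR \o (fun s : R => - s^-1)) (expR (- t^-1) * - - t ^- 2).
    by apply: is_derive1_comp; exact: is_deriveN.
  apply: is_derive_eq (is_deriveM dVk dE) _.
  rewrite /flat t0 /= opprK -exprVn; move: (t^-1) (expR _) => y E.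
  rewrite -[LHS]/(y ^+ k * (E * y ^+ 2) + E * (k%:R * y ^+ k.-1 * - y ^+ 2)).
  case: (k) => [|n]; first by rewrite /= !expr0; ring.
  rewrite /= !exprS; ring.
- rewrite !flat_npos// mulr0 subr0.
  (* At 0 the difference quotient of [flat k] is [flat k.+1] itself, which tends to 0. *)
  have E : (fun h : R => h^-1 *: ((flat k \o shift 0) (h *: (1 : R)) - flat k 0)) = flat k.+1.
    apply/funext => h /=; rewrite addr0 [h *: (1 : R)]mulr1 (flat_npos k (lexx 0)) subr0.
    rewrite /flat; case: ifP => h0; last by rewrite scaler0.
    by rewrite exprS -mulrA.
  have c0 : flat k.+1 @ (0 : R)^' --> (0 : R) by apply: cvg_within_filter; exact: flat_cvg0.
  constructor; rewrite /derivable /derive E; first by apply/cvg_ex; exists 0.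
  exact: cvg_lim.
Unshelve. all: by end_near. Qed.

Lemma flat_continuous k : continuous (flat k).
Proof.
move=> t; apply: differentiable_continuous; apply/derivable1_diffP.
by case: (is_derive_flat k t).
Qed.

Lemma flat0_cvg t : 0 < t -> (fun n : nat => flat 0 (n%:R * t)) @ \oo --> (1 : R).
Proof.
move=> t0; apply/cvgrPdist_lt => e e0.
have [M _ hM] := near_infty_natSinv_lt (PosNum (mulr_gt0 e0 t0)).
exists M.+1 => //= -[//|n] /= Mn.
have nt0 : 0 < n.+1%:R * t by rewrite mulr_gt0.
rewrite ger0_norm ?subr_ge0 ?flat0_le1// /flat nt0 expr0 mul1r; cbv iota.
have ne : (n.+1%:R * t)^-1 < e by rewrite invfM ltr_pdivrMr//; exact: hM _ Mn.
have := expR_ge1Dx (- (n.+1%:R * t)^-1).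
by move=> h; apply: le_lt_trans ne; rewrite lerBlDl -lerBlDr.
Qed.

End flat.

#[local] Opaque smooth.

(** * Bump functions on boxes *)

Section bump.
Context {R : realType} {N : nat}.
Implicit Types (a b x : 'rV[R]_N).

Definition flat_coord (k : nat) (s r : R) (i : 'I_N) x : R := flat k (s * x ord0 i + r).

Lemma coord_cvg (i : 'I_N) x : (fun y : 'rV[R]_N => y ord0 i) @ x --> x ord0 i.
Proof. exact: coord_continuous. Qed.

Lemma is_derive_flat_coord k s r i j x :
  is_derive x (delta_mx ord0 j) (flat_coord k s r i)
    ((s * (i == j)%:R) * (flat_coord k.+2 s r i x - k%:R * flat_coord k.+1 s r i x)).
Proof.
rewrite -[x in is_derive x]add0r -(scale0r (delta_mx ord0 j : 'rV[R]_N)).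
apply/is_derive_line.
pose g (t : R) := s * (i == j)%:R * t + (s * x ord0 i + r).
rewrite (_ : (fun _ => _) = flat k \o g); last first.
  apply/funext => t; rewrite /flat_coord /g /= !mxE eqxx /= mulrDr addrA.
  by rewrite [t * _]mulrC mulrA.
have g0 : g 0 = s * x ord0 i + r by rewrite /g mulr0 add0r.
have dg : is_derive (0 : R) (1 : R) g (s * (i == j)%:R).
  rewrite -[X in is_derive _ _ _ X]addr0; apply: is_deriveD.
  rewrite -[X in is_derive _ _ _ X]mulr1.
  exact: is_deriveZ.
have := is_derive1_comp (is_derive_flat k (g 0)) dg.
by rewrite g0 mulrC.
Qed.

Lemma smooth_flat_coord k s r i : smooth (flat_coord k s r i).
Proof.
pose B := [set f : 'rV[R]_N -> R | exists k, f = flat_coord k s r i].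
apply: (@smooth_spanP _ _ B); last by apply: Span_base; exists k.
- move=> _ [n ->] x; apply: (continuous_comp (f := fun y : 'rV[R]_N => s * y ord0 i + r));
    last exact: flat_continuous.
  have hc : (fun y : 'rV[R]_N => s * y ord0 i) @ x --> s * x ord0 i.
    exact: (cvgMl_tmp (coord_cvg (i := i) (x := x))).
  have h : (fun y : 'rV[R]_N => s * y ord0 i + r) @ x --> s * x ord0 i + r.
    by apply: (cvgD hc); exact: cvg_cst.
  exact: h.
- by move=> _ [n ->] j x; case: (is_derive_flat_coord n s r i j x).
- move=> _ j [n ->].
  rewrite (_ : partial j _ = (s * (i == j)%:R) *:
      (flat_coord n.+2 s r i + (- n%:R) *: flat_coord n.+1 s r i)); last first.
    apply/funext => x; have := is_derive_flat_coord n s r i j x => /@derive_val.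
    rewrite /partial => ->.
    rewrite -[RHS]/(s * (i == j)%:R *
      (flat_coord n.+2 s r i x + (- n%:R) * flat_coord n.+1 s r i x)).
    by rewrite mulNr.
  apply/Span_scale/Span_add; first by apply: Span_base; exists n.+2.
  by apply/Span_scale/Span_base; exists n.+1.
Qed.

Lemma smooth1 : smooth (1 : 'rV[R]_N -> R).
Proof.
apply: (@smooth_spanP _ _ [set 1]) => [phi ->|phi -> i x|phi i ->|].
- exact: cst_continuous.
- exact: derivable_cst.
- rewrite (_ : partial i 1 = (0 : R) *: (1 : 'rV[R]_N -> R)); first by apply/Span_scale/Span_base.
  by apply/funext => x; rewrite scale0r; exact: derive_cst.
- exact: Span_base.
Qed.

Lemma smooth_prod (I : Type) (r : seq I) (F : I -> 'rV[R]_N -> R) :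
  (forall i, smooth (F i)) -> smooth (\prod_(i <- r) F i).
Proof.
move=> sF; elim/big_ind: _ => [|f g sf sg|i _]; first exact: smooth1.
- exact: smoothM.
- exact: sF.
Qed.

(* As n grows these test functions tend to the indicator function of the open box. *)
Definition bump a b (n : nat) : 'rV[R]_N -> R :=
  \prod_(i < N) (flat_coord 0 n%:R (- (n%:R * a ord0 i)) i *
                 flat_coord 0 (- n%:R) (n%:R * b ord0 i) i).

Definition open_box a b : set 'rV[R]_N :=
  [set x | forall i, a ord0 i < x ord0 i < b ord0 i].

Definition closed_box a b : set 'rV[R]_N :=
  [set x | forall i, a ord0 i <= x ord0 i <= b ord0 i].

Lemma smooth_bump a b n : smooth (bump a b n).
Proof. by apply: smooth_prod => i; apply: smoothM; exact: smooth_flat_coord. Qed.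

Lemma bumpE a b n x : bump a b n x =
  \prod_(i < N) (flat 0 (n%:R * (x ord0 i - a ord0 i)) * flat 0 (n%:R * (b ord0 i - x ord0 i))).
Proof.
rewrite /bump fct_prodE; apply: eq_bigr => i _.
rewrite -[LHS]/(flat_coord _ _ _ _ x * flat_coord _ _ _ _ x) /flat_coord.
by congr (flat _ _ * flat _ _); ring.
Qed.

Lemma bump_ge0 a b n x : 0 <= bump a b n x.
Proof. by rewrite bumpE prodr_ge0// => i _; rewrite mulr_ge0// flat_ge0. Qed.

Lemma bump_le1 a b n x : bump a b n x <= 1.
Proof.
rewrite bumpE; apply: (@le_trans _ _ (\prod_(i < N) (1 : R))); last by rewrite big1.
by apply: ler_prod => i _; rewrite mulr_ge0 ?flat_ge0//= mulr_ile1 ?flat_ge0 ?flat0_le1.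
Qed.

Lemma bump_out a b n x : ~ open_box a b x -> bump a b n x = 0.
Proof.
move=> /existsNP[i /negP]; rewrite negb_and -!leNgt => h.
rewrite bumpE (bigD1 i)//=; case/orP: h => h.
  by rewrite flat_npos ?mul0r// mulr_ge0_le0// subr_le0.
by rewrite [X in _ * X * _]flat_npos ?mulr0 ?mul0r// mulr_ge0_le0// subr_le0.
Qed.

Lemma bump_cvg a b x : open_box a b x -> bump a b ^~ x @ \oo --> (1 : R).
Proof.
move=> abx; under eq_fun do rewrite bumpE.
suff : (fun n => \prod_(i < N) (flat 0 (n%:R * (x ord0 i - a ord0 i)) *
    flat 0 (n%:R * (b ord0 i - x ord0 i)))) @ \oo --> \prod_(i < N) (1 : R).
  by rewrite [X in _ --> X]big1.
apply: cvg_big => [|i _]; first exact: mul_continuous.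
have /andP[ai bi] := abx i.
rewrite -[X in _ --> X]mulr1; apply: cvgM; apply: flat0_cvg; by rewrite subr_gt0.
Qed.

Lemma closed_box_compact a b : compact (closed_box a b).
Proof.
pose A i := [set r : R | a ord0 i <= r <= b ord0 i].
rewrite (_ : closed_box a b = [set v | forall i, A i (v ord0 i)])//.
apply: rV_compact => i; rewrite (_ : A i = `[a ord0 i, b ord0 i]%classic).
  exact: segment_compact.
by apply/seteqP; split=> r /=; rewrite in_itv.
Qed.

Lemma test_function_bump (Omega : set 'rV[R]_N) a b n :
  closed_box a b `<=` Omega -> test_function Omega (bump a b n).
Proof.
move=> abO; split; first exact: smooth_bump.
exists (closed_box a b); split => //; first exact: closed_box_compact.
move=> x nx; apply: bump_out => abx; apply: nx => i.
by have /andP[/ltW -> /ltW ->] := abx i.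
Qed.

End bump.

(** * Lebesgue measure on R^N and integration by parts *)

Section measure_rV.
Context {R : realType}.

Lemma closed_measurable_rV N (A : set 'rV[R]_N) : closed A -> measurable A.
Proof.
by move=> /closed_openC/open_measurable_rV/measurableC; rewrite setCK.
Qed.

Lemma compact_closed_rV N (A : set 'rV[R]_N) : compact A -> closed A.
Proof. by apply: compact_closed; exact: norm_hausdorff. Qed.

Lemma continuous_measurable_rV N (f : 'rV[R]_N -> R) :
  continuous f -> measurable_fun setT f.
Proof.
move=> /continuousP cf; apply: (measurability _ (RGenOpens.measurableE R)).
move=> _ [_ [a [b ->] <-]]; rewrite setTI; apply: open_measurable_rV.
exact/cf/interval_open.
Qed.

(** Cubes serve to enclose compact sets: being products of intervals, they have finite measure by
    induction on [N]. *)
Definition cube N (M : R) : set 'rV[R]_N := [set x | forall i, `|x ord0 i| <= M].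

Arguments cube : clear implicits.

Lemma cubeE N M : cube N M = closed_box (const_mx (- M)) (const_mx M).
Proof.
by apply/seteqP; split=> x /= h i; have := h i; rewrite !mxE ler_norml.
Qed.

Lemma cube_compact N M : compact (cube N M).
Proof. by rewrite cubeE; exact: closed_box_compact. Qed.

Lemma cube_measurable N M : measurable (cube N M).
Proof. exact: closed_measurable_rV (compact_closed_rV (@cube_compact N M)). Qed.

Lemma compact_cube N (K : set 'rV[R]_N) : compact K -> exists M, K `<=` cube N M.
Proof.
move=> /compact_bounded[M [_ hM]]; exists (M + 1) => x Kx i.
have /(_ x Kx) := hM (M + 1) (ltr_pwDr ltr01 (lexx M)).
apply: le_trans; rewrite [leRHS]mx_normrE.
exact: (le_bigmax _ (fun ij : 'I_1 * 'I_N => `|x ij.1 ij.2|) (ord0, i)).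
Qed.

Lemma consrV_l N (p : R * 'rV[R]_N) : consrV p ord0 (lshift N ord0 : 'I_(1 + N)) = p.1.
Proof. by rewrite /consrV (@row_mxEl _ 1 1 N) mxE. Qed.

Lemma consrV_r N (p : R * 'rV[R]_N) (i : 'I_N) : consrV p ord0 (rshift 1 i) = p.2 ord0 i.
Proof. by rewrite /consrV (@row_mxEr _ 1 1 N). Qed.

Lemma cube_consrV N M : (@consrV R N) @^-1` (cube N.+1 M) =
  `[- M, M]%classic `*` cube N M.
Proof.
apply/seteqP; split=> -[x y] /=.
  move=> h; split=> [|i].
    by have := h (lshift N ord0 : 'I_(1 + N)); rewrite consrV_l in_itv /= ler_norml.
  by have := h (rshift 1 i); rewrite consrV_r.
rewrite in_itv /= -ler_norml => -[hx hy] i.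
case: (@splitP 1 N i) => j ij.
  rewrite (_ : i = lshift N j :> 'I_(1 + N)); last exact/val_inj.
  by rewrite (ord1 j) consrV_l.
rewrite (_ : i = rshift 1 j); last exact/val_inj.
by rewrite consrV_r.
Qed.

Lemma lebesgue_cube N M : (lebesgue_rV N (cube N M) < +oo)%E.
Proof.
elim: N => [|N IH] /=.
  by rewrite diracE; case: (_ \in _); rewrite ltry.
rewrite /lebesgue_step /pushforward cube_consrV product_measure2E//; last exact: cube_measurable.
apply: lte_mul_pinfty => //.
by rewrite /= lebesgue_measure_itv /=; case: ifP.
Qed.

Lemma lebesgue_compact N (K : set 'rV[R]_N) : compact K -> (lebesgue_rV N K < +oo)%E.
Proof.
move=> cK; have [M KM] := compact_cube cK.
apply: le_lt_trans (lebesgue_cube N M); apply: le_measure => //; rewrite inE.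
  exact: closed_measurable_rV (compact_closed_rV cK).
exact: cube_measurable.
Qed.

Lemma bigcup_cube N : \bigcup_n (cube N n%:R) = [set: 'rV[R]_N].
Proof.
apply/seteqP; split=> // x _.
have [M hM] := compact_cube (@compact_set1 _ x).
exists (Num.bound `|M|) => // i; apply: le_trans (hM x erefl i) _.
by apply: le_trans (ler_norm _) _; apply/ltW/archi_boundP.
Qed.

Lemma lebesgue_sigma_finite N : sigma_finite setT (@lebesgue_rV R N).
Proof.
exists (fun n => cube N n%:R); first by rewrite bigcup_cube.
by move=> n; split; [exact: cube_measurable|exact: lebesgue_cube].
Qed.

(* Carries the sigma-finite structure that Fubini's theorem requires. *)
Definition lebesgue_rV_sf N : set 'rV[R]_N -> \bar R := lebesgue_rV N.
Arguments lebesgue_rV_sf : clear implicits.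
HB.instance Definition _ N := Measure.copy (lebesgue_rV_sf N) (Measure.sort (lebesgue_rV N)).
HB.instance Definition _ N := Measure_isSigmaFinite.Build _ _ _ (lebesgue_rV_sf N)
  (lebesgue_sigma_finite N).

Lemma compact_supp_bounded N (f : 'rV[R]_N -> R) (K : set 'rV[R]_N) :
  compact K -> continuous f -> (forall x, ~ K x -> f x = 0) ->
  exists C : R, 0 <= C /\ forall x, `|f x| <= C.
Proof.
move=> cK cf f0.
have /compact_bounded[C [_ hC]] : compact (f @` K).
  by apply: continuous_compact => //; exact: continuous_subspaceT.
exists `|C + 1|; split=> // x; have [Kx|/f0 ->] := pselect (K x); last by rewrite normr0.
apply: le_trans (ler_norm _); apply: (hC (C + 1)); first by rewrite ltrDl.
by exists x.
Qed.

Section compact_supp.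
Context N (mu : {measure set 'rV[R]_N -> \bar R}) (K : set 'rV[R]_N) (f : 'rV[R]_N -> R).
Hypotheses (muK : (mu K < +oo)%E) (cK : compact K) (cf : continuous f)
  (f0 : forall x, ~ K x -> f x = 0).

Lemma compact_supp_integrable : mu.-integrable setT (EFin \o f).
Proof.
have [C [C0 hC]] := compact_supp_bounded cK cf f0.
have mK : measurable K by exact: closed_measurable_rV (compact_closed_rV cK).
have mf := continuous_measurable_rV cf.
apply: (@le_integrable _ _ _ mu _ _ _ (fun x => (C * \1_K x)%:E)) => //.
- exact/measurable_EFinP.
- move=> x _ /=; rewrite lee_fin indicE; have [Kx|nKx] := pselect (K x).
    by rewrite mem_set// mulr1 (le_trans (hC x))// ler_norm.
  by rewrite f0// normr0.
- under eq_fun do rewrite EFinM.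
  apply: integrableZl => //; apply/integrableP; split.
    by apply/measurable_EFinP; exact: measurable_indic.
  rewrite (eq_integral (fun x => (\1_K x)%:E)); last first.
    by move=> x _; rewrite gee0_abs// lee_fin indicE.
  by rewrite integral_indic// setIT.
Qed.

End compact_supp.

Lemma compact_supp_Lfun2 N (mu : {measure set 'rV[R]_N -> \bar R}) (K : set 'rV[R]_N)
    (f : 'rV[R]_N -> R) :
  (mu K < +oo)%E -> compact K -> continuous f -> (forall x, ~ K x -> f x = 0) ->
  f \in Lfun mu 2%:E.
Proof.
move=> muK cK cf f0; apply: Lfun2P; first exact: continuous_measurable_rV.
have cf2 : continuous (fun x => f x ^+ 2).
  by move=> x; apply: (continuousM (cf x) (cf x)).
have f20 x : ~ K x -> f x ^+ 2 = 0 by move=> /f0 ->; rewrite expr0n.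
have /integrableP[_] := compact_supp_integrable muK cK cf2 f20.
apply: le_lt_trans; rewrite le_eqVlt; apply/orP; left; apply/eqP.
by apply: eq_integral => x _; rewrite gee0_abs// lee_fin sqr_ge0.
Qed.

Lemma derive_out (V : normedModType R) (K : set V) (f : V -> R) v x :
  closed K -> (forall y, ~ K y -> f y = 0) -> ~ K x -> 'D_v f x = 0.
Proof.
move=> cK f0 nKx; rewrite (@near_eq_derive _ _ _ f (cst 0)).
  exact: derive_cst.
have : open_nbhs x (~` K) by split; [exact: closed_openC|exact: nKx].
move/open_nbhs_nbhs; apply: filterS => y; exact: f0.
Qed.

Lemma integral_derive_R (g : R -> R) (M : R) :
  (forall x, derivable g x 1) -> continuous ('D_1 g) ->
  (forall x, M < `|x| -> g x = 0) ->
  (\int[lebesgue_measure]_x ('D_1 g x)%:E = 0)%E.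
Proof.
(* Taking [|M| + 1] makes the interval nondegenerate and puts both endpoints where [g] vanishes. *)
move=> dg cg g0; pose L : R := `|M| + 1.
have M0 : 0 < L by rewrite ltr_wpDl.
have ML : M < L by rewrite (le_lt_trans (ler_norm _))// ltrDl.
have gc : continuous g.
  by move=> x; apply: differentiable_continuous; exact/derivable1_diffP.
have E : (\int[lebesgue_measure]_(x in `[(- L)%R, L]) ('D_1 g x)%:E = 0)%E.
  rewrite (@continuous_FTC2 _ ('D_1 g) g).
  - by rewrite !g0 ?normrN ?(gtr0_norm M0)// sube0.
  - by rewrite -subr_gt0 opprK addr_gt0.
  - exact: continuous_subspaceT.
  - split=> [x _||]; first exact: dg.
    + apply: cvg_at_right_filter; exact: gc.
    + apply: cvg_at_left_filter; exact: gc.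
  - by move=> x _; rewrite derive1E.
rewrite -E [RHS]integral_mkcond; apply: eq_integral => x _.
rewrite /patch; case: ifPn => // xL; congr EFin.
apply: (@derive_out _ `[- L, L]%classic).
- exact: itv_closed.
- move=> y yL; apply: g0; rewrite ltNge; apply/negP => yM; apply: yL.
  by rewrite /= in_itv /= -ler_norml (le_trans yM)// ltW.
- by move=> Lx; rewrite mem_set in xL.
Qed.

End measure_rV.
Arguments cube {R} N M.
Arguments lebesgue_rV_sf {R} N.

(** * Fubini's theorem and integrals of partial derivatives *)

Section integral_partial.
Context {R : realType}.

Lemma consrVP N (p : R * 'rV[R]_N) (z : 'rV[R]_N.+1) :
  z ord0 (lshift N ord0 : 'I_(1 + N)) = p.1 ->
  (forall j, z ord0 (rshift 1 j : 'I_(1 + N)) = p.2 ord0 j) -> z = consrV p.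
Proof.
move=> z1 z2; apply/rowP => i; case: (@splitP 1 N i) => j ij.
  rewrite (_ : i = lshift N j :> 'I_(1 + N)); last exact/val_inj.
  by rewrite (ord1 j) consrV_l.
rewrite (_ : i = rshift 1 j); last exact/val_inj.
by rewrite consrV_r.
Qed.

Lemma consrV_lineR N (x : R) (y : 'rV[R]_N) :
  x *: delta_mx ord0 (lshift N ord0 : 'I_(1 + N)) + consrV (0, y) = consrV (x, y).
Proof.
apply: consrVP => [|j]; rewrite mxE.
  by rewrite consrV_l !mxE !eqxx mulr1 addr0.
by rewrite consrV_r !mxE eqxx -val_eqE /= mulr0 add0r.
Qed.

Lemma consrV_line N (x t : R) (y : 'rV[R]_N) (j : 'I_N) :
  t *: delta_mx ord0 (rshift 1 j : 'I_(1 + N)) + consrV (x, y) =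
  consrV (x, t *: delta_mx ord0 j + y).
Proof.
apply: consrVP => [|k]; rewrite mxE.
  by rewrite consrV_l !mxE eqxx -val_eqE /= mulr0 add0r.
by rewrite consrV_r !mxE eqxx -val_eqE /= eqn_add2l.
Qed.

Lemma continuous_consrVl N (y : 'rV[R]_N) : continuous (fun x : R => consrV (x, y) : 'rV[R]_N.+1).
Proof.
move=> x; under eq_fun do rewrite -consrV_lineR.
rewrite -consrV_lineR.
by apply: cvgD; [apply: cvgZr_tmp; exact: cvg_id|exact: cvg_cst].
Qed.

Lemma continuous_consrVr N (x : R) : continuous (fun y : 'rV[R]_N => consrV (x, y) : 'rV[R]_N.+1).
Proof.
move=> y U /nbhs_ballP[e /= e0 eU]; apply/nbhs_ballP; exists e => //= z [_ yz].
apply: eU; split=> // a i; rewrite (ord1 a); case: (@splitP 1 N i) => j ij.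
  rewrite (_ : i = lshift N j :> 'I_(1 + N)); last exact/val_inj.
  by rewrite (ord1 j) !consrV_l; exact: ballxx.
rewrite (_ : i = rshift 1 j); last exact/val_inj.
by rewrite !consrV_r; exact: yz.
Qed.

(** Both orders are provided because the group of variables containing the differentiated one has to
    be integrated first. *)
Lemma integral_lebesgue_rVS N (f : 'rV[R]_N.+1 -> R) :
  measurable_fun setT f ->
  (lebesgue_rV N.+1).-integrable setT (EFin \o f) ->
  ((\int[lebesgue_rV N.+1]_z (f z)%:E =
    \int[lebesgue_measure]_x \int[lebesgue_rV N]_y (f (consrV (x, y)))%:E) /\
   (\int[lebesgue_rV N.+1]_z (f z)%:E =
    \int[lebesgue_rV N]_y \int[lebesgue_measure]_x (f (consrV (x, y)))%:E))%E.
Proof.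
move=> mf intf.
pose m1 := @lebesgue_measure R; pose m2 := @lebesgue_rV_sf R N.
have mef : measurable_fun [set: 'rV[R]_N.+1] (EFin \o f) by exact/measurable_EFinP.
have mfc : measurable_fun setT ((EFin \o f) \o @consrV R N).
  by apply: (measurableT_comp mef); exact: measurable_consrV.
have int2 : (m1 \x^ m2)%E.-integrable setT ((EFin \o f) \o @consrV R N).
  have e : (\int[pushforward (m1 \x^ m2) (@consrV R N)]_z `|(f z)%:E| =
      \int[m1 \x^ m2]_p `|(f (consrV p))%:E|)%E.
    by rewrite ge0_integral_pushforward//; exact: measurableT_comp.
  apply/integrableP; split => //.
  have /integrableP[_] := intf; apply: le_lt_trans; rewrite le_eqVlt.
  by apply/orP; left; apply/eqP; exact: esym e.
have E : (\int[lebesgue_rV N.+1]_z (f z)%:E = \int[m1 \x^ m2]_p (f (consrV p))%:E)%E.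
  exact: integral_pushforward.
(* The measure is built with [\x^], while the Fubini statements below take integrability for [\x];
   uniqueness of the product measure identifies the two. *)
have int1 : (m1 \x m2)%E.-integrable setT ((EFin \o f) \o @consrV R N).
  apply/integrableP; split => //; have /integrableP[_] := int2.
  rewrite (@eq_measure_integral _ _ _ _ (m1 \x m2)%E)// => A mA _.
  apply/esym; apply: product_measure_unique => // B C mB mC.
  exact: product_measure2E.
split; rewrite E.
  by rewrite -(integral12_prod_meas2 int1).
by rewrite -(integral21_prod_meas2 int1).
Qed.

End integral_partial.

Section integral_partial_rV.
Context {R : realType}.

Lemma is_derive_consrVl N (f : 'rV[R]_N.+1 -> R) (x : R) (y : 'rV[R]_N) :
  (forall z, derivable f z (delta_mx ord0 (lshift N ord0 : 'I_(1 + N)))) ->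
  is_derive x (1 : R) (fun s => f (consrV (s, y)))
    (partial (lshift N ord0 : 'I_(1 + N)) f (consrV (x, y))).
Proof.
move=> df; have := is_derive_along (consrV (0, y)) x df.
rewrite consrV_lineR; congr is_derive.
by apply/funext => s; rewrite consrV_lineR.
Qed.

Lemma is_derive_consrVr N (f : 'rV[R]_N.+1 -> R) (x : R) (y : 'rV[R]_N) j :
  (forall z, derivable f z (delta_mx ord0 (rshift 1 j : 'I_(1 + N)))) ->
  is_derive y (delta_mx ord0 j) (fun z => f (consrV (x, z)))
    (partial (rshift 1 j : 'I_(1 + N)) f (consrV (x, y))).
Proof.
move=> df; have := is_derive_along (consrV (x, y)) 0 df.
rewrite scale0r add0r => h.
rewrite -[y in is_derive y]add0r -(scale0r (delta_mx ord0 j : 'rV[R]_N)).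
apply/is_derive_line; move: h; congr is_derive.
by apply/funext => s; rewrite consrV_line.
Qed.

Lemma continuous_compact_supp_integrable N (f : 'rV[R]_N -> R) M :
  continuous f -> (forall x, ~ cube N M x -> f x = 0) ->
  (lebesgue_rV N).-integrable setT (EFin \o f).
Proof.
move=> cf f0; apply: (compact_supp_integrable _ _ cf f0); last exact: cube_compact.
exact: lebesgue_cube.
Qed.

(** Induction on the dimension: the first coordinate is the one-dimensional case, the others use the
    induction hypothesis on slices. A cube is the support set because its slices lie in a cube of
    the same size. *)
Lemma integral_partial N (f : 'rV[R]_N -> R) i M :
  (forall x, derivable f x (delta_mx ord0 i)) -> continuous (partial i f) ->
  (forall x, ~ cube N M x -> f x = 0) ->
  (\int[lebesgue_rV N]_x (partial i f x)%:E = 0)%E.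
Proof.
elim: N => [|N IH] in f i *; first by case: i.
move=> df cf f0.
have pf0 x : ~ cube N.+1 M x -> partial i f x = 0.
  by apply: derive_out f0; exact: compact_closed_rV (cube_compact (N := N.+1) (M := M)).
have [E1 E2] := integral_lebesgue_rVS (continuous_measurable_rV cf)
  (continuous_compact_supp_integrable cf pf0).
case: (@splitP 1 N i) => j ij.
- have iE : i = (lshift N ord0 : 'I_(1 + N)) by apply/val_inj; rewrite /= ij (ord1 j).
  subst i; rewrite {}E2 {E1}; apply: integral0_eq => y _.
  pose g (x : R) := f (consrV (x, y)).
  have dg x := is_derive_consrVl x y df.
  have gE x : 'D_1 g x = partial (lshift N ord0 : 'I_(1 + N)) f (consrV (x, y)).
    by have [_ ] := dg x.
  transitivity (\int[lebesgue_measure]_x ('D_1 g x)%:E)%E.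
    by congr integral; apply/funext => x; rewrite gE.
  apply: (@integral_derive_R _ g M).
  + by move=> x; case: (dg x).
  + have -> : 'D_1 g = partial (lshift N ord0 : 'I_(1 + N)) f \o (fun x => consrV (x, y)).
      by apply/funext => x; rewrite gE.
    by move=> x; apply: continuous_comp; [exact: continuous_consrVl|exact: cf].
  + move=> x Mx; apply: f0 => /(_ (lshift N ord0 : 'I_(1 + N))).
    by rewrite consrV_l /= leNgt Mx.
- have iE : i = (rshift 1 j : 'I_(1 + N)) by apply/val_inj.
  subst i; rewrite {}E1 {E2}; apply: integral0_eq => x _.
  pose g (y : 'rV[R]_N) := f (consrV (x, y)).
  have dg y := is_derive_consrVr x y df.
  have gE : partial j g = partial (rshift 1 j : 'I_(1 + N)) f \o (fun y => consrV (x, y)).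
    by apply/funext => y; have [_ ] := dg y.
  have := IH g j; rewrite gE; apply.
  + by move=> y; case: (dg y).
  + by move=> y; apply: continuous_comp; [exact: continuous_consrVr|exact: cf].
  + move=> y My; apply: f0 => h; apply: My => k.
    by have := h (rshift 1 k : 'I_(1 + N)); rewrite consrV_r.
Qed.

End integral_partial_rV.

(** * Test functions on a domain and integration by parts *)

Section test_functions.
Context {R : realType} {N : nat} (Omega : domain R N).
Local Notation mu := (lebesgue_on Omega).
Local Notation H := (L2 mu).
Implicit Types (phi psi : 'rV[R]_N -> R).

Lemma measurable_domain : measurable (Omega : set 'rV[R]_N).
Proof. exact: open_measurable_rV (domain_open Omega). Qed.

Lemma integral_lebesgue_on (f : 'rV[R]_N -> \bar R) :
  (forall x, ~ domain_set Omega x -> f x = 0%E) ->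
  (\int[mu]_x f x = \int[lebesgue_rV N]_x f x)%E.
Proof.
move=> f0; have fE : f = f \_ Omega.
  apply/funext => x; rewrite /patch; case: ifPn => // /negP xO.
  by apply: f0 => Ox; apply: xO; rewrite inE.
rewrite fE -!integral_mkcond; apply: eq_measure_integral => A mA AO.
by rewrite /= /mrestr setIidl.
Qed.

Lemma lebesgue_on_compact (K : set 'rV[R]_N) : compact K -> (mu K < +oo)%E.
Proof.
move=> cK; apply: le_lt_trans (lebesgue_compact cK).
have mK := closed_measurable_rV (compact_closed_rV cK).
rewrite /= /mrestr; apply: le_measure => //; rewrite inE //.
exact: measurableI mK measurable_domain.
Qed.

Lemma test_partial phi i : test_function Omega phi -> test_function Omega (partial i phi).
Proof.
move=> [sphi [K [cK KO phi0]]]; split; first exact: smooth_partial.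
exists K; split=> // x; apply: derive_out phi0; exact: compact_closed_rV.
Qed.

Lemma test_foldr phi s : test_function Omega phi -> test_function Omega (foldr partial phi s).
Proof. by move=> tphi; elim: s => //= i s; exact: test_partial. Qed.

Lemma test_smooth phi : test_function Omega phi -> smooth phi.
Proof. by case. Qed.

Lemma testM phi psi : test_function Omega phi -> smooth psi ->
  test_function Omega (phi * psi).
Proof.
move=> [sphi [K [cK KO phi0]]] spsi; split; first exact: smoothM.
by exists K; split=> // x /phi0 p0; rewrite mulrfctE p0 mul0r.
Qed.

Lemma testZ (a : R) phi : test_function Omega phi -> test_function Omega (a *: phi).
Proof.
move=> [sphi [K [cK KO phi0]]]; split; first exact: smoothZ.
by exists K; split=> // x /phi0 p0; rewrite scalrfctE p0 scaler0.
Qed.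

Lemma testD phi psi : test_function Omega phi -> test_function Omega psi ->
  test_function Omega (phi + psi).
Proof.
move=> [sphi [K [cK KO phi0]]] [spsi [L [cL LO psi0]]]; split; first exact: smoothD.
exists (K `|` L); split; first exact: compactU.
- by move=> x [/KO|/LO].
- by move=> x /not_orP[/phi0 p0 /psi0 q0]; rewrite addrfctE p0 q0 addr0.
Qed.

Lemma test0 : test_function Omega (0 : 'rV[R]_N -> R).
Proof. by split; [exact: smooth0|exists set0; split => //; exact: compact0]. Qed.

Lemma test_sum (I : Type) (r : seq I) (P : pred I) (F : I -> 'rV[R]_N -> R) :
  (forall i, P i -> test_function Omega (F i)) ->
  test_function Omega (\sum_(i <- r | P i) F i).
Proof.
move=> tF; elim/big_ind: _ => [|f g tf tg|i Pi]; first exact: test0.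
- exact: testD.
- exact: tF.
Qed.

Lemma test_measurable phi : test_function Omega phi -> measurable_fun setT phi.
Proof. by move=> [sphi _]; apply: continuous_measurable_rV; exact: smooth_continuous. Qed.

Lemma test_Lfun phi : test_function Omega phi -> phi \in Lfun mu 2%:E.
Proof.
move=> [sphi [K [cK KO phi0]]].
apply: compact_supp_Lfun2 phi0; [exact: lebesgue_on_compact|exact: cK|].
exact: smooth_continuous.
Qed.

Lemma Rintegral_partial phi i : test_function Omega phi -> \int[mu]_x partial i phi x = 0.
Proof.
move=> tphi; have [_ [L [cL LO pphi0]]] := test_partial i tphi.
have [sphi [K [cK KO phi0]]] := tphi.
rewrite /Rintegral integral_lebesgue_on; last by move=> x nO; rewrite pphi0// => /LO.
have [M KM] := compact_cube cK.
rewrite (@integral_partial _ _ _ _ M)//.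
- by move=> x; exact: smooth_derivable.
- exact: smooth_continuous (smooth_partial i sphi).
- by move=> x nM; apply: phi0 => /KM.
Qed.

Lemma integration_by_parts_test phi psi i :
  test_function Omega phi -> test_function Omega psi ->
  \int[mu]_x (partial i phi x * psi x) = - \int[mu]_x (phi x * partial i psi x).
Proof.
move=> tphi tpsi; have sphi := test_smooth tphi; have spsi := test_smooth tpsi.
apply/eqP; rewrite -addr_eq0 -RintegralD//.
- have := Rintegral_partial i (testM tphi spsi).
  by rewrite partialM// => ->.
- exact: Lfun2_mul_integrable (test_Lfun (test_partial i tphi)) (test_Lfun tpsi).
- exact: Lfun2_mul_integrable (test_Lfun tphi) (test_Lfun (test_partial i tpsi)).
Qed.

(** Derivatives move over one at a time, which reverses their order; commutation of derivatives
    restores it. *)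
Lemma integration_by_parts_foldr phi psi s :
  test_function Omega phi -> test_function Omega psi ->
  \int[mu]_x (phi x * foldr partial psi s x) =
  (-1) ^+ size s * \int[mu]_x (foldr partial phi s x * psi x).
Proof.
move=> tphi tpsi; elim: s phi tphi => [|i s IH] phi tphi /=; first by rewrite mul1r.
rewrite -[LHS]opprK -integration_by_parts_test//; last exact: test_foldr.
rewrite (IH _ (test_partial i tphi)) exprS mulN1r mulNr.
by rewrite foldr_partial_cons_rcons//; exact: test_smooth.
Qed.

End test_functions.

(** * The fundamental lemma of the calculus of variations *)

Section box_sigma_algebra.
Context {R : realType} (N : nat).

Definition open_boxes : set (set 'rV[R]_N) := [set S | exists a b, S = open_box a b].

Lemma open_boxI (a b a' b' : 'rV[R]_N) : open_box a b `&` open_box a' b' =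
  open_box (\row_i Num.max (a ord0 i) (a' ord0 i)) (\row_i Num.min (b ord0 i) (b' ord0 i)).
Proof.
apply/seteqP; split=> x /=.
  move=> [h1 h2] i; have /andP[ai bi] := h1 i; have /andP[ai' bi'] := h2 i.
  by rewrite !mxE gt_max lt_min ai ai' bi.
move=> h; split=> i; have := h i; rewrite !mxE gt_max lt_min.
  by move=> /andP[/andP[-> _] /andP[->]].
by move=> /andP[/andP[_ ->] /andP[_ ->]].
Qed.

Lemma open_box_sub_closed (a b : 'rV[R]_N) : open_box a b `<=` closed_box a b.
Proof. by move=> x h i; have /andP[/ltW -> /ltW ->] := h i. Qed.

Lemma open_box_measurable (a b : 'rV[R]_N) : measurable (open_box a b).
Proof.
have -> : open_box a b =
    \bigcap_(i in [set: 'I_N]) ((@rV_coord R N i) @^-1` `]a ord0 i, b ord0 i[%classic).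
  apply/seteqP; split=> x h i => [_ /=|].
    by rewrite in_itv /=; exact: h.
  by have := h i I; rewrite /= in_itv.
apply: fin_bigcap_measurable; first exact: finite_finset.
move=> i _; rewrite -[X in measurable X]setTI.
exact: measurable_rV_coord.
Qed.

Lemma open_boxes_setI_closed : setI_closed open_boxes.
Proof.
by move=> _ _ [a [b ->]] [a' [b' ->]]; rewrite open_boxI; do 2 eexists.
Qed.

Let boxT := g_sigma_algebraType open_boxes.

Let measurable_boxT_id : measurable_fun [set: boxT] (id : boxT -> 'rV[R]_N).
Proof.
apply: measurable_fun_rVP => i.
apply: (measurability _ (RGenOInfty.measurableE R)).
move=> _ [_ [r ->] <-]; rewrite setTI.
have -> : (fun t : boxT => (t : 'rV[R]_N) ord0 i) @^-1` `]r, +oo[%classic =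
    \bigcup_n (open_box (\row_j if j == i then r else - n%:R) (const_mx n%:R)).
  apply/seteqP; split=> [x /=|x [n _ /(_ i)]]; last first.
    by rewrite !mxE eqxx /= in_itv /= andbT => /andP[].
  rewrite in_itv /= andbT => rx.
  have [M hM] := compact_cube (@compact_set1 _ (x : 'rV[R]_N)).
  exists (Num.bound `|M|).+1 => // j; rewrite !mxE.
  have : `|(x : 'rV[R]_N) ord0 j| < (Num.bound `|M|).+1%:R.
    apply: le_lt_trans (hM x erefl j) _; apply: le_lt_trans (ler_norm _) _.
    by apply: lt_trans (archi_boundP _) _ => //; rewrite ltr_nat.
  rewrite ltr_norml => /andP[h1 ->]; rewrite andbT; case: eqP => [->//|_]; exact: h1.
by apply: bigcupT_measurable => n; apply: sub_sigma_algebra; do 2 eexists.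
Qed.

(** This is the form that Dynkin induction asks for. Each half-space bounding one coordinate from
    below is a countable union of boxes. *)
Lemma measurable_open_boxes : @measurable _ 'rV[R]_N = <<s open_boxes >>.
Proof.
apply/seteqP; split=> [A mA|].
  by have := measurable_boxT_id measurableT mA; rewrite setTI.
apply: smallest_sub; first exact: sigma_algebra_measurable.
by move=> _ [a [b ->]]; exact: open_box_measurable.
Qed.

(** Rational centres and radii 1 / (n + 1) make the covering family countable, so that exceptional
    null sets can be united. *)
Lemma box_cover (Omega : set 'rV[R]_N) x : open Omega -> Omega x ->
  exists p : 'rV[rat]_N * nat,
    let c : 'rV[R]_N := map_mx ratr p.1 in
    let r : 'rV[R]_N := const_mx p.2.+1%:R^-1 in
    closed_box (c - r) (c + r) `<=` Omega /\ open_box (c - r) (c + r) x.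
Proof.
move=> oO Ox.
have /nbhs_ballP[e /= e0 eO] : nbhs x Omega by exact: open_nbhs_nbhs.
have [n ne] : exists n : nat, (n.+1%:R^-1 : R) < e / 2.
  have := @near_infty_natSinv_lt R (PosNum (divr_gt0 e0 (ltr0n R 2))).
  by move=> [n _ /(_ n (leqnn n))] /= h; exists n.
have n0 : (0 : R) < n.+1%:R^-1 by rewrite invr_gt0 ltr0n.
have q_ i : exists q : rat, `|x ord0 i - ratr q| < n.+1%:R^-1.
  have : x ord0 i - n.+1%:R^-1 < x ord0 i + n.+1%:R^-1.
    by rewrite ltrBlDr -addrA ltrDl addr_gt0.
  by move/rat_in_itvoo => [q]; rewrite in_itv/= => xq; exists q; rewrite ltr_distlC.
have [q qx] := choice q_.
exists (\row_i q i, n) => /=; split=> [y hy|i].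
  apply: eO; split=> // i j; rewrite (ord1 i) /ball /=.
  have := hy j; rewrite !mxE -ler_distlC distrC => qy.
  rewrite (splitr e) (le_lt_trans (ler_distD (ratr (q j)) _ _))// ltrD//.
    exact: lt_trans (qx j) ne.
  first [exact: le_lt_trans qy ne | rewrite distrC; exact: le_lt_trans qy ne].
by rewrite !mxE -ltr_distlC distrC.
Qed.

End box_sigma_algebra.

(** * Elements of L^2 orthogonal to all test functions *)

Section fundamental_lemma.
Context {R : realType} {N : nat} (Omega : domain R N).
Local Notation mu := (lebesgue_on Omega).
Local Notation H := (L2 mu).
Implicit Types (u v : H) (phi psi : 'rV[R]_N -> R) (a b : 'rV[R]_N).

Lemma closed_box_indic_Lfun a b : \1_(closed_box a b) \in Lfun mu 2%:E.
Proof.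
have mK : measurable (closed_box a b).
  exact: closed_measurable_rV (compact_closed_rV (closed_box_compact (a := a) (b := b))).
apply: Lfun2P; first exact: measurable_indic.
rewrite (eq_integral (fun x => (\1_(closed_box a b) x)%:E)); last first.
  by move=> x _; rewrite indicE; case: (_ \in _); rewrite ?expr1n ?expr0n.
by rewrite integral_indic// setIT; apply: lebesgue_on_compact; exact: closed_box_compact.
Qed.

Lemma L2_integrable_box u a b : mu.-integrable (open_box a b) (EFin \o (u : _ -> R)).
Proof.
have mK : measurable (closed_box a b).
  exact: closed_measurable_rV (compact_closed_rV (closed_box_compact (a := a) (b := b))).
apply: (@integrableS _ _ _ mu (closed_box a b)) => //.
- exact: open_box_measurable.
- exact: open_box_sub_closed.
- apply/(integrable_mkcond _ mK).
  have := Lfun2_mul_integrable (L2_Lfun u) (closed_box_indic_Lfun a b).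
  congr (_.-integrable _ _); apply/funext => x; rewrite /patch /= indicE.
  by case: ifPn => _; rewrite ?mulr1 ?mulr0.
Qed.

(** Dominated convergence along the bump functions, with |u| times the indicator of the closed box
    as integrable bound. *)
Lemma integral_box_eq0 u a b :
  (forall psi, test_function Omega psi -> \int[mu]_x (u x * psi x) = 0) ->
  closed_box a b `<=` Omega ->
  (\int[mu]_(x in open_box a b) (u x)%:E = 0)%E.
Proof.
move=> u0 abO; have mQ := open_box_measurable a b.
have mu_ := L2_measurable u.
have tb n := test_function_bump n abO.
have ib n : (\int[mu]_x (u x * bump a b n x)%:E = 0)%E.
  have fn := integrable_fin_num measurableT
    (Lfun2_mul_integrable (L2_Lfun u) (test_Lfun (tb n))).
  by rewrite -[LHS]fineK//; congr EFin; exact: u0 (tb n).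
have [] := @dominated_convergence _ _ _ mu setT measurableT
  (fun n x => (u x * bump a b n x)%:E) (fun x => (u x * \1_(open_box a b) x)%:E)
  (fun x => `|u x * \1_(closed_box a b) x|%:E).
- move=> n; apply/measurable_EFinP; apply: measurable_funM => //.
  exact: test_measurable (tb n).
- by apply/measurable_EFinP; apply: measurable_funM => //; exact: measurable_indic.
- apply: aeW => x _; apply: cvg_EFin; first exact: nearW.
  apply: cvgMl_tmp; rewrite indicE; have [Qx|nQx] := pselect (open_box a b x).
    by rewrite mem_set//; exact: bump_cvg.
  rewrite memNset//=; under eq_fun do rewrite bump_out//.
  exact: cvg_cst.
- have := Lfun2_mul_integrable (L2_Lfun u) (closed_box_indic_Lfun a b).
  by move/integrable_abse.
- apply: aeW => x n _; rewrite abse_EFin lee_fin !normrM ler_wpM2l//.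
  rewrite indicE; have [Kx|nKx] := pselect (closed_box a b x).
    by rewrite mem_set// normr1 ger0_norm ?bump_ge0// bump_le1.
  by rewrite bump_out ?normr0// => /open_box_sub_closed.
move=> _ _ /=; under eq_fun do rewrite ib.
move=> h; have : (\int[mu]_x (u x * \1_(open_box a b) x)%:E = 0)%E.
  exact: cvg_unique h (cvg_cst _).
move=> <-; rewrite integral_mkcond; apply: eq_integral => x _.
by rewrite /patch indicE; case: ifPn => _; rewrite ?mulr1 ?mulr0.
Qed.

(* The sets S with \int_(S /\ Q) u = 0 form a Dynkin system containing the boxes. *)
Lemma ae_eq0_box u a b :
  (forall psi, test_function Omega psi -> \int[mu]_x (u x * psi x) = 0) ->
  closed_box a b `<=` Omega ->
  {ae mu, forall x, open_box a b x -> u x = 0}.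
Proof.
move=> u0 abO; pose Q := open_box a b; have mQ : measurable Q := open_box_measurable a b.
have iu : mu.-integrable Q (EFin \o (u : _ -> R)) := L2_integrable_box u a b.
pose P (S : set 'rV[R]_N) := (\int[mu]_(x in S `&` Q) (u x)%:E = 0)%E.
have PT : P setT by rewrite /P setTI; exact: integral_box_eq0.
have mu_ : measurable_fun setT (EFin \o (u : _ -> R)).
  by apply/measurable_EFinP; exact: L2_measurable.
have PS S : measurable S -> P S.
  rewrite measurable_open_boxes => sS.
  apply: (dynkin_induction (measurable_open_boxes N) _ PT _ _ _ sS).
  - exact: open_boxes_setI_closed.
  - move=> _ [a' [b' ->]]; rewrite /P /Q open_boxI; apply: integral_box_eq0 => //.
    move=> x h; apply: abO => i; have := h i; rewrite !mxE ge_max le_min.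
    by move=> /andP[/andP[_ ->] /andP[_ ->]].
  - move=> A mA PA; have : P setT := PT; rewrite /P setTI -[in LHS](setUIDK Q A).
    rewrite integral_setU => //.
    + by rewrite setIC PA add0e setIC -setDE.
    + exact: measurableI.
    + exact: measurableD.
    + exact: measurable_funTS.
    + by apply/disj_setPS => x [[_ Ax] [_ /(_ Ax)]].
  - move=> F mF tF PF; rewrite /P setI_bigcupl integral_bigcup.
    + by rewrite eseries0// => n _ _; exact: PF.
    + exact: trivIset_setIr.
    + by move=> k; exact: measurableI.
    + apply: integrableS iu => //.
        by apply: bigcupT_measurable => k; exact: measurableI.
      by apply: bigcup_sub => k _; exact: subIsetr.
have := @integral_ae_eq _ _ _ mu Q mQ (cst 0%E) (EFin \o (u : _ -> R)) iu.
move=> /(_ (@measurable_cst _ _ _ _ _ _)) h.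
have : ae_eq mu Q (EFin \o (u : _ -> R)) (cst 0%E).
  apply: h => E EQ mE; rewrite integral_cst// mul0e.
  by have := PS E mE; rewrite /P setIidl.
by apply: filterS => x h' Qx; have := h' Qx => -[].
Qed.

Lemma ae_domain : {ae mu, forall x, domain_set Omega x}.
Proof.
exists (~` (Omega : set 'rV[R]_N)); split=> //.
  exact: measurableC (measurable_domain Omega).
by rewrite /= /mrestr setICl measure0.
Qed.

Lemma L2_fundamental_lemma u :
  (forall psi, test_function Omega psi -> \int[mu]_x (u x * psi x) = 0) -> u = 0.
Proof.
move=> u0; pose c (p : 'rV[rat]_N * nat) : 'rV[R]_N := map_mx ratr p.1.
pose r (p : 'rV[rat]_N * nat) : 'rV[R]_N := const_mx p.2.+1%:R^-1.
(* One null set for all rational boxes contained in the domain: [unpickle] enumerates them by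
   natural numbers. *)
have : {ae mu, forall x, forall n : nat, forall p, unpickle n = Some p ->
    closed_box (c p - r p) (c p + r p) `<=` Omega ->
    open_box (c p - r p) (c p + r p) x -> u x = 0}.
  apply: ae_foralln => n; case E : (unpickle n) => [p|]; last by apply: aeW.
  have [pO|npO] := pselect (closed_box (c p - r p) (c p + r p) `<=` Omega).
    have := ae_eq0_box u0 pO; apply: filterS => x h q [<-] _; exact: h.
  by apply: aeW => x q [<-].
move=> h; apply/L2_eqP; apply: ae_eq_trans (ae_eq_sym (L20_ae mu)).
have := ae_domain; apply: filterS2 h => x h Ox _.
have [p [pO px]] := box_cover (domain_open Omega) Ox.
exact: h (pickle p) p (pickleK p) pO px.
Qed.

End fundamental_lemma.

#[local] Opaque partial.

(** * Weak derivatives *)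

Section toL2_linear.
Context d (T : measurableType d) (R : realType) (mu : {measure set T -> \bar R}).

Lemma toL2D (f g : T -> R) : f \in Lfun mu 2%:E -> g \in Lfun mu 2%:E ->
  toL2 mu (f + g) = toL2 mu f + toL2 mu g.
Proof.
move=> fL gL; apply: toL2_eq; apply: ae_eq_trans (L2D_ae _ _) _.
have := toL2P fL; have := toL2P gL; apply: filterS2 => x /(_ I) gx /(_ I) fx _.
by rewrite gx fx.
Qed.

Lemma toL2Z (a : R) (f : T -> R) : f \in Lfun mu 2%:E ->
  toL2 mu (a *: f) = a *: toL2 mu f.
Proof.
move=> fL; apply: toL2_eq; apply: ae_eq_trans (L2Z_ae _ _) _.
by have := toL2P fL; apply: filterS => x /(_ I) fx _; rewrite fx.
Qed.

Lemma toL20 : toL2 mu (0 : T -> R) = 0.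
Proof. by apply: toL2_eq; exact: L20_ae. Qed.

End toL2_linear.

Section weak_derivatives.
Context {R : realType} {N : nat} (Omega : domain R N).
Local Notation mu := (lebesgue_on Omega).
Local Notation H := (L2 mu).
Local Notation tst := (toL2 mu).
Local Notation test := (test_function (domain_set Omega)).
Implicit Types (u v w f g : H) (phi psi : 'rV[R]_N -> R) (a : 'I_N -> nat).

Lemma tstD phi psi : test phi -> test psi -> tst (phi + psi) = tst phi + tst psi.
Proof. by move=> tp tq; apply: toL2D; exact: test_Lfun. Qed.

Lemma tstZ (c : R) phi : test phi -> tst (c *: phi) = c *: tst phi.
Proof. by move=> tp; apply: toL2Z; exact: test_Lfun. Qed.

Lemma testB phi psi : test phi -> test psi -> test (phi - psi).
Proof. by move=> tp tq; rewrite -scaleN1r; apply: testD => //; exact: testZ. Qed.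

Lemma tstB phi psi : test phi -> test psi -> tst (phi - psi) = tst phi - tst psi.
Proof.
by move=> tp tq; rewrite -scaleN1r tstD//; [rewrite tstZ// scaleN1r|exact: testZ].
Qed.

Lemma tst_sum (I : Type) (r : seq I) (F : I -> 'rV[R]_N -> R) :
  (forall i, test (F i)) -> tst (\sum_(i <- r) F i) = \sum_(i <- r) tst (F i).
Proof.
move=> tF; elim: r => [|i r IH]; first by rewrite !big_nil toL20.
by rewrite !big_cons tstD// ?IH//; exact: test_sum.
Qed.

Lemma test_dotE u psi : test psi -> '[u, tst psi] = \int[mu]_x (u x * psi x).
Proof. by move=> tp; apply: L2_dotE; exact: test_Lfun. Qed.

Lemma L2_test_eq0 u : (forall psi, test psi -> '[u, tst psi] = 0) -> u = 0.
Proof.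
by move=> h; apply: L2_fundamental_lemma => psi tp; rewrite -test_dotE// h.
Qed.

Lemma Cc_inftyP v : Cc_infty Omega v <-> exists2 phi, test phi & v = tst phi.
Proof.
split=> -[phi tp vp]; exists phi => //.
  by apply/esym; exact: toL2_eq.
by subst v; exact: toL2P (test_Lfun tp).
Qed.

Lemma test_mpartial a psi : test psi -> test (mpartial a psi).
Proof. by move=> tp; rewrite mpartialE; exact: test_foldr. Qed.

Lemma dot_foldr phi psi s : test phi -> test psi ->
  '[tst (foldr partial phi s), tst psi] = (-1) ^+ size s * '[tst phi, tst (foldr partial psi s)].
Proof.
move=> tp tq; have ts := test_foldr s tq; have ts' := test_foldr s tp.
have ibp := integration_by_parts_foldr s tp tq.
have E (f g : 'rV[R]_N -> R) : test f -> test g -> '[tst f, tst g] = \int[mu]_x (f x * g x).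
  move=> tf tg; rewrite test_dotE//; apply: ae_eq_Rintegral.
  - by apply: measurable_funM; [exact: L2_measurable|exact: test_measurable tg].
  - by apply: measurable_funM; [exact: test_measurable tf|exact: test_measurable tg].
  - by have := toL2P (test_Lfun tf); apply: filterS => x /(_ I) -> _.
by rewrite (E _ _ ts' tq) (E _ _ tp ts) ibp mulrA -expr2 sqrr_sign mul1r.
Qed.

Lemma is_wpartialP a u g : is_wpartial a u g <->
  forall psi, test psi -> '[u, tst (mpartial a psi)] = (-1) ^+ mindex_len a * '[g, tst psi].
Proof.
split=> h psi tp; have := h _ tp; rewrite test_dotE ?test_dotE//;
  exact: test_mpartial.
Qed.

Lemma is_wpartial_uniq a u g g' : is_wpartial a u g -> is_wpartial a u g' -> g = g'.
Proof.
move=> /is_wpartialP h /is_wpartialP h'; apply/eqP; rewrite -subr_eq0; apply/eqP.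
apply: L2_test_eq0 => psi tp; rewrite L2_dotBl; apply/eqP; rewrite subr_eq0; apply/eqP.
have s0 : (-1) ^+ mindex_len a != 0 :> R by rewrite expf_neq0// oppr_eq0 oner_eq0.
by apply: (mulfI s0); rewrite -h// -h'.
Qed.

Lemma wpartialE a u g : is_wpartial a u g -> wpartial a u = g.
Proof.
move=> h; rewrite /wpartial; case: xgetP => [g' _ h'|/(_ g)//].
exact: is_wpartial_uniq h' h.
Qed.

Lemma is_wpartial_lin a (c : R) u v g h : is_wpartial a u g -> is_wpartial a v h ->
  is_wpartial a (c *: u + v) (c *: g + h).
Proof.
move=> /is_wpartialP hu /is_wpartialP hv; apply/is_wpartialP => psi tp.
by rewrite !L2_dotDl !L2_dotZl hu// hv// mulrDr mulrCA.
Qed.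

Lemma is_wpartialB a u v g h : is_wpartial a u g -> is_wpartial a v h ->
  is_wpartial a (u - v) (g - h).
Proof.
move=> hu hv; rewrite [u - v]addrC [g - h]addrC -scaleN1r -(scaleN1r h).
exact: is_wpartial_lin.
Qed.

(** Against a fixed test function both sides of the defining identity are continuous in L^2. *)
Lemma is_wpartial_limit a u g :
  (forall e : R, 0 < e -> exists v h, [/\ is_wpartial a v h, `|u - v| < e & `|g - h| < e]) ->
  is_wpartial a u g.
Proof.
move=> lim; apply/is_wpartialP => psi tp; apply/eqP; rewrite -subr_eq0; apply/eqP.
apply: (@eq0_small _ _ (`|tst (mpartial a psi)| + `|tst psi|)) => e e0.
have [v [h [/is_wpartialP vh uv gh]]] := lim e e0.
have -> : '[u, tst (mpartial a psi)] - (-1) ^+ mindex_len a * '[g, tst psi] =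
    '[u - v, tst (mpartial a psi)] - (-1) ^+ mindex_len a * '[g - h, tst psi].
  by rewrite !L2_dotBl vh// mulrBr; ring.
rewrite (le_trans (ler_normB _ _))// mulrDr lerD//.
  by rewrite (le_trans (L2_CauchySchwarz _ _))// ler_wpM2r// ltW.
rewrite normrM normrX normrN1 expr1n mul1r.
by rewrite (le_trans (L2_CauchySchwarz _ _))// ler_wpM2r// ltW.
Qed.

Lemma is_wpartial_tst a phi : test phi -> is_wpartial a (tst phi) (tst (mpartial a phi)).
Proof.
move=> tp; apply/is_wpartialP => psi tq.
rewrite [mpartial a psi]mpartialE [mpartial a phi]mpartialE dot_foldr//.
by rewrite size_mindex_seq mulrA -expr2 sqrr_sign mul1r.
Qed.

Lemma laplacianE phi : laplacian phi = \sum_(i < N) foldr partial phi [:: i; i].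
Proof. by apply/funext => x; rewrite /laplacian fct_sumE. Qed.

#[local] Opaque toL2 L2_dot laplacian.

Lemma test_laplacian phi : test phi -> test (laplacian phi).
Proof. by move=> tp; rewrite laplacianE; apply: test_sum => i _; exact: test_foldr. Qed.

Lemma test_bilaplacian phi : test phi -> test (laplacian (laplacian phi)).
Proof. by move=> tp; do 2 apply: test_laplacian. Qed.

Lemma foldr_partialD phi psi s : test phi -> test psi ->
  foldr partial (phi + psi) s = foldr partial phi s + foldr partial psi s.
Proof.
move=> tp tq; elim: s => //= i s ->.
exact: (partialD i (smooth_foldr s (test_smooth tp)) (smooth_foldr s (test_smooth tq))).
Qed.

Lemma foldr_partialZ (c : R) phi s : test phi ->
  foldr partial (c *: phi) s = c *: foldr partial phi s.
Proof.
move=> tp; elim: s => //= i s ->.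
exact: (partialZ i c (smooth_foldr s (test_smooth tp))).
Qed.

Lemma foldr_partial0 s : foldr partial (0 : 'rV[R]_N -> R) s = 0.
Proof. by elim: s => //= i s ->; exact: partial0. Qed.

Lemma foldr_partial_sum (I : Type) (r : seq I) (F : I -> 'rV[R]_N -> R) s :
  (forall i, test (F i)) ->
  foldr partial (\sum_(i <- r) F i) s = \sum_(i <- r) foldr partial (F i) s.
Proof.
move=> tF; elim: r => [|i r IH]; first by rewrite !big_nil foldr_partial0.
by rewrite !big_cons foldr_partialD// ?IH//; exact: test_sum.
Qed.

Lemma laplacianD phi psi : test phi -> test psi ->
  laplacian (phi + psi) = laplacian phi + laplacian psi.
Proof.
move=> tp tq; rewrite !laplacianE -big_split; apply: eq_bigr => i _.
exact: foldr_partialD.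
Qed.

Lemma laplacianZ (c : R) phi : test phi -> laplacian (c *: phi) = c *: laplacian phi.
Proof.
move=> tp; rewrite !laplacianE scaler_sumr; apply: eq_bigr => i _.
exact: foldr_partialZ.
Qed.

Lemma laplacian_foldr phi s : test phi ->
  laplacian (foldr partial phi s) = foldr partial (laplacian phi) s.
Proof.
move=> tp; rewrite !laplacianE foldr_partial_sum; last by move=> i; exact: test_foldr.
apply: eq_bigr => i _; rewrite -!foldr_cat.
by apply: foldr_partial_perm; [exact: test_smooth tp|rewrite perm_catC].
Qed.

(** Displays Delta^2 as a sum of derivatives of order four, so that convergence in the norm of H^4
    passes to it. *)
Lemma bilaplacianE phi : test phi -> laplacian (laplacian phi) =
  \sum_(i < N) \sum_(j < N) mpartial (fun k => count_mem k [:: i; i; j; j]) phi.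
Proof.
move=> tp; rewrite laplacianE; apply: eq_bigr => i _.
rewrite [laplacian phi]laplacianE foldr_partial_sum; last by move=> j; exact: test_foldr.
apply: eq_bigr => j _; rewrite mpartial_count//; exact: test_smooth tp.
Qed.

Lemma dot_suml (I : Type) (r : seq I) (F : I -> H) v :
  '[\sum_(i <- r) F i, v] = \sum_(i <- r) '[F i, v].
Proof. by elim/big_rec2: _ => [|i y x _ <-]; rewrite ?L2_dot0l ?L2_dotDl. Qed.

Lemma tst_laplacian phi : test phi ->
  tst (laplacian phi) = \sum_(i < N) tst (foldr partial phi [:: i; i]).
Proof.
move=> tp; rewrite laplacianE; apply: tst_sum => i; exact: test_foldr.
Qed.

Lemma dot_laplacian phi psi : test phi -> test psi ->
  '[tst (laplacian phi), tst psi] = '[tst phi, tst (laplacian psi)].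
Proof.
move=> tp tq.
have key (A B a b : H) (F G : 'I_N -> H) : A = \sum_i F i -> B = \sum_i G i ->
    (forall i, '[F i, b] = (-1) ^+ 2 * '[a, G i]) -> '[A, b] = '[a, B].
  move=> -> -> h; rewrite dot_suml L2_dotC dot_suml; apply: eq_bigr => i _.
  by rewrite h sqrrN expr1n mul1r L2_dotC.
exact: (key _ _ _ _ _ _ (tst_laplacian tp) (tst_laplacian tq)
  (fun i => dot_foldr [:: i; i] tp tq)).
Qed.

Lemma is_bilaplacianP u f : is_bilaplacian u f <->
  forall psi, test psi -> '[u, tst (laplacian (laplacian psi))] = '[f, tst psi].
Proof.
split=> h psi tp; have := h _ tp; rewrite test_dotE ?test_dotE//;
  exact: test_bilaplacian.
Qed.

Lemma is_bilaplacian_uniq u f g : is_bilaplacian u f -> is_bilaplacian u g -> f = g.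
Proof.
move=> /is_bilaplacianP h /is_bilaplacianP h'; apply/eqP; rewrite -subr_eq0; apply/eqP.
by apply: L2_test_eq0 => psi tp; rewrite L2_dotBl -h// -h'// subrr.
Qed.

Lemma bilaplacian_eq u f : is_bilaplacian u f -> bilaplacian u = f.
Proof.
move=> h; rewrite /bilaplacian; case: xgetP => [g _ h'|/(_ f)//].
exact: is_bilaplacian_uniq h' h.
Qed.

End weak_derivatives.

#[local] Opaque toL2 L2_dot laplacian.

(** * A priori estimates for test functions *)

Section estimates.
Context {R : realType} {N : nat} (Omega : domain R N).
Local Notation mu := (lebesgue_on Omega).
Local Notation H := (L2 mu).
Local Notation tst := (toL2 mu).
Local Notation test := (test_function (domain_set Omega)).
Implicit Types (u v w f g : H) (phi psi : 'rV[R]_N -> R) (a : 'I_N -> nat).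

Lemma is_wpartial0 a : is_wpartial a (0 : H) 0.
Proof. by apply/is_wpartialP => psi tp; rewrite !L2_dot0l mulr0. Qed.

Lemma sum_le_card (I : finType) (P : pred I) (F : I -> R) (D : R) : 0 <= D ->
  (forall i, P i -> F i <= D) -> \sum_(i | P i) F i <= #|I|%:R * D.
Proof.
move=> D0 hF; apply: (@le_trans _ _ (\sum_(i : I) D)).
  by rewrite big_mkcond; apply: ler_sum => i _; case: ifP => // /hF.
by rewrite sumr_const mulr_natl.
Qed.

Lemma Hk_norm_le k u (C : R) : 0 <= C ->
  (forall a, (mindex_len a <= k)%N -> `|wpartial a u| <= C) ->
  Hk_norm Omega k u <= Num.sqrt (#|{ffun 'I_N -> 'I_k.+1}|%:R) * C.
Proof.
move=> C0 hC; rewrite -ler_sqr ?nnegrE ?mulr_ge0 ?sqrtr_ge0// exprMn !sqr_sqrtr//.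
  by apply: sum_le_card => [|b bk]; rewrite ?sqr_ge0// lerXn2r ?nnegrE// hC.
by apply: sumr_ge0 => b _; exact: sqr_ge0.
Qed.

Lemma wpartial_le_Hk_norm k u a : (mindex_len a <= k)%N ->
  `|wpartial a u| <= Hk_norm Omega k u.
Proof.
move=> ak; have ai i : (a i <= k)%N.
  by apply: leq_trans ak; rewrite /mindex_len (bigD1 i)//= leq_addr.
(* Entries of a multi-index of length at most k are at most k, so it occurs in the finite sum
   defining [Hk_norm]. *)
pose b := [ffun i => inord (a i) : 'I_k.+1].
have ba : (fun i => b i : nat) = a.
  by apply/funext => i; rewrite ffunE inordK// ltnS.
rewrite -ler_sqr ?nnegrE ?sqrtr_ge0// sqr_sqrtr; last first.
  by apply: sumr_ge0 => c _; exact: sqr_ge0.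
by rewrite (bigD1 b) ?ba//= lerDl; apply: sumr_ge0 => c _; exact: sqr_ge0.
Qed.

Lemma Hk_tst k phi : test phi -> Hk Omega k (tst phi).
Proof. by move=> tp a _; exists (tst (mpartial a phi)); exact: is_wpartial_tst. Qed.

Lemma Hk_norm0 k : Hk_norm Omega k 0 = 0.
Proof.
rewrite /Hk_norm big1 ?sqrtr0// => b _.
by rewrite (wpartialE (is_wpartial0 _)) normr0 expr0n.
Qed.

Lemma H0k_tst k phi : test phi -> H0k Omega k (tst phi).
Proof.
move=> tp; split; first exact: Hk_tst.
move=> e e0; exists (tst phi); first by apply/Cc_inftyP; exists phi.
by rewrite subrr Hk_norm0.
Qed.

Lemma grad_norm_tst phi : test phi ->
  grad_norm (tst phi) ^+ 2 = \sum_(i < N) `|tst (partial i phi)| ^+ 2.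
Proof.
move=> tp; rewrite sqr_sqrtr; last by apply: sumr_ge0 => i _; exact: sqr_ge0.
apply: eq_bigr => i _; congr (`|_| ^+ 2); rewrite (wpartialE (is_wpartial_tst _ tp)).
congr toL2; rewrite -[RHS](mpartial_count [:: i] (test_smooth tp)).
by congr mpartial; apply/funext => j; rewrite /= addn0 eq_sym.
Qed.

Lemma grad_norm_dot phi : test phi ->
  grad_norm (tst phi) ^+ 2 = - '[tst phi, tst (laplacian phi)].
Proof.
move=> tp.
have key (g : R) (A b : H) (F G : 'I_N -> H) : g = \sum_i `|F i| ^+ 2 ->
    A = \sum_i G i -> (forall i, '[G i, b] = (-1) ^+ 1 * '[F i, F i]) -> g = - '[b, A].
  move=> -> -> h; rewrite L2_dotC dot_suml -sumrN; apply: eq_bigr => i _.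
  by rewrite h expr1 mulN1r opprK L2_dotuu.
exact: (key _ _ _ _ _ (grad_norm_tst tp) (tst_laplacian tp)
  (fun i => dot_foldr [:: i] (test_partial i tp) tp)).
Qed.

Lemma dot_foldr2 phi s t : test phi ->
  '[tst (foldr partial phi s), tst (foldr partial phi t)] =
  (-1) ^+ size s * '[tst phi, tst (foldr partial phi (s ++ t))].
Proof. by move=> tp; rewrite (dot_foldr s tp (test_foldr t tp)) foldr_cat. Qed.

(* Moving derivatives around turns |d_i d_j phi|^2 into <d_i d_i phi, d_j d_j phi>. *)
Lemma sum_second_partials phi : test phi ->
  \sum_(i < N) \sum_(j < N) `|tst (foldr partial phi [:: i; j])| ^+ 2 =
  `|tst (laplacian phi)| ^+ 2.
Proof.
move=> tp.
have key (A : H) (P : 'I_N -> 'I_N -> H) (G : 'I_N -> H) : A = \sum_i G i ->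
    (forall i j, '[P i j, P i j] = '[G i, G j]) ->
    \sum_i \sum_j `|P i j| ^+ 2 = `|A| ^+ 2.
  move=> -> h; rewrite -L2_dotuu dot_suml; apply: eq_bigr => i _.
  by rewrite L2_dotC dot_suml; apply: eq_bigr => j _; rewrite -L2_dotuu h L2_dotC.
apply: (key _ (fun i j => tst (foldr partial phi [:: i; j])) _ (tst_laplacian tp)) => i j.
have e : foldr partial phi ([:: i; j] ++ [:: i; j]) =
    foldr partial phi ([:: i; i] ++ [:: j; j]).
  apply: (foldr_partial_perm (test_smooth tp)).
  by rewrite /= perm_cons (perm_catC [:: j] [:: i; j]).
have h1 := dot_foldr2 [:: i; j] [:: i; j] tp.
have h2 := dot_foldr2 [:: i; i] [:: j; j] tp.
rewrite e in h1.
exact: (etrans h1 (esym h2)).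
Qed.

Lemma second_partial_le phi i j : test phi ->
  `|tst (foldr partial phi [:: i; j])| <= `|tst (laplacian phi)|.
Proof.
move=> tp.
have key (x : R) (F : 'I_N -> 'I_N -> H) : 0 <= x ->
    \sum_i \sum_j `|F i j| ^+ 2 = x ^+ 2 -> `|F i j| <= x.
  move=> x0 h; rewrite -ler_sqr ?nnegrE// -h.
  rewrite (bigD1 i)//= (bigD1 j)//= -addrA lerDl addr_ge0//.
    by apply: sumr_ge0 => k _; exact: sqr_ge0.
  by apply: sumr_ge0 => k _; apply: sumr_ge0 => l _; exact: sqr_ge0.
exact: (key _ _ (normr_ge0 _) (sum_second_partials tp)).
Qed.

Section friedrichs.
Variable (c : R) (hc : friedrichs_bound Omega c).

Let c_gt0 : 0 < c. Proof. by case: hc. Qed.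

Lemma friedrichs_tst phi : test phi -> `|tst phi| <= c * grad_norm (tst phi).
Proof. by move=> tp; case: hc => _ h; exact: h (H0k_tst 1 tp). Qed.

Lemma grad_norm_le phi : test phi -> grad_norm (tst phi) <= c * `|tst (laplacian phi)|.
Proof.
move=> tp.
(* Here g^2 <= |u| |v| <= c g |v|, and one factor g cancels unless it is 0. *)
have key (g : R) (u v : H) : 0 <= g -> `|u| <= c * g -> g ^+ 2 = - '[u, v] ->
    g <= c * `|v|.
  move=> g0 ug gE; have [->|gn0] := eqVneq g 0; first by rewrite mulr_ge0// ltW.
  have gp : 0 < g by rewrite lt_def gn0.
  rewrite -(ler_pM2l gp) -expr2 gE (le_trans (ler_norm _))// normrN.
  by rewrite (le_trans (L2_CauchySchwarz _ _))// mulrA ler_wpM2r// mulrC.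
exact: (key _ _ _ (sqrtr_ge0 _) (friedrichs_tst tp) (grad_norm_dot tp)).
Qed.

Lemma laplacian_bound phi : test phi -> `|tst phi| <= c ^+ 2 * `|tst (laplacian phi)|.
Proof.
move=> tp; apply: (le_trans (friedrichs_tst tp)).
have h := grad_norm_le tp; rewrite expr2 -mulrA.
by apply: ler_wpM2l; [exact: ltW|exact: h].
Qed.

Lemma bilaplacian_bound phi : test phi ->
  `|tst phi| <= c ^+ 4 * `|tst (laplacian (laplacian phi))|.
Proof.
move=> tp; apply: (le_trans (laplacian_bound tp)).
have h := laplacian_bound (test_laplacian tp).
rewrite (_ : c ^+ 4 = c ^+ 2 * c ^+ 2); last by rewrite -exprD.
by rewrite -mulrA; apply: ler_wpM2l; [exact: sqr_ge0|exact: h].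
Qed.

(** Covers the orders 2, 1 and 0 together: their bounds in terms of |Delta phi| have the constants
    1, c and c^2. *)
Let K := 1 + c + c ^+ 2.
Let K_ge0 : 0 <= K.
Proof. by rewrite !addr_ge0// ?(ltW c_gt0)// sqr_ge0. Qed.

Lemma foldr_le_laplacian phi s : test phi -> (size s <= 2)%N ->
  `|tst (foldr partial phi s)| <= K * `|tst (laplacian phi)|.
Proof.
move=> tp; have cge := ltW c_gt0; have c2 := sqr_ge0 c.
have key (x y b : R) : 0 <= y -> x <= b * y -> b <= K -> x <= K * y.
  by move=> y0 xby bK; apply: (le_trans xby); exact: ler_wpM2r.
have gkey (g : R) (F : 'I_N -> H) i : 0 <= g -> g ^+ 2 = \sum_i `|F i| ^+ 2 -> `|F i| <= g.
  move=> g0 gE; rewrite -ler_sqr ?nnegrE// gE (bigD1 i)//= lerDl.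
  by apply: sumr_ge0 => k _; exact: sqr_ge0.
case: s => [|i [|j [|//]]] _.
- by apply: (key _ _ _ (normr_ge0 _) (laplacian_bound tp)); rewrite /K; lra.
- have g1 := gkey _ _ i (sqrtr_ge0 _) (grad_norm_tst tp).
  by apply: (key _ _ _ (normr_ge0 _) (le_trans g1 (grad_norm_le tp))); rewrite /K; lra.
- have h := second_partial_le i j tp.
  by apply: (key _ _ 1 (normr_ge0 _)); [rewrite mul1r; exact: h|rewrite /K; lra].
Qed.

(** One factor [K] for the outer two derivatives and one for the inner two. *)
Definition partials_constant : R := K ^+ 2.

Lemma partials_constant_ge0 : 0 <= partials_constant.
Proof. exact: sqr_ge0. Qed.

Lemma mpartial_le_bilaplacian phi a : test phi -> (mindex_len a <= 4)%N ->
  `|tst (mpartial a phi)| <= partials_constant * `|tst (laplacian (laplacian phi))|.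
Proof.
move=> tp a4; have [s [sE s4]] : exists s, mpartial a phi = foldr partial phi s /\ (size s <= 4)%N.
  by exists (mindex_seq a); rewrite size_mindex_seq; split => //; exact: mpartialE.
have td := test_foldr (drop 2 s) tp.
have h1 : `|tst (foldr partial (foldr partial phi (drop 2 s)) (take 2 s))| <=
    K * `|tst (laplacian (foldr partial phi (drop 2 s)))|.
  by apply: (foldr_le_laplacian td); rewrite size_take; case: ltnP => // /leq_trans.
have h2 : `|tst (foldr partial (laplacian phi) (drop 2 s))| <=
    K * `|tst (laplacian (laplacian phi))|.
  by apply: (foldr_le_laplacian (test_laplacian tp)); rewrite size_drop leq_subLR.
have e1 : mpartial a phi = foldr partial (foldr partial phi (drop 2 s)) (take 2 s).
  by rewrite sE -foldr_cat cat_take_drop.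
rewrite e1; apply: (le_trans h1); rewrite (laplacian_foldr _ tp).
by rewrite /partials_constant expr2 -mulrA; apply: ler_wpM2l; [exact: K_ge0|exact: h2].
Qed.

End friedrichs.

End estimates.

(** * The operators of the bi-Laplacian *)

Section graph_B0.
Context {R : realType} {N : nat} (Omega : domain R N).
Local Notation mu := (lebesgue_on Omega).
Local Notation H := (L2 mu).
Local Notation tst := (toL2 mu).
Local Notation test := (test_function (domain_set Omega)).
Implicit Types (u v w f g : H) (phi psi : 'rV[R]_N -> R) (a : 'I_N -> nat).

(* The graph of [B0] is the closure in L^2 x L^2 of the graph of Delta^2 on test
   functions ([graph_B0E]). *)
Definition test_graph (q : H * H) :=
  exists2 phi, test phi & q = (tst phi, tst (laplacian (laplacian phi))).

Definition test_graph_closure : set (H * H) := [set p | forall e : R, 0 < e ->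
  exists q, [/\ test_graph q, `|p.1 - q.1| < e & `|p.2 - q.2| < e]].

Local Notation G := test_graph_closure.

Lemma test_graph_sub q : test_graph q -> G q.
Proof. by move=> tq e e0; exists q; rewrite !subrr !normr0. Qed.

Lemma test_graph_lin (c : R) q q' : test_graph q -> test_graph q' ->
  test_graph (c *: q.1 + q'.1, c *: q.2 + q'.2).
Proof.
move=> [phi tp ->] [psi tq ->]; exists (c *: phi + psi).
  by apply: testD; [exact: testZ|exact: tq].
have tcp := testZ c tp; have tl := test_laplacian tp; have tl' := test_laplacian tq.
congr pair; first by rewrite (tstD tcp tq) (tstZ c tp).
rewrite (laplacianD tcp tq) (laplacianZ c tp) (laplacianD (testZ c tl) tl').
rewrite (laplacianZ c tl) (tstD (testZ c (test_laplacian tl)) (test_laplacian tl')).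
by rewrite (tstZ c (test_laplacian tl)).
Qed.

Lemma tst_bilaplacianB phi psi : test phi -> test psi ->
  tst (laplacian (laplacian (phi - psi))) =
  tst (laplacian (laplacian phi)) - tst (laplacian (laplacian psi)).
Proof.
move=> tp tq; have tl := test_laplacian tp; have tl' := test_laplacian tq.
rewrite -(scaleN1r psi) addrC (laplacianD (testZ (- 1) tq) tp) (laplacianZ (- 1) tq).
rewrite (laplacianD (testZ (- 1) tl') tl) (laplacianZ (- 1) tl').
rewrite (tstD (testZ (- 1) (test_laplacian tl')) (test_laplacian tl)).
by rewrite (tstZ (- 1) (test_laplacian tl')) scaleN1r addrC.
Qed.

Lemma test_graph_closure_closed : closed G.
Proof.
apply/closed_prodP => p hp e e0; have e20 := divr_gt0 e0 (ltr0n R 2).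
have [p' [Gp' h1 h2]] := hp _ e20; have [q [tq h1' h2']] := Gp' _ e20.
exists q; split; [exact: tq| |].
  by apply: le_lt_trans (ler_distD p'.1 _ _) _; rewrite (splitr e); exact: ltrD h1 h1'.
by apply: le_lt_trans (ler_distD p'.2 _ _) _; rewrite (splitr e); exact: ltrD h2 h2'.
Qed.

Lemma test_graph_closure0 : G (0, 0).
Proof.
have [phi tp] : exists2 phi, test phi & phi = 0 by exists 0; [exact: test0|].
have tg : test_graph (tst phi, tst (laplacian (laplacian phi))) by exists phi.
(* The pair (0, 0) is obtained as -q + q from a test pair q. *)
have := test_graph_lin (-1) tg tg => /= h _.
by apply: test_graph_sub; move: h; rewrite !scaleN1r !addNr.
Qed.

(** The divisor [|c| + 1] stays positive when [c] is 0. *)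
Lemma norm_lin_lt (e c : R) u v u' v' : 0 < e -> `|u - u'| < e / 2 / (`|c| + 1) ->
  `|v - v'| < e / 2 -> `|c *: u + v - (c *: u' + v')| < e.
Proof.
move=> e0 hu hv; have c1 : 0 < `|c| + 1 by rewrite ltr_wpDl.
rewrite opprD addrACA -scalerBr (splitr e) (le_lt_trans (ler_normD _ _))//.
rewrite normrZ; apply: ler_ltD => //.
apply: (@le_trans _ _ ((`|c| + 1) * `|u - u'|)); first by rewrite ler_wpM2r// lerDl.
by rewrite mulrC -ler_pdivlMr// ltW.
Qed.

Lemma test_graph_closure_lin (c : R) u f v g : G (u, f) -> G (v, g) ->
  G (c *: u + v, c *: f + g).
Proof.
move=> Gu Gv e e0; have e20 := divr_gt0 e0 (ltr0n R 2).
have c1 : 0 < `|c| + 1 by rewrite ltr_wpDl.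
have [q [tq q1 q2]] := Gu _ (divr_gt0 e20 c1); have [q' [tq' q1' q2']] := Gv _ e20.
exists (c *: q.1 + q'.1, c *: q.2 + q'.2); split; first exact: test_graph_lin.
- exact: norm_lin_lt.
- exact: norm_lin_lt.
Qed.

Lemma closure_is_bilaplacian u f : G (u, f) -> is_bilaplacian u f.
Proof.
move=> Gu; apply/is_bilaplacianP => psi tp; apply/eqP; rewrite -subr_eq0; apply/eqP.
have tl := test_laplacian tp.
have key (A B : H) : (forall q, test_graph q -> '[q.1, A] = '[q.2, B]) ->
    '[u, A] - '[f, B] = 0.
  move=> h; apply: (@eq0_small _ _ (`|A| + `|B|)) => e e0.
  have [q [tq /= q1 q2]] := Gu _ e0.
  have -> : '[u, A] - '[f, B] = '[u - q.1, A] - '[f - q.2, B].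
    by rewrite !L2_dotBl (h _ tq); ring.
  rewrite (le_trans (ler_normB _ _))// mulrDr.
  by apply: lerD; rewrite (le_trans (L2_CauchySchwarz _ _))// ler_wpM2r// ltW.
apply: key => _ [phi tq ->] /=.
exact: (etrans (esym (dot_laplacian tq tl)) (esym (dot_laplacian (test_laplacian tq) tp))).
Qed.

Lemma closure_uniq_bilaplacian u f : G (u, f) -> bilaplacian u = f.
Proof. by move=> /closure_is_bilaplacian /bilaplacian_eq. Qed.

Section friedrichs.
Variable (c : R) (hc : friedrichs_bound Omega c).
Let C := partials_constant c.
Let C_ge0 : 0 <= C. Proof. exact: partials_constant_ge0. Qed.

Lemma closure_bound u f : G (u, f) -> `|u| <= c ^+ 4 * `|f|.
Proof.
move=> Gu; have [c0 _] := hc; have c40 : 0 <= c ^+ 4 by rewrite exprn_ge0// ltW.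
suff h (e : R) : 0 < e -> `|u| <= c ^+ 4 * `|f| + e.
  by apply/ler_addgt0Pr => e; exact: h.
move=> e0; have C1 : 0 < 1 + c ^+ 4 by rewrite ltr_pwDl.
have [q [[phi tp ->] /= q1 q2]] := Gu _ (divr_gt0 e0 C1).
exact: (L2_closure_bound c40 e0 (bilaplacian_bound hc tp) q1 q2).
Qed.

(** The a priori estimate for differences of test functions makes the derivatives of the
    approximants Cauchy, and their limit is the weak derivative. Taking [phi] to be 0 in the
    conclusion bounds it by [f]. *)
Lemma closure_partial u f a : G (u, f) -> (mindex_len a <= 4)%N ->
  exists2 g, is_wpartial a u g & forall phi, test phi ->
    `|g - tst (mpartial a phi)| <= C * `|f - tst (laplacian (laplacian phi))|.
Proof.
move=> Gu a4.
pose d (n : nat) : R := n.+1%:R^-1.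
have d0 n : 0 < d n by rewrite invr_gt0 ltr0n.
have small (e : R) : 0 < e -> exists M, forall n, (M <= n)%N -> d n < e.
  exact: natSinv_eventually_lt.
have bnd phi psi : test phi -> test psi ->
    `|tst (mpartial a phi) - tst (mpartial a psi)| <=
    C * `|tst (laplacian (laplacian phi)) - tst (laplacian (laplacian psi))|.
  move=> tp tq; have tpq := testB tp tq.
  have h := mpartial_le_bilaplacian hc tpq a4.
  (* Linearity of [mpartial] is read off from uniqueness of weak derivatives. *)
  have e1 : tst (mpartial a (phi - psi)) = tst (mpartial a phi) - tst (mpartial a psi).
    apply: (is_wpartial_uniq (is_wpartial_tst a tpq)); rewrite (tstB tp tq).
    exact: (is_wpartialB (is_wpartial_tst a tp) (is_wpartial_tst a tq)).
  have e2 := tst_bilaplacianB tp tq.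
  by rewrite -e1 -e2.
have /choice[p_ p_P] : forall n, exists phi, [/\ test phi, `|u - tst phi| < d n &
    `|f - tst (laplacian (laplacian phi))| < d n].
  by move=> n; have [_ [[phi tp ->] /= h1 h2]] := Gu _ (d0 n); exists phi.
have tp n : test (p_ n) by have [] := p_P n.
have up n : `|u - tst (p_ n)| < d n by have [] := p_P n.
have fp n : `|f - tst (laplacian (laplacian (p_ n)))| < d n by have [] := p_P n.
pose g_ n := tst (mpartial a (p_ n)); pose f_ n := tst (laplacian (laplacian (p_ n))).
have gb n m : `|g_ n - g_ m| <= C * `|f_ n - f_ m| by exact: bnd.
have ff : f_ @ \oo --> f.
  apply/cvg_normP => e e0; have [M hM] := small _ e0; exists M => n Mn.
  by rewrite distrC; exact: lt_trans (fp n) (hM _ Mn).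
have wg n : is_wpartial a (tst (p_ n)) (g_ n) := is_wpartial_tst a (tp n).
have [g /cvg_normP gP gb'] := L2_dominated_cvg C_ge0 gb ff.
exists g.
  apply: is_wpartial_limit => e e0.
  have [M1 hM1] := gP _ e0; have [M2 hM2] := small _ e0.
  exists (tst (p_ (maxn M1 M2))), (g_ (maxn M1 M2)); split; first exact: wg.
    by apply: lt_trans (up _) _; apply: hM2; exact: leq_maxr.
  by rewrite distrC; apply: hM1; exact: leq_maxl.
by move=> phi tphi; apply: gb' => n; exact: bnd (tp n) tphi.
Qed.

End friedrichs.

End graph_B0.

(** * Identification of the closure with the operator [B0] *)

Section operator_B0.
Context {R : realType} {N : nat} (Omega : domain R N).
Local Notation mu := (lebesgue_on Omega).
Local Notation H := (L2 mu).
Local Notation tst := (toL2 mu).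
Local Notation test := (test_function (domain_set Omega)).
Local Notation G := (test_graph_closure (Omega := Omega)).
Implicit Types (u v w f g : H) (phi psi : 'rV[R]_N -> R) (a : 'I_N -> nat).

(** One direction restricts to test pairs; the other extends the identity from test pairs to their
    limits, both pairings being continuous. *)
Lemma closure_adjointP v w : graph_adjoint G (v, w) <-> is_bilaplacian v w.
Proof.
split=> [av|/is_bilaplacianP vw u f Gu /=].
  apply/is_bilaplacianP => psi tp; rewrite L2_dotC [RHS]L2_dotC.
  by apply: (av (tst psi) (tst (laplacian (laplacian psi)))); apply: test_graph_sub; exists psi.
apply/eqP; rewrite -subr_eq0; apply/eqP.
apply: (@eq0_small _ _ (`|v| + `|w|)) => e e0.
have [q [[phi tp qE] /= q1 q2]] := Gu _ e0.
have qvw : '[q.2, v] = '[q.1, w].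
  by rewrite qE /= L2_dotC [RHS]L2_dotC; exact: vw tp.
have -> : '[f, v] - '[u, w] = '[f - q.2, v] - '[u - q.1, w].
  by rewrite !L2_dotBl qvw; ring.
rewrite (le_trans (ler_normB _ _))// mulrDr.
by apply: lerD; rewrite (le_trans (L2_CauchySchwarz _ _))// ler_wpM2r// ltW.
Qed.

Lemma wpartialP k u a : Hk Omega k u -> (mindex_len a <= k)%N ->
  is_wpartial a u (wpartial a u).
Proof. by move=> uk /uk[g ug]; rewrite (wpartialE ug). Qed.

Lemma is_wpartial_nil u : is_wpartial (fun k => count_mem k [::]) u u.
Proof.
apply/is_wpartialP => psi tp.
rewrite (mpartial_count [::] (test_smooth tp)) mindex_len_count.
by rewrite /= expr0 mul1r.
Qed.

Lemma H0k4_closure u : H0k Omega 4 u -> exists f, G (u, f).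
Proof.
move=> [uk uapprox].
pose b (i j : 'I_N) := fun k => count_mem k [:: i; i; j; j].
have b4 i j : (mindex_len (b i j) <= 4)%N by rewrite mindex_len_count.
(* The value is the sum of the weak derivatives that make up Delta^2: there are N^2 of them, each
   approximated within e / (1 + N^2). The summand 1 keeps the divisor positive for N = 0 and the
   tolerance at most e for [u] itself. *)
exists (\sum_i \sum_j wpartial (b i j) u) => e e0.
have n0 : 0 < 1 + (N * N)%:R :> R by rewrite ltr_pwDl// ler0n.
have [v /Cc_inftyP[phi tp ->] uv] := uapprox _ (divr_gt0 e0 n0).
have le4 a : (mindex_len a <= 4)%N ->
    `|wpartial a u - tst (mpartial a phi)| <= Hk_norm Omega 4 (u - tst phi).
  move=> a4; have := wpartial_le_Hk_norm (u - tst phi) a4.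
  by rewrite (wpartialE (is_wpartialB (wpartialP uk a4) (is_wpartial_tst a tp))).
have key (D x : R) (F F' : 'I_N -> 'I_N -> H) (A : H) : 0 <= x ->
    x < e / (1 + (N * N)%:R) -> A = \sum_i \sum_j F' i j ->
    (forall i j, `|F i j - F' i j| <= x) -> `|\sum_i \sum_j F i j - A| < e.
  move=> x0 xe -> hF.
  apply: (@le_lt_trans _ _ ((1 + (N * N)%:R) * x)); last by rewrite mulrC -ltr_pdivlMr.
  apply: (@le_trans _ _ ((N * N)%:R * x)); last by rewrite ler_wpM2r// lerDr.
  have sumN (E : 'I_N -> H) y : (forall i, `|E i| <= y) -> `|\sum_i E i| <= N%:R * y.
    move=> hE; apply: le_trans (ler_norm_sum _ _ _) _.
    apply: (@le_trans _ _ (\sum_(i < N) y)); first by apply: ler_sum => i _; exact: hE.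
    by rewrite sumr_const card_ord mulr_natl.
  rewrite natrM -mulrA -sumrB; apply: (sumN) => i.
  by rewrite -sumrB; apply: (sumN) => j; exact: hF.
have uv0 : 0 <= Hk_norm Omega 4 (u - tst phi) by exact: sqrtr_ge0.
exists (tst phi, tst (laplacian (laplacian phi))); split => /=; first by exists phi.
- have nil4 : (mindex_len (fun k : 'I_N => count_mem k [::]) <= 4)%N by rewrite mindex_len_count.
  have := wpartial_le_Hk_norm (u - tst phi) nil4.
  rewrite (wpartialE (is_wpartial_nil _)) => /le_lt_trans; apply.
  apply: lt_le_trans uv _; rewrite ler_pdivrMr//.
  by rewrite ler_peMr ?(ltW e0)// lerDl ler0n.
- have E : tst (laplacian (laplacian phi)) = \sum_i \sum_j tst (mpartial (b i j) phi).
    rewrite (bilaplacianE tp).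
    have ti i : test (\sum_j mpartial (b i j) phi).
      by apply: test_sum => j _; exact: test_mpartial.
    apply: (etrans (tst_sum _ ti)).
    apply: eq_bigr => i _; apply: tst_sum => j; exact: test_mpartial.
  exact: (key 0 _ _ _ _ uv0 uv E (fun i j => le4 _ (b4 i j))).
Qed.

(** The L^2 closure [K] of the test functions is a closed subspace whose orthogonal complement is 0
    by the fundamental lemma, so it is everything. *)
Lemma dense_H0k4 : dense (H0k Omega 4).
Proof.
pose K := [set u : H | forall e : R, 0 < e -> exists2 phi, test phi & `|u - tst phi| < e].
have sK : subspace K.
  split.
    exists 0 => e e0; exists 0; first exact: test0.
    by rewrite toL20 subrr normr0.
  move=> c u v Ku Kv e e0; have e20 := divr_gt0 e0 (ltr0n R 2).
  have c1 : 0 < `|c| + 1 by rewrite ltr_wpDl.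
  have [phi tp up] := Ku _ (divr_gt0 e20 c1); have [psi tq vq] := Kv _ e20.
  exists (c *: phi + psi); first by apply: testD; [exact: testZ|exact: tq].
  by rewrite (tstD (testZ c tp) tq) (tstZ c tp); exact: norm_lin_lt.
have cK : closed K.
  apply/closed_normP => x hx e e0; have e20 := divr_gt0 e0 (ltr0n R 2).
  have [k Kk xk] := hx _ e20; have [phi tp kp] := Kk _ e20.
  exists phi; first exact: tp.
  by apply: le_lt_trans (ler_distD k _ _) _; rewrite (splitr e); exact: ltrD xk kp.
have KT x : K x.
  rewrite -(L2_perp_perp cK sK) => v vK.
  have -> : v = 0; last exact: L2_dot0r.
  apply: L2_test_eq0 => psi tp; apply: vK => e e0; exists psi; first exact: tp.
  by rewrite subrr normr0.
move=> O [x Ox] oO.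
have /nbhs_ballP[e /= e0 eO] : nbhs x O by exact: open_nbhs_nbhs.
have [phi tp xp] := KT x _ e0.
exists (tst phi); split; last exact: H0k_tst.
by apply: eO; rewrite -ball_normE.
Qed.

Section friedrichs.
Variable (c : R) (hc : friedrichs_bound Omega c).

Lemma closure_Hk_norm u f : G (u, f) ->
  Hk_norm Omega 4 u <= Num.sqrt #|{ffun 'I_N -> 'I_5}|%:R * (partials_constant c * `|f|).
Proof.
move=> Gu; apply: Hk_norm_le => [|a a4].
  by rewrite mulr_ge0// partials_constant_ge0.
have [g ug gb] := closure_partial hc Gu a4; rewrite (wpartialE ug).
have := gb _ (test0 Omega).
have -> : tst (mpartial a 0) = 0 by rewrite mpartialE foldr_partial0 toL20.
have -> : tst (laplacian (laplacian 0)) = 0.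
  have l0 : laplacian (0 : 'rV[R]_N -> R) = 0.
    by rewrite laplacianE big1// => i _; exact: foldr_partial0.
  by rewrite !l0 toL20.
by rewrite !subr0.
Qed.

Lemma closure_H0k4 u f : G (u, f) -> H0k Omega 4 u.
Proof.
move=> Gu; split=> [a a4|e e0].
  by have [g ug _] := closure_partial hc Gu a4; exists g.
pose D := Num.sqrt #|{ffun 'I_N -> 'I_5}|%:R * partials_constant c.
have D0 : 0 <= D by rewrite mulr_ge0 ?sqrtr_ge0// partials_constant_ge0.
have D1 : 0 < D + 1 by rewrite ltr_wpDl.
have [q [[phi tp qE] _ q2]] := Gu _ (divr_gt0 e0 D1).
exists (tst phi); first by apply/Cc_inftyP; exists phi.
have tg : G (tst phi, tst (laplacian (laplacian phi))) by apply: test_graph_sub; exists phi.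
(* The difference of [u] and the test function lies in the graph too, so its H^4 norm is bounded by
   the L^2 distance of the values. *)
have := test_graph_closure_lin (-1) tg Gu.
rewrite !scaleN1r ![- _ + _]addrC => /closure_Hk_norm; rewrite mulrA -/D.
move=> /le_lt_trans; apply.
rewrite qE /= in q2.
apply: (@le_lt_trans _ _ ((D + 1) * `|f - tst (laplacian (laplacian phi))|)).
  by rewrite ler_wpM2r// lerDl.
by rewrite mulrC -ltr_pdivlMr.
Qed.

Lemma graph_B0E : graph (B0 Omega) = G.
Proof.
apply/seteqP; split=> -[u f] /=.
  by move=> [/H0k4_closure[g Gu] /= ->]; rewrite (closure_uniq_bilaplacian Gu).
by move=> Gu; split => /=; [exact: closure_H0k4 Gu|rewrite (closure_uniq_bilaplacian Gu)].
Qed.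

End friedrichs.

End operator_B0.

(** * Inverses and the best Friedrichs constant *)

Section inverse_operator.
Context d (T : measurableType d) (R : realType) (mu : {measure set T -> \bar R}).

Lemma inverseP (A : operator mu) (Y : set (L2 mu)) : set_bij (dom A) Y A ->
  forall f, Y f -> dom A (inverse A f) /\ A (inverse A f) = f.
Proof.
move=> [_ injA surA] f Yf; have [u Au <-] := surA _ Yf.
by rewrite /inverse pinvKV ?inE.
Qed.

End inverse_operator.

(** The fourth root of [x] is a lower bound for all Friedrichs constants, hence at most their
    infimum. *)
Lemma friedrichs_constant_le (R : realType) (N : nat) (Omega : domain R N) (x : R) :
  friedrichs_admissible Omega -> 0 <= x ->
  (forall c, friedrichs_bound Omega c -> x <= c ^+ 4) ->
  x <= friedrichs_constant Omega ^+ 4.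
Proof.
move=> [c0 hc0] x0 hx; pose y := Num.sqrt (Num.sqrt x).
have y4 : y ^+ 4 = x.
  by rewrite (_ : 4 = 2 * 2)%N// exprM /y !sqr_sqrtr ?sqrtr_ge0.
have yF : y <= friedrichs_constant Omega.
  apply: lb_le_inf; first by exists c0.
  move=> c hc; have [cpos _] := hc.
  by rewrite -(@ler_pXn2r _ 4) ?nnegrE ?sqrtr_ge0 ?(ltW cpos)// y4 hx.
rewrite -[leLHS]y4 lerXn2r ?nnegrE ?sqrtr_ge0//.
by apply: le_trans yF; exact: sqrtr_ge0.
Qed.

Theorem mainTheorem5 (R : realType) (N : nat) (Omega : domain R N)
    (hOmega : friedrichs_admissible Omega) :
  [/\ [/\ H0k Omega 4 `<=` H_bilaplacian Omega,
          densely_defined (B0 Omega),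
          closed_operator (B0 Omega) &
          is_adjoint (B0 Omega) (B Omega)],
      [/\ closed (op_range (B0 Omega)),
          closed (op_range (B Omega)),
          op_kernel (B0 Omega) = [set 0],
          op_range (B0 Omega) = L2_perp (BH Omega) &
          op_kernel (B Omega) = BH Omega /\ op_range (B Omega) = setT],
      [/\ set_bij (H0k Omega 4) (L2_perp (BH Omega)) (B0 Omega),
          set_bij (H_bilaplacian Omega `&` L2_perp (BH Omega)) setT (red_B Omega),
          bounded_into (L2_perp (BH Omega)) (Hk_norm Omega 4) (inverse (B0 Omega)) &
          bounded_into setT (H_bilaplacian_norm Omega)
            (inverse (red_B Omega))],
      (opnorm (L2_perp (BH Omega)) (inverse (B0 Omega)) =
         opnorm setT (inverse (red_B Omega)) /\
       opnorm setT (inverse (red_B Omega)) <= (friedrichs_constant Omega ^+ 4)%:E)%E &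
      (forall f, L2_perp (BH Omega) f ->
         exists! u, H0k Omega 4 u /\ is_bilaplacian u f) /\
      (forall f : L2 (lebesgue_on Omega),
         exists! u, [/\ H_bilaplacian Omega u, L2_perp (BH Omega) u &
                        is_bilaplacian u f])].
Proof.
have [c hc] := hOmega; have [c_gt0 _] := hc.
pose G := @test_graph_closure R N Omega.
have cG : closed G := @test_graph_closure_closed R N Omega.
have G0 : G (0, 0) := @test_graph_closure0 R N Omega.
have sG (a : R) u f v g : G (u, f) -> G (v, g) -> G (a *: u + v, a *: f + g).
  exact: test_graph_closure_lin.
(* Kept for an arbitrary [c'], since the norm bound at the end ranges over all Friedrichs constants;
   elsewhere the fixed [c] serves. *)
have bG c' : friedrichs_bound Omega c' -> forall u f, G (u, f) -> `|u| <= c' ^+ 4 * `|f|.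
  by move=> hc' u f; exact: closure_bound.
have c4 : 0 <= c ^+ 4 by rewrite exprn_ge0// ltW.
have GE : graph (B0 Omega) = G := graph_B0E hc.
have GP u : H0k Omega 4 u -> G (u, bilaplacian u) by rewrite -GE => u4; split.
have Gdom u f : G (u, f) -> H0k Omega 4 u by move=> Gu; exact: (closure_H0k4 hc Gu).
have Gval u f : G (u, f) -> bilaplacian u = f by move=> Gu; exact: closure_uniq_bilaplacian Gu.
have ranE : op_range (B0 Omega) = graph_range G.
  apply/seteqP; split=> [_ [u u4 <-]|f [u Gu]]; first by exists u; exact: GP.
  by exists u; [exact: Gdom Gu|exact: Gval].
have BHE : [set v | graph_adjoint G (v, 0)] = BH Omega.
  by apply/seteqP; split=> v /closure_adjointP.
(* The bridge between the two settings: orthogonality to [BH] becomes membership in the range of the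
   graph, on which the abstract results operate. *)
have perpE : L2_perp (BH Omega) = graph_range G.
  rewrite -BHE; exact: (graph_range_perp c4 cG G0 sG (bG c hc)).
have ran_closed : closed (graph_range G) := graph_range_closed c4 cG sG (bG c hc).
have surj w := graph_adjoint_surj c4 cG G0 sG (bG c hc) w.
have bilap v w : graph_adjoint G (v, w) -> H_bilaplacian Omega v /\ bilaplacian v = w.
  by move=> /closure_adjointP vw; split; [exists w|exact: bilaplacian_eq].
have bilap' v : H_bilaplacian Omega v -> graph_adjoint G (v, bilaplacian v).
  by move=> [w vw]; apply/closure_adjointP; rewrite (bilaplacian_eq vw).
have BrangeT : op_range (B Omega) = setT.
  apply/seteqP; split=> // w _; have [v [_ /bilap[vB vw]]] := surj w.
  by exists v.
have bij0 : set_bij (H0k Omega 4) (L2_perp (BH Omega)) (B0 Omega).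
  rewrite perpE; split.
  - by move=> u u4; exists u; exact: GP.
  - move=> u v /set_mem u4 /set_mem v4 uv.
    apply: (graph_uniq sG (bG c hc) (GP _ u4)).
    by have := GP _ v4; rewrite -[bilaplacian v]uv.
  - by move=> f [u Gu]; exists u; [exact: Gdom Gu|exact: Gval].
have bij1 : set_bij (H_bilaplacian Omega `&` L2_perp (BH Omega)) setT (red_B Omega).
  rewrite perpE; split => //.
  - move=> u v /set_mem[uB ur] /set_mem[vB vr] uv.
    apply: (graph_adjoint_uniq c4 G0 sG (bG c hc) ur vr (bilap' _ uB)).
    by have := bilap' _ vB; rewrite -[bilaplacian v]uv.
  - move=> w _; have [v [rv /bilap[vB vw]]] := surj w.
    by exists v; [split|exact: vw].
(* The two concrete inverses fit the pattern of [S] and [S'] in [opnorm_adjoint]. *)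
have inv0 f : graph_range G f -> G (inverse (B0 Omega) f, f).
  rewrite -perpE => fp; have [/= u4 uf] := inverseP (A := B0 Omega) bij0 fp.
  by have := GP _ u4; rewrite uf.
have inv1 f : graph_range G (inverse (red_B Omega) f) /\
    graph_adjoint G (inverse (red_B Omega) f, f).
  have [[uB]] := inverseP (A := red_B Omega) bij1 (f := f) I; rewrite perpE => ur uf; split => //.
  by have := bilap' _ uB; rewrite [bilaplacian _]uf.
split.
- split.
  + by move=> u /GP /closure_is_bilaplacian Gu; exists (bilaplacian u).
  + exact: dense_H0k4.
  + by rewrite /closed_operator GE.
  + apply/seteqP; split=> -[v w] /=.
      by move=> [vB /= ->] u u4; exact: (bilap' _ vB) (GP _ u4).
    move=> vw; have av : graph_adjoint G (v, w).
      by move=> u f Gu /=; rewrite -(Gval _ _ Gu); apply: vw; exact: Gdom Gu.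
    by have [vB vE] := bilap _ _ av; split.
- split.
  + by rewrite ranE.
  + by rewrite BrangeT; exact: closedT.
  + apply/seteqP; split=> [u [/GP Gu uE]|_ ->].
      have : `|u| <= c ^+ 4 * `|bilaplacian u| by exact: bG Gu.
      by rewrite [bilaplacian u]uE normr0 mulr0 normr_le0 => /eqP.
    by split; [exact: Gdom G0|exact: Gval].
  + by rewrite ranE perpE.
  + split=> //; apply/seteqP; split=> [v [/= [w vw] vE]|v vB].
      by move: vE; rewrite (bilaplacian_eq vw) => w0; subst w.
    by split; [exists 0|exact: bilaplacian_eq].
- split => //.
  + exists (Num.sqrt #|{ffun 'I_N -> 'I_5}|%:R * partials_constant c) => f.
    by rewrite perpE => /inv0 Gu; rewrite -mulrA; exact: closure_Hk_norm.
  (* The squared graph norm of the solution is |u|^2 + |f|^2, at most ((c^4)^2 + 1) |f|^2. *)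
  + exists (Num.sqrt ((c ^+ 4) ^+ 2 + 1)) => f _; have [ru au] := inv1 f.
    have [_ uE] := bilap _ _ au; rewrite /H_bilaplacian_norm uE.
    rewrite -[X in _ * X](@ger0_norm _ `|f|)// -sqrtr_sqr -sqrtrM; last first.
      by rewrite addr_ge0// sqr_ge0.
    apply: ler_wsqrtr; rewrite mulrDl mul1r lerD2r -exprMn.
    apply: lerXn2r; rewrite ?nnegrE//; first exact: mulr_ge0.
    exact: (graph_adjoint_bound c4 (bG c hc) ru au).
- split.
    rewrite perpE.
    exact: (opnorm_adjoint c4 G0 sG (bG c hc) inv0 inv1).
  apply: ge_ereal_sup => _ [f [_ f1] <-]; rewrite lee_fin.
  apply: friedrichs_constant_le => // c' hc'.
  have [ru au] := inv1 f; have [c'0 _] := hc'.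
  have c'4 : 0 <= c' ^+ 4 by rewrite exprn_ge0// ltW.
  apply: le_trans (graph_adjoint_bound c'4 (bG c' hc') ru au) _.
  by rewrite ler_piMr.
- split=> [f|f].
    rewrite perpE => -[u Gu]; exists u; split.
      by split; [exact: Gdom Gu|exact: closure_is_bilaplacian].
    move=> v [v4 vf]; apply: (graph_uniq sG (bG c hc) Gu).
    by have := GP _ v4; rewrite (bilaplacian_eq vf).
  have [v [rv av]] := surj f; exists v; split.
    rewrite perpE; split=> //; first by have [] := bilap _ _ av.
    exact/closure_adjointP.
  rewrite perpE => v' [_ rv' /closure_adjointP av'].
  exact: (graph_adjoint_uniq c4 G0 sG (bG c hc) rv rv' av av').
Qed.
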